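(* Let $r\in\mathbb{N}$ be such that $q^{2r}<\frac12<q^{2r-2}$ and let $\gamma_r=(\beta^*\beta)^r(\beta-I)+I\in\mathcal{A}_f$. Given any $m\in\mathbb{Z}$, there exists an equivariant (odd) spectral triple $(\mathcal{A},\mathcal{H},D)$, with $D$ acting on $\mathcal{H}$, such that $\langle \gamma_r,[(\mathcal{A},\mathcal{H},D)]\rangle=m$, where $\langle\cdot,\cdot\rangle:K_1(\mathcal{A})\times K^1(\mathcal{A})\to\mathbb{Z}$ denotes the map coming from the Kasparov product.
   Context: Fix a real number $q\in(0,1)$. $\mathcal{A}=C(SU_q(2))$ is the $C^*$-algebra generated by $\alpha,\beta$ subject to $\alpha^*\alpha+\beta^*\beta=I$, $\alpha\alpha^*+q^2\beta\beta^*=I$, $\alpha\beta-q\beta\alpha=0$, $\alpha\beta^*-q\beta^*\alpha=0$, $\beta^*\beta=\beta\beta^*$; $\mathcal{A}_f$ is the dense $*$-subalgebra generated by $\alpha,\beta$. $\mathcal{H}$ is the GNS space of the (faithful) Haar state of $\mathcal{A}$. It has an orthonormal basis $\{e^{(n)}_{ij}: n=0,\frac12,1,\ldots;\ i,j=-n,-n+1,\ldots,n\}$ (normalized matrix entries of the irreducible representations), and $\mathcal{A}$ acts faithfully on $\mathcal{H}$ by $$\alpha e^{(n)}_{ij}=a_+(n,i,j)e^{(n+1/2)}_{i-1/2,j-1/2}+a_-(n,i,j)e^{(n-1/2)}_{i-1/2,j-1/2},\quad \beta e^{(n)}_{ij}=b_+(n,i,j)e^{(n+1/2)}_{i+1/2,j-1/2}+b_-(n,i,j)e^{(n-1/2)}_{i+1/2,j-1/2},$$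 $$a_+=\Bigl(q^{2(n+i)+2(n+j)+2}\tfrac{(1-q^{2n-2j+2})(1-q^{2n-2i+2})}{(1-q^{4n+2})(1-q^{4n+4})}\Bigr)^{1/2},\quad a_-=\Bigl(\tfrac{(1-q^{2n+2j})(1-q^{2n+2i})}{(1-q^{4n})(1-q^{4n+2})}\Bigr)^{1/2},$$ $$b_+=-\Bigl(q^{2(n+j)}\tfrac{(1-q^{2n-2j+2})(1-q^{2n+2i+2})}{(1-q^{4n+2})(1-q^{4n+4})}\Bigr)^{1/2},\quad b_-=\Bigl(q^{2(n+i)}\tfrac{(1-q^{2n+2j})(1-q^{2n-2i})}{(1-q^{4n})(1-q^{4n+2})}\Bigr)^{1/2},$$ where terms involving basis vectors with indices out of range are zero. Odd spectral triple: $(\mathcal{A},\mathcal{H},D)$ is an odd spectral triple if $D$ is self-adjoint on $\mathcal{H}$, has compact resolvent, and $[D,a]$ is bounded for all $a\in\mathcal{A}_f$. Equivariance: let $A_0 e^{(n)}_{ij}=q^je^{(n)}_{ij}$, and $A_1e^{(n)}_{ij}=(q^{-2n}+q^{2n+2}-q^{-2j}-q^{2j+2})^{1/2}e^{(n)}_{i,j+1}$ if $j<n$, $A_1e^{(n)}_{in}=0$. An operator is equivariant if it commutes with $A_0,A_1,A_1^*$. The spectral triple is equivariant if $D$ is. Index pairing: let $P$ be the projection onto the $-1$ eigenspace of $\mathrm{sign}\,D$ (the finite-dimensional kernel of $D$, if any, may be assigned either sign). For an invertible $\gamma\in\mathcal{A}$ (the element $\gamma_r$ is invertible for $r$ as in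 the claim), $P\gamma P$ is Fredholm on the range of $P$, and the $K$-theory–$K$-homology pairing of the class of $\gamma$ with the class of the triple is $\langle\gamma,[(\mathcal{A},\mathcal{H},D)]\rangle=-\mathrm{index}(P\gamma P)$. *)

(* Defs.v *)
From HB Require Import structures.
From mathcomp Require Import all_boot all_order all_algebra.
From mathcomp Require Import all_classical all_reals all_analysis.
From mathcomp.real_closed Require Import complex.
From mathcomp Require Import zify ring lra.
Import Order.TTheory GRing.Theory Num.Theory.
Import numFieldNormedType.Exports.
Import ComplexField.Normc.

Set Implicit Arguments.
Unset Strict Implicit.
Unset Printing Implicit Defensive.

Local Open Scope classical_set_scope.
Local Open Scope ring_scope.

Section SquareSummable.
Context {R : realType} {I : choiceType}.
Implicit Types f g : I -> R[i].

Definition sqsum f : \bar R := \esum_(t in [set: I]) ((normc (f t)) ^+ 2)%:E.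

Definition square_summable f : Prop := (sqsum f < +oo)%E.

Lemma sqsum_ge0 f : (0 <= sqsum f)%E.
Proof. by apply: esum_ge0 => t _; rewrite lee_fin sqr_ge0. Qed.

Lemma square_summable_fin f : square_summable f -> sqsum f \is a fin_num.
Proof. by move=> h; rewrite ge0_fin_numE // sqsum_ge0. Qed.

Lemma normc_ge0 (z : R[i]) : 0 <= normc z.
Proof. by case: z => a b; exact: sqrtr_ge0. Qed.

Lemma sqsumZ (c : R[i]) f :
  square_summable f ->
  sqsum (fun t => c * f t) = (((normc c) ^+ 2)%:E * sqsum f)%E.
Proof.
move=> hf.
suff le (d : R[i]) g : (sqsum (fun t => (d * g t)%R)
    <= ((normc d) ^+ 2)%:E * sqsum g)%E.
  apply/eqP; rewrite eq_le le /=.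
  have [->|c0] := eqVneq c 0.
    by rewrite normc0 expr0n /= mul0e sqsum_ge0.
  have nc : (0 < normc c ^+ 2)%R.
    rewrite exprn_gt0 // lt_def normc_ge0 andbT.
    by apply: contra_neq c0; exact: eq0_normc.
  have := le c^-1 (fun t => c * f t).
  under [X in sqsum X]eq_fun do rewrite mulKf //.
  move=> /(lee_pmul (x1 := ((normc c) ^+ 2)%:E)) H.
  apply: le_trans (H _ _ _ (lexx _)) _; rewrite ?sqsum_ge0 ?lee_fin ?sqr_ge0//.
  rewrite muleA -EFinM -exprMn -normcM divff // normc1 expr1n mul1e //.
apply: ub_ereal_sup => _ [F [finF _] <-].
under eq_fsbigr do rewrite normcM exprMn EFinM.
rewrite -ge0_mule_fsumr; last by move=> t; rewrite lee_fin sqr_ge0.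
apply: lee_pmul; rewrite ?lee_fin ?sqr_ge0 //.
  by apply: fsume_ge0 => t _; rewrite lee_fin sqr_ge0.
by apply: ereal_sup_ubound; exists F.
Qed.

Lemma square_summableZ (c : R[i]) f :
  square_summable f -> square_summable (fun t => c * f t).
Proof.
move=> hf; rewrite /square_summable sqsumZ //.
by rewrite -ge0_fin_numE ?mule_ge0 ?sqsum_ge0 ?lee_fin ?sqr_ge0 //
  fin_numM // square_summable_fin.
Qed.

Lemma sqsum_eq0 f : sqsum f = 0%E -> forall t, f t = 0.
Proof.
move=> h t; apply: eq0_normc; apply/eqP; rewrite -sqrf_eq0 eq_le sqr_ge0 andbT.
rewrite -lee_fin; apply: (le_trans (y := sqsum f)); last by rewrite h.
by apply: ereal_sup_ubound; exists [set t]; [split|rewrite fsbig_set1].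
Qed.

Definition l2norm f : R := Num.sqrt (fine (sqsum f)).

Lemma sqsum_l2norm f : square_summable f -> sqsum f = ((l2norm f) ^+ 2)%:E.
Proof.
move=> hf; rewrite /l2norm sqr_sqrtr ?fineK ?square_summable_fin //.
by rewrite fine_ge0 // sqsum_ge0.
Qed.

Lemma l2norm_ge0 f : 0 <= l2norm f.
Proof. exact: sqrtr_ge0. Qed.

Lemma l2norm_eq0 f : square_summable f -> l2norm f = 0 -> forall t, f t = 0.
Proof.
by move=> hf h; apply: sqsum_eq0; rewrite sqsum_l2norm // h expr0n.
Qed.

Lemma sqsumD_le f g : square_summable f -> square_summable g ->
  (sqsum (fun t => (f t + g t)%R) <= ((l2norm f + l2norm g) ^+ 2)%:E)%E.
Proof.
move=> hf hg.
have [f0|nf] := eqVneq (l2norm f) 0.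
  have -> : (fun t => f t + g t) = g.
    by apply/funext => t; rewrite (l2norm_eq0 hf f0) add0r.
  by rewrite f0 add0r sqsum_l2norm.
have [g0|ng] := eqVneq (l2norm g) 0.
  have -> : (fun t => f t + g t) = f.
    by apply/funext => t; rewrite (l2norm_eq0 hg g0) addr0.
  by rewrite g0 addr0 sqsum_l2norm.
set A := l2norm f in nf *; set B := l2norm g in ng *.
have A0 : 0 < A by rewrite lt_def nf l2norm_ge0.
have B0 : 0 < B by rewrite lt_def ng l2norm_ge0.
have pt t : (((normc (f t + g t)%R) ^+ 2)%:E <=
    ((A + B) / A)%:E * ((normc (f t)) ^+ 2)%:E +
    ((A + B) / B)%:E * ((normc (g t)) ^+ 2)%:E)%E.
  rewrite -!EFinM -EFinD lee_fin.
  have le1 : normc (f t + g t) ^+ 2 <= (normc (f t) + normc (g t)) ^+ 2.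
    by rewrite ler_sqr ?nnegrE ?addr_ge0 ?normc_ge0 //; exact: le_normcD.
  apply: le_trans le1 _.
  move: (normc (f t)) (normc (g t)) => x y.
  rewrite -subr_ge0.
  have -> : (A + B) / A * x ^+ 2 + (A + B) / B * y ^+ 2 - (x + y) ^+ 2
    = (B * x - A * y) ^+ 2 / (A * B).
    by field; rewrite nf ng.
  by rewrite divr_ge0 ?sqr_ge0 // mulr_ge0 // ltW.
apply: le_trans (le_esum (fun t _ => pt t)) _.
rewrite esumD; last 2 first.
- by move=> t _; rewrite -EFinM lee_fin mulr_ge0 ?sqr_ge0 // divr_ge0 // ?addr_ge0 // ltW.
- by move=> t _; rewrite -EFinM lee_fin mulr_ge0 ?sqr_ge0 // divr_ge0 // ?addr_ge0 // ltW.
have sc (c : R) h : 0 <= c -> square_summable h ->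
   (\esum_(t in [set: I]) (c%:E * ((normc (h t)) ^+ 2)%:E) = c%:E * sqsum h)%E.
  move=> c0 hh; have := sqsumZ ((Num.sqrt c)%:C)%C hh.
  have -> : (normc (Num.sqrt c)%:C%C) ^+ 2 = c.
    by rewrite /normc /= expr0n addr0 sqrtr_sqr ger0_norm ?sqrtr_ge0 // sqr_sqrtr.
  move=> <-; apply: eq_esum => t _; rewrite normcM exprMn -EFinM.
  congr (_ * _)%:E.
  by rewrite /normc /= expr0n addr0 sqrtr_sqr ger0_norm ?sqrtr_ge0 // sqr_sqrtr.
have AB : 0 <= A + B by rewrite addr_ge0 // ltW.
rewrite !sc //; [|exact: divr_ge0 (ltW _)..].
rewrite !sqsum_l2norm // -!EFinM -EFinD lee_fin.
rewrite -/A -/B le_eqVlt; apply/orP; left; apply/eqP.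
by field; rewrite nf ng.
Qed.

Lemma square_summableD f g : square_summable f -> square_summable g ->
  square_summable (fun t => f t + g t).
Proof.
move=> hf hg; apply: le_lt_trans (sqsumD_le hf hg) _.
exact: ltry.
Qed.

Lemma square_summable0 : square_summable (fun _ : I => 0 : R[i]).
Proof.
rewrite /square_summable /sqsum esum1 ?ltry // => t _.
by rewrite normc0 expr0n.
Qed.

End SquareSummable.

Record l2 (R : realType) (I : choiceType) := L2 {
  l2fun :> I -> R[i];
  l2P : square_summable l2fun }.

Section L2Space.
Context {R : realType} {I : choiceType}.
Local Notation H := (l2 R I).
Implicit Types x y : H.

HB.instance Definition _ := gen_eqMixin H.
HB.instance Definition _ := gen_choiceMixin H.

Lemma l2_ext x y : (forall t, x t = y t) -> x = y.
Proof.
case: x => f hf; case: y => g hg /= /funext fg.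
by case: _ / fg hg => hg; congr L2; exact: Prop_irrelevance.
Qed.

Definition l2_zero : H := L2 square_summable0.
Definition l2_add x y : H := L2 (square_summableD (l2P x) (l2P y)).
Definition l2_scale (c : R[i]) x : H := L2 (square_summableZ c (l2P x)).
Definition l2_opp x : H := l2_scale (-1) x.

Let addA : associative l2_add.
Proof. by move=> x y z; apply: l2_ext => t /=; rewrite addrA. Qed.
Let addC : commutative l2_add.
Proof. by move=> x y; apply: l2_ext => t /=; rewrite addrC. Qed.
Let add0 : left_id l2_zero l2_add.
Proof. by move=> x; apply: l2_ext => t /=; rewrite add0r. Qed.
Let addN : left_inverse l2_zero l2_opp l2_add.
Proof. by move=> x; apply: l2_ext => t /=; rewrite mulN1r addNr. Qed.

HB.instance Definition _ := GRing.isZmodule.Build H addA addC add0 addN.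

Let scaleA a b x : l2_scale a (l2_scale b x) = l2_scale (a * b) x.
Proof. by apply: l2_ext => t /=; rewrite mulrA. Qed.
Let scale1 : left_id 1 l2_scale.
Proof. by move=> x; apply: l2_ext => t /=; rewrite mul1r. Qed.
Let scaleDr : right_distributive l2_scale +%R.
Proof. by move=> c x y; apply: l2_ext => t /=; rewrite mulrDr. Qed.
Let scaleDl x : {morph l2_scale^~ x : a b / a + b}.
Proof. by move=> a b; apply: l2_ext => t /=; rewrite mulrDl. Qed.

HB.instance Definition _ :=
  GRing.Zmodule_isLmodule.Build R[i] H scaleA scale1 scaleDr scaleDl.

Lemma l2DE x y t : (x + y) t = x t + y t. Proof. by []. Qed.
Lemma l2ZE (c : R[i]) x t : (c *: x) t = c * x t. Proof. by []. Qed.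
Lemma l2_0E t : (0 : H) t = 0. Proof. by []. Qed.
Lemma l2NE x t : (- x) t = - x t. Proof. by rewrite -mulN1r. Qed.

Definition cnorm x : R[i] := (l2norm x)%:C%C.

Let cnormD x y : cnorm (x + y) <= cnorm x + cnorm y.
Proof.
rewrite /cnorm -rmorphD /= lecR -ler_sqr ?nnegrE ?addr_ge0 ?l2norm_ge0 //.
rewrite -lee_fin -(sqsum_l2norm (l2P (x + y))).
by apply: sqsumD_le; exact: l2P.
Qed.

Let cnormZ (c : R[i]) x : cnorm (c *: x) = `|c| * cnorm x.
Proof.
rewrite /cnorm -[`|c|]/((normc c)%:C%C) -rmorphM /=; congr (_%:C)%C.
rewrite /l2norm (sqsumZ c (l2P x)) fineM ?(square_summable_fin (l2P x)) //.
by rewrite /= sqrtrM ?sqr_ge0 // sqrtr_sqr ger0_norm // normc_ge0.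
Qed.

Let cnorm0 x : cnorm x = 0 -> x = 0.
Proof.
move=> [h]; apply: l2_ext => t /=.
by rewrite (l2norm_eq0 (l2P x) h).
Qed.

HB.instance Definition _ := Lmodule_isNormed.Build R[i] H cnormD cnormZ cnorm0.

(* The norm of a complex normed module takes its values in R[i]. *)
Lemma l2_normE x : `|x| = (l2norm x)%:C%C. Proof. by []. Qed.

End L2Space.

Section InnerProduct.
Context {R : realType} {I : choiceType}.
Local Notation H := (l2 R I).

(* rsum and csum are meant for absolutely summable families only. *)
Definition rsum (f : I -> R) : R :=
  fine (\esum_(t in [set: I]) (Num.max (f t) 0)%:E) -
  fine (\esum_(t in [set: I]) (Num.max (- f t) 0)%:E).

Definition csum (f : I -> R[i]) : R[i] :=
  (rsum (fun t => complex.Re (f t)) +i* rsum (fun t => complex.Im (f t)))%C.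

(* Linear in the first argument. *)
Definition inner (x y : H) : R[i] := csum (fun t => x t * (y t)^*%C).

Lemma innerxx (x : H) : inner x x = `|x| ^+ 2.
Proof.
have E t : x t * (x t)^*%C = (normc (x t) ^+ 2)%:C%C.
  by rewrite -sqr_normc -rmorphXn.
rewrite /inner /csum; under [in X in (X +i* _)%C]eq_fun do rewrite E /=.
under [in X in (_ +i* X)%C]eq_fun do rewrite E /=.
have s0 : (\esum_(t in [set: I]) (0 : R)%:E = 0)%E by rewrite esum1.
have -> : rsum (fun _ : I => 0) = 0 by rewrite /rsum oppr0 maxxx s0 subrr.
rewrite l2_normE -rmorphXn /=; congr (_%:C)%C; rewrite /rsum.
under eq_esum do rewrite max_l ?sqr_ge0 //.
under [in X in _ - X]eq_esum do rewrite max_r ?oppr_le0 ?sqr_ge0 //.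
by rewrite s0 subr0 -[LHS]/(fine (sqsum x)) (sqsum_l2norm (l2P x)).
Qed.

End InnerProduct.

Section Operators.
Context {R : realType} {I : choiceType}.
Local Notation H := (l2 R I).
Implicit Types (S T K P : H -> H) (U V : set H) (D A : set (H * H)).

Definition bounded_op T : Prop :=
  linear T /\ exists M : R[i], forall x, `|T x| <= M * `|x|.

(* The Hilbert space adjoint, which exists for bounded T; otherwise possibly
   a junk value. *)
Definition adj T : H -> H :=
  xget T [set S | forall x y, inner (T x) y = inner x (S y)].

Definition compact_op K : Prop :=
  bounded_op K /\ compact (closure (K @` [set x | `|x| <= 1])).

(* The unital *-algebra of operators generated by G. *)
Inductive star_alg (G : set (H -> H)) : set (H -> H) :=
| star_alg_gen T : G T -> star_alg G T
| star_alg_id : star_alg G id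
| star_alg_add S T : star_alg G S -> star_alg G T ->
    star_alg G (fun x => S x + T x)
| star_alg_scale (c : R[i]) T : star_alg G T -> star_alg G (fun x => c *: T x)
| star_alg_comp S T : star_alg G S -> star_alg G T -> star_alg G (S \o T)
| star_alg_adj T : star_alg G T -> star_alg G (adj T).

Definition op_closure (B : set (H -> H)) : set (H -> H) :=
  [set T | linear T /\ forall e : R, 0 < e ->
     exists2 S, B S & forall x, `|T x - S x| <= e%:C%C * `|x|].

(* Unbounded operators are given by their graphs, as subsets of H * H. *)

Definition dom A : set H := [set x | exists y, A (x, y)].

Definition adjoint_graph A : set (H * H) :=
  [set yz | forall x w, A (x, w) -> inner w yz.1 = inner x yz.2].

(* adjoint_graph D is always a closed linear subspace, and it is single-valued
   when dom D is dense, so such a D is the graph of a linear operator. *)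
Definition self_adjoint D : Prop := dense (dom D) /\ D = adjoint_graph D.

(* K = (D - l)^-1 *)
Definition is_resolvent D (l : R[i]) K : Prop :=
  [/\ bounded_op K, forall y, D (K y, y + l *: K y) &
      forall x y, D (x, y) -> K (y - l *: x) = x].

Definition compact_resolvent D : Prop :=
  exists l K, is_resolvent D l K /\ compact_op K.

(* T preserves dom D, and D T - T D is bounded on dom D. *)
Definition bounded_commutator D T : Prop :=
  exists M : R[i], forall x y, D (x, y) ->
    exists2 z, D (T x, z) & `|z - T y| <= M * `|x|.

(* A self-adjoint D commutes with a closed operator A when its resolvents K
   satisfy K A <= A K. *)
Definition commutes_with D A : Prop :=
  forall l K, is_resolvent D l K -> forall x y, A (x, y) -> A (K x, K y).

Definition odd_spectral_triple (Af : set (H -> H)) D : Prop :=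
  [/\ self_adjoint D, compact_resolvent D &
      forall T, Af T -> bounded_commutator D T].

(* S = sign D, with sign 0 = 1.  For D self-adjoint with compact resolvent the
   eigenvectors of D are total, so that this determines S. *)
Definition is_sign D S : Prop :=
  bounded_op S /\ forall (l : R) x, D (x, l%:C%C *: x) ->
    S x = (if l < 0 then -1 else 1) *: x.

Definition orth_proj P V : Prop :=
  forall x, V (P x) /\ forall v, V v -> inner (x - P x) v = 0.

(* The quotient space V / U (for U contained in V) has dimension n. *)
Definition quot_dim V U (n : nat) : Prop :=
  exists b : 'I_n -> H,
  [/\ forall k, V (b k),
      forall c : 'I_n -> R[i], U (\sum_k c k *: b k) -> forall k, c k = 0 &
      forall x, V x -> exists c : 'I_n -> R[i], U (x - \sum_k c k *: b k)].

(* T restricts to a Fredholm operator V -> V of index k.  The range of a bounded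
   operator between Hilbert spaces is closed when it has finite codimension. *)
Definition fredholm_index V T (k : int) : Prop :=
  exists n p : nat,
  [/\ forall x, V x -> V (T x),
      quot_dim [set x | V x /\ T x = 0] [set 0] n,
      quot_dim V (T @` V) p & k = n%:Z - p%:Z].

Definition invertible_in (A : set (H -> H)) T : Prop :=
  A T /\ exists S, [/\ A S, T \o S = id & S \o T = id].

(* <[g], [(A, H, D)]> = m, the pairing being - index (P g P) with P the projection
   onto the eigenspace of sign D for the eigenvalue -1. *)
Definition index_pairing (A : set (H -> H)) (g : H -> H) D (m : int) : Prop :=
  invertible_in A g /\
  exists S P k, [/\ is_sign D S, orth_proj P [set x | S x = - x],
    fredholm_index (range P) (P \o g \o P) k & m = - k].

End Operators.

(* The label (n, i, j) of e^(n)_ij is encoded as (N, a, b) with N = 2n,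
   a = n + i and b = n + j, so that a and b range over 0 .. N. *)
Definition idx := {t : nat * nat * nat | (t.1.2 <= t.1.1) && (t.2 <= t.1.1)}%N.

Section SUq2.
Context {R : realType} (q : R).
Local Notation H := (l2 R idx).
Implicit Types (x y : H) (N a b : nat).

Definition coord x N a b : R[i] := oapp x 0 (insub (N, a, b) : option idx).

(* In the exponents of q below, 2(n+i) = 2a, 2(n+j) = 2b, 2n-2i = 2(N-a),
   2n-2j = 2(N-b) and 4n = 2N.  At N = 0 the last two coefficients are
   divisions by zero and vanish, as they should: their target is out of range. *)

Definition a_plus N a b : R :=
  Num.sqrt (q ^+ (2 * a + 2 * b + 2) *
    ((1 - q ^+ (2 * (N - b) + 2)) * (1 - q ^+ (2 * (N - a) + 2)) /
     ((1 - q ^+ (2 * N + 2)) * (1 - q ^+ (2 * N + 4))))).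

Definition a_minus N a b : R :=
  Num.sqrt ((1 - q ^+ (2 * b)) * (1 - q ^+ (2 * a)) /
    ((1 - q ^+ (2 * N)) * (1 - q ^+ (2 * N + 2)))).

Definition b_plus N a b : R :=
  - Num.sqrt (q ^+ (2 * b) *
    ((1 - q ^+ (2 * (N - b) + 2)) * (1 - q ^+ (2 * a + 2)) /
     ((1 - q ^+ (2 * N + 2)) * (1 - q ^+ (2 * N + 4))))).

Definition b_minus N a b : R :=
  Num.sqrt (q ^+ (2 * a) *
    ((1 - q ^+ (2 * b)) * (1 - q ^+ (2 * (N - a))) /
     ((1 - q ^+ (2 * N)) * (1 - q ^+ (2 * N + 2))))).

(* The junk value 0 does not occur in alpha and beta: see alphaE and betaE. *)
Definition mkl2 (f : idx -> R[i]) : H :=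
  if pselect (square_summable f) is left h then L2 h else 0.

(* Coordinates of alpha x and beta x for an arbitrary x in l2; the action on the
   basis e^(n)_ij is given by alpha_basis and beta_basis. *)
Definition alpha_fun x (t : idx) : R[i] :=
  let: (N, a, b) := val t in
  (if (0 < N)%N then (a_plus N.-1 a b)%:C%C * coord x N.-1 a b else 0) +
  (a_minus N.+1 a.+1 b.+1)%:C%C * coord x N.+1 a.+1 b.+1.

Definition beta_fun x (t : idx) : R[i] :=
  let: (N, a, b) := val t in
  (if (0 < a)%N then (b_plus N.-1 a.-1 b)%:C%C * coord x N.-1 a.-1 b else 0) +
  (b_minus N.+1 a b.+1)%:C%C * coord x N.+1 a b.+1.

Definition alpha x : H := mkl2 (alpha_fun x).
Definition beta x : H := mkl2 (beta_fun x).

Definition SUq2_poly : set (H -> H) := star_alg [set alpha; beta].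
(* C(SU_q(2)) in its faithful representation on the GNS space. *)
Definition SUq2 : set (H -> H) := op_closure SUq2_poly.

(* (beta^* beta)^r (beta - 1) + 1 *)
Definition gamma (r : nat) x : H :=
  iter r (adj beta \o beta) (beta x - x) + x.

(* A_0 and A_1 are taken with their maximal domains.  The exponent of q in A_0
   is j = b - N/2. *)
Definition A0 : set (H * H) :=
  [set xy : H * H | forall t : idx, let: (N, a, b) := val t in
     xy.2 t = (q `^ (b%:R - N%:R / 2))%:C%C * xy.1 t].

(* 2j = 2b - N *)
Definition A1_coef N b : R :=
  Num.sqrt (q ^ (- N%:Z) + q ^ (N%:Z + 2)
            - q ^ (N%:Z - (2 * b)%:Z) - q ^ ((2 * b)%:Z - N%:Z + 2)).

Definition A1 : set (H * H) :=
  [set xy : H * H | forall t : idx, let: (N, a, b) := val t in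
     xy.2 t = if b is b'.+1 then (A1_coef N b')%:C%C * coord xy.1 N a b'
              else 0].

Definition equivariant (D : set (H * H)) : Prop :=
  [/\ commutes_with D A0, commutes_with D A1 &
      commutes_with D (adjoint_graph A1)].


Definition delta (t s : idx) : R[i] := (s == t)%:R.

Lemma delta_summable t : square_summable (delta t).
Proof.
rewrite /square_summable /sqsum.
rewrite (_ : \esum_(s in _) _ = \esum_(s in [set t]) (1 : R)%:E)%E.
  by rewrite esum_set1 ?lee_fin ?ler01 // ltry.
rewrite [RHS]esum_mkcond; apply: eq_esum => s _; rewrite /delta (_ : (s \in [set t]) = (s == t)); last by apply/idP/eqP; rewrite inE.
by case: eqVneq => _; rewrite ?normc1 ?normc0 ?expr1n ?expr0n.
Qed.

(* e^(n)_ij, and 0 when the indices are out of range *)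
Definition basis N a b : H :=
  oapp (fun t => L2 (delta_summable t)) 0 (insub (N, a, b) : option idx).

Lemma square_summable_shift (g : idx -> option idx) (w : idx -> R[i]) x :
  (forall s s' t, g s = Some t -> g s' = Some t -> s = s') ->
  (forall s t, g s = Some t -> normc (w s) <= 1) ->
  square_summable (fun s => w s * oapp x 0 (g s)).
Proof.
move=> ginj w1; apply: le_lt_trans (l2P x).
pose S := [set s | g s != None].
apply: (le_trans (y := \esum_(s in S)
   ((normc (oapp x 0 (g s))) ^+ 2)%:E)%E).
  rewrite [leRHS]esum_mkcond; apply: le_esum => s _.
  case: ifPn => [|]; rewrite ?inE ?notin_setE /S /=.
    case gs: (g s) => [t|] // _; rewrite lee_fin /= normcM exprMn.
    by rewrite ler_piMl ?sqr_ge0 // exprn_ile1 ?normc_ge0 // (w1 _ _ gs).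
  by move=> /negP/negPn/eqP -> /=; rewrite mulr0 normc0 expr0n.
have inj : set_inj S (fun s => odflt s (g s)).
  move=> s s'; rewrite !inE /S /=.
  case gs: (g s) => [t|] // _; case gs': (g s') => [t'|] //= _ tt'.
  by apply: (ginj _ _ t) => //; rewrite tt'.
rewrite (_ : (\esum_(s in S) _)%E =
   \esum_(t in (fun s => odflt s (g s)) @` S) ((normc (x t)) ^+ 2)%:E)%E; last first.
  rewrite esum_image //; apply: eq_esum => s; rewrite /S /=.
  by case: (g s).
rewrite esum_mkcond; apply: le_esum => t _.
by case: ifP => // _; rewrite lee_fin sqr_ge0.
Qed.

Context (hq : 0 < q < 1).

Let q01 k : 0 <= 1 - q ^+ k <= 1.
Proof.
case/andP: hq => q0 q1; rewrite lerBlDr lerDl.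
by rewrite subr_ge0 exprn_ile1 ?exprn_ge0 ?ltW.
Qed.

Let q_gt0 k : (0 < k)%N -> 0 < 1 - q ^+ k.
Proof.
by case/andP: hq => q0 q1 k0; rewrite subr_gt0 exprn_ilt1 ?ltW // -lt0n.
Qed.

Let q_mono k l : (k <= l)%N -> 1 - q ^+ k <= 1 - q ^+ l.
Proof.
by case/andP: hq => q0 q1 kl; rewrite lerD2l lerN2 ler_wiXn2l ?ltW.
Qed.

Let sqrt_le1 k u v w z : (0 < w)%N -> (0 < z)%N -> (u <= w)%N -> (v <= z)%N ->
  Num.sqrt (q ^+ k * ((1 - q ^+ u) * (1 - q ^+ v) /
    ((1 - q ^+ w) * (1 - q ^+ z)))) <= 1.
Proof.
move=> w0 z0 uw vz; rewrite -[leRHS]sqrtr1 ler_wsqrtr //.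
case/andP: hq => q0 q1.
have /andP[u0 _] := q01 u; have /andP[v0 _] := q01 v.
have wz : 0 < (1 - q ^+ w) * (1 - q ^+ z) by rewrite mulr_gt0 ?q_gt0.
have uvwz : 0 <= (1 - q ^+ u) * (1 - q ^+ v) / ((1 - q ^+ w) * (1 - q ^+ z)).
  by apply: divr_ge0; [exact: mulr_ge0|exact: ltW].
rewrite mulr_ile1 ?exprn_ge0 ?exprn_ile1 ?(ltW q0) ?(ltW q1) //.
by rewrite ler_pdivrMr // mul1r ler_pM // q_mono.
Qed.

Let normcR (c : R) : normc c%:C%C = `|c|.
Proof. by rewrite /normc /= expr0n addr0 sqrtr_sqr. Qed.

Lemma a_plus_le1 N a b : (a <= N)%N -> (b <= N)%N -> `|a_plus N a b| <= 1.
Proof.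
move=> aN bN; rewrite ger0_norm ?sqrtr_ge0 //.
by apply: sqrt_le1; rewrite ?addn_gt0 ?orbT //; lia.
Qed.

Lemma a_minus_le1 N a b : (0 < N)%N -> (a <= N)%N -> (b <= N)%N ->
  `|a_minus N a b| <= 1.
Proof.
move=> N0 aN bN; rewrite ger0_norm ?sqrtr_ge0 // /a_minus.
have := @sqrt_le1 0 (2 * b) (2 * a) (2 * N) (2 * N + 2).
by rewrite expr0 mul1r; apply; lia.
Qed.

Lemma b_plus_le1 N a b : (a <= N)%N -> (b <= N)%N -> `|b_plus N a b| <= 1.
Proof.
move=> aN bN; rewrite normrN ger0_norm ?sqrtr_ge0 //.
by apply: sqrt_le1; lia.
Qed.

Lemma b_minus_le1 N a b : (0 < N)%N -> (a <= N)%N -> (b <= N)%N ->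
  `|b_minus N a b| <= 1.
Proof.
move=> N0 aN bN; rewrite ger0_norm ?sqrtr_ge0 //.
by apply: sqrt_le1; lia.
Qed.

Lemma alphaE x t : alpha x t = alpha_fun x t.
Proof.
rewrite /alpha /mkl2; case: pselect => // -[].
pose g1 (t : idx) : option idx := let: (N, a, b) := val t in
  if (0 < N)%N then (insub (N.-1, a, b) : option idx) else None.
pose g2 (t : idx) : option idx := let: (N, a, b) := val t in
  insub (N.+1, a.+1, b.+1) : option idx.
pose w1 (t : idx) := let: (N, a, b) := val t in (a_plus N.-1 a b)%:C%C.
pose w2 (t : idx) := let: (N, a, b) := val t in (a_minus N.+1 a.+1 b.+1)%:C%C.
rewrite (_ : alpha_fun x = fun t => w1 t * oapp x 0 (g1 t) + w2 t * oapp x 0 (g2 t)).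
  apply: square_summableD; apply: square_summable_shift.
  - move=> [[[N a] b] ?] [[[N' a'] b'] ?] s; rewrite /g1 /=.
    case: ifP => // N0; case: ifP => // N0'.
    case: insubP => // u _ Eu [<-]; case: insubP => // v _ Ev [vu].
    by move: Ev; rewrite vu Eu => -[] ? ? ?; apply: val_inj => /=; congr (_, _, _) => //; lia.
  - move=> [[[N a] b] h] s; rewrite /g1 /=.
    case: ifP => // N0; case: insubP => //= u /andP[/= ha hb] _ _.
    by have := a_plus_le1 ha hb; rewrite -normcR.
  - move=> [[[N a] b] ?] [[[N' a'] b'] ?] s; rewrite /g2 /=.
    case: insubP => // u _ Eu [<-]; case: insubP => // v _ Ev [vu].
    by move: Ev; rewrite vu Eu => -[] ? ? ?; apply: val_inj => /=; congr (_, _, _) => //; lia.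
  - move=> [[[N a] b] h] s; rewrite /g2 /=.
    case: insubP => //= u /andP[/= ha hb] _ _.
    by have := a_minus_le1 (ltn0Sn _) ha hb; rewrite -normcR.
apply/funext => -[[[N a] b] h]; rewrite /alpha_fun /g1 /g2 /w1 /w2 /=.
by case: ifP => // _; rewrite mulr0.
Qed.

Lemma betaE x t : beta x t = beta_fun x t.
Proof.
rewrite /beta /mkl2; case: pselect => // -[].
pose g1 (t : idx) : option idx := let: (N, a, b) := val t in
  if (0 < a)%N then (insub (N.-1, a.-1, b) : option idx) else None.
pose g2 (t : idx) : option idx := let: (N, a, b) := val t in
  insub (N.+1, a, b.+1) : option idx.
pose w1 (t : idx) := let: (N, a, b) := val t in (b_plus N.-1 a.-1 b)%:C%C.
pose w2 (t : idx) := let: (N, a, b) := val t in (b_minus N.+1 a b.+1)%:C%C.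
rewrite (_ : beta_fun x = fun t => w1 t * oapp x 0 (g1 t) + w2 t * oapp x 0 (g2 t)).
  apply: square_summableD; apply: square_summable_shift.
  - move=> [[[N a] b] /= h] [[[N' a'] b'] /= h'] s; rewrite /g1 /=.
    case: ifP => // N0; case: ifP => // N0'.
    case: insubP => // u _ Eu [<-]; case: insubP => // v _ Ev [vu].
    by move: Ev; rewrite vu Eu => -[] ? ? ?; apply: val_inj => /=; congr (_, _, _) => //; lia.
  - move=> [[[N a] b] h] s; rewrite /g1 /=.
    case: ifP => // N0; case: insubP => //= u /andP[/= ha hb] _ _.
    by have := b_plus_le1 ha hb; rewrite -normcR.
  - move=> [[[N a] b] ?] [[[N' a'] b'] ?] s; rewrite /g2 /=.
    case: insubP => // u _ Eu [<-]; case: insubP => // v _ Ev [vu].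
    by move: Ev; rewrite vu Eu => -[] ? ? ?; apply: val_inj => /=; congr (_, _, _) => //; lia.
  - move=> [[[N a] b] h] s; rewrite /g2 /=.
    case: insubP => //= u /andP[/= ha hb] _ _.
    by have := b_minus_le1 (ltn0Sn _) ha hb; rewrite -normcR.
apply/funext => -[[[N a] b] h]; rewrite /beta_fun /g1 /g2 /w1 /w2 /=.
by case: ifP => // _; rewrite mulr0.
Qed.

Let coord_basis N a b N' a' b' : (a <= N)%N -> (b <= N)%N ->
  coord (basis N a b) N' a' b' = ((N', a', b') == (N, a, b))%:R.
Proof.
move=> aN bN; rewrite /coord /basis.
case: (insubP _ (N, a, b)) => [u _ Eu|]; last by rewrite /= aN bN.
case: insubP => [v _ Ev|h] /=; first by rewrite /delta -val_eqE Ev Eu.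
by case: eqP h => [[-> -> ->]|] //; rewrite /= aN bN.
Qed.

Let basisE N a b (t : idx) : (a <= N)%N -> (b <= N)%N ->
  basis N a b t = (val t == (N, a, b))%:R.
Proof.
move=> aN bN; rewrite -(coord_basis _ _ _ aN bN) /coord.
by case: t => [[[N' a'] b'] /= h]; rewrite insubT.
Qed.

Let a_minus0 N a b : (a == 0)%N || (b == 0)%N -> a_minus N a b = 0.
Proof.
rewrite /a_minus => /orP[] /eqP ->;
  by rewrite muln0 expr0 subrr ?mul0r ?mulr0 ?mul0r sqrtr0.
Qed.

Let b_minus0 N a b : (a == N)%N || (b == 0)%N -> b_minus N a b = 0.
Proof.
rewrite /b_minus => /orP[] /eqP ->;
  by rewrite ?subnn muln0 expr0 subrr ?mul0r ?mulr0 ?mul0r ?mulr0 sqrtr0.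
Qed.

Lemma alpha_basis N a b : (a <= N)%N -> (b <= N)%N ->
  alpha (basis N a b) = (a_plus N a b)%:C%C *: basis N.+1 a b +
                        (a_minus N a b)%:C%C *: basis N.-1 a.-1 b.-1.
Proof.
move=> aN bN; apply: l2_ext => t; rewrite alphaE l2DE !l2ZE basisE ?leqW //.
case: t => [[[N' a'] b'] h]; rewrite /alpha_fun /= !coord_basis //; congr (_ + _).
  case: ltnP => N0; last by case: eqP => [[]|]; [lia|rewrite mulr0].
  rewrite (_ : ((N'.-1, a', b') == _) = ((N', a', b') == (N.+1, a, b))).
    by case: eqP => [[-> -> ->]|_]; rewrite ?mulr0.
  by apply/eqP/eqP => -[E1 E2 E3]; congr (_, _, _); lia.
have [/a_minus0 ab0|ab] := boolP ((a == 0) || (b == 0))%N.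
  rewrite ab0 mul0r; case: eqP => [[E1 E2 E3]|_]; last by rewrite mulr0.
  by rewrite E1 E2 E3 ab0 mul0r.
rewrite basisE; [|lia..].
rewrite [in RHS](_ : ((N', a', b') == _) = ((N'.+1, a'.+1, b'.+1) == (N, a, b))).
  by case: eqP => [[<- <- <-]|_]; rewrite ?mulr0.
by apply/eqP/eqP => -[E1 E2 E3]; congr (_, _, _); lia.
Qed.

Lemma beta_basis N a b : (a <= N)%N -> (b <= N)%N ->
  beta (basis N a b) = (b_plus N a b)%:C%C *: basis N.+1 a.+1 b +
                       (b_minus N a b)%:C%C *: basis N.-1 a b.-1.
Proof.
move=> aN bN; apply: l2_ext => t; rewrite betaE l2DE !l2ZE basisE; [|lia..].
case: t => [[[N' a'] b'] /= h]; rewrite /beta_fun /= !coord_basis //; congr (_ + _).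
  case: ltnP => a0; last by case: eqP => [[]|]; [lia|rewrite mulr0].
  rewrite (_ : ((N'.-1, a'.-1, b') == _) = ((N', a', b') == (N.+1, a.+1, b))).
    by case: eqP => [[-> -> ->]|_]; rewrite ?mulr0.
  by apply/eqP/eqP => -[E1 E2 E3]; congr (_, _, _); lia.
have [/b_minus0 ab0|ab] := boolP ((a == N) || (b == 0))%N.
  rewrite ab0 mul0r; case: eqP => [[E1 E2 E3]|_]; last by rewrite mulr0.
  by rewrite E1 E2 E3 ab0 mul0r.
rewrite basisE; [|lia..].
rewrite [in RHS](_ : ((N', a', b') == _) = ((N'.+1, a', b'.+1) == (N, a, b))).
  by case: eqP => [[<- <- <-]|_]; rewrite ?mulr0.
by apply/eqP/eqP => -[E1 E2 E3]; congr (_, _, _); lia.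
Qed.

End SUq2.

(* Main.v *)
Require Import Defs.
From mathcomp Require Import all_boot all_order all_algebra.
From mathcomp Require Import all_classical all_reals all_analysis.
From mathcomp.real_closed Require Import complex.
From mathcomp Require Import zify ring lra.
Import Order.TTheory GRing.Theory Num.Theory.
Import numFieldNormedType.Exports.
Import ComplexField.Normc.

Set Implicit Arguments.
Unset Strict Implicit.
Unset Printing Implicit Defensive.

Local Open Scope classical_set_scope.
Local Notation coord := Defs.coord.
Local Open Scope ring_scope.

(** Write e(N,a,b) for the basis vector with N = 2n, a = n + i, b = n + j.  The
    operator D is diagonal, with eigenvalue (N + 1) or -(N + 1) at e(N,a,b), where
    the sign depends on N and a only.  The operators A_0 and A_1 move b only, so D
    is equivariant; the eigenvalues have finite multiplicity and tend to infinity,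
    so the resolvent is compact ([compact_tails]).  The generators are sums of
    weighted shifts that change N by one, hence a commutator with D is bounded as
    soon as the weights of the shifts that change the sign are O(1/N).  This holds
    if the negative eigenvalues are those of the region N - a < k, N >= N0, or those
    of its complement: the shifts between the lines N - a = k - 1 and N - a = k have
    weights O(q^N) ([dirac_commutator_weight]).

    Let V be spanned by the e(N,a,b) of the region and let P be the projection onto
    V.  On V, up to an error that tends to 0 when N0 grows, beta maps e(N,a,b) to
    -q^b e(N+1,a+1,b), so that beta^* beta is multiplication by q^(2b) and gamma_r
    is q^(2br) (beta - 1) + 1 ([gamma_asymp]).  For b = 0 this is minus the
    unilateral shift along each of the k lines N - a = 0, ..., k - 1; for b > 0 it
    differs from 1 by at most 2 q^(2r) in norm.  As 2 q^(2r) < 1, for N0 large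
    P gamma_r P is at distance less than 1 from the isometry [model], which is this
    shift for b = 0 and the identity for b > 0.  By a Neumann series P gamma_r P is
    injective on V and its range has codimension k, as for the isometry
    ([compression_shift]): the index is -k and the pairing is k.  Taking N0 large
    replaces the perturbation of Fredholm operators by compact ones with norm
    estimates.

    For a negative pairing the sign of D is reversed, and gamma_r has to be
    compressed to the range of Q = 1 - P.  The corner Q gamma_r P is small, so that
    G = gamma_r - Q gamma_r P is invertible; it maps V into V, and Q G Q = Q gamma_r Q.
    An invertible operator that preserves V induces on the quotient by V a surjection
    with kernel isomorphic to V / G V, which has dimension k ([index_complement]).

    That gamma_r is invertible follows from the relations of SU_q(2).  With
    c = beta^* beta they give c^n (1 - c) = q^(2n) alpha^* c^n alpha, which isolates
    the point 1 of the spectrum of c.  For v = 1 - gamma_r this makes v^J (1 - c)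
    of order (2 q^(2r))^J, and an explicit polynomial in beta and beta^* inverts
    gamma_r up to such a term ([gamma_inverse]). *)

(** * The norm of l2 *)

Section L2Norm.
Context {R : realType} {I : choiceType}.
Local Notation H := (l2 R I).
Implicit Types (x y : H) (M : R) (D : set I) (g : I -> I).

Lemma normcR (c : R) : normc c%:C%C = `|c|.
Proof. by rewrite /normc /= expr0n addr0 sqrtr_sqr. Qed.

Lemma normc_Re (z : R[i]) : `|complex.Re z| <= normc z.
Proof. by case: z => a b /=; rewrite -sqrtr_sqr ler_wsqrtr // lerDl sqr_ge0. Qed.

Lemma normc_Im (z : R[i]) : `|complex.Im z| <= normc z.
Proof. by case: z => a b /=; rewrite -sqrtr_sqr ler_wsqrtr // lerDr sqr_ge0. Qed.

Lemma normcJ (z : R[i]) : normc z^*%C = normc z.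
Proof. by case: z => a b /=; rewrite sqrrN. Qed.

Lemma l2normD x y : l2norm (x + y) <= l2norm x + l2norm y.
Proof. by have := ler_normD x y; rewrite !l2_normE -rmorphD lecR. Qed.

Lemma l2normZ (c : R[i]) x : l2norm (c *: x) = normc c * l2norm x.
Proof.
by have := normrZ c x; rewrite !l2_normE -[`|c|]/((normc c)%:C%C) -rmorphM => -[].
Qed.

Lemma l2normN x : l2norm (- x) = l2norm x.
Proof. by have := normrN x; rewrite !l2_normE => -[]. Qed.

Lemma l2norm0 : l2norm (0 : H) = 0.
Proof. by have := @normr0 _ H; rewrite l2_normE => -[]. Qed.

Lemma l2normB x y : l2norm (x - y) <= l2norm x + l2norm y.
Proof. by rewrite -(l2normN y) l2normD. Qed.

Lemma l2norm0_eq x : l2norm x = 0 -> x = 0.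
Proof. by move=> h; apply: l2_ext => t; rewrite (l2norm_eq0 (l2P x) h). Qed.

Lemma normc_coord_le x t : normc (x t) <= l2norm x.
Proof.
rewrite -ler_sqr ?nnegrE ?l2norm_ge0 ?normc_ge0 // -lee_fin -(sqsum_l2norm (l2P x)).
by apply: ereal_sup_ubound; exists [set t]; [split|rewrite fsbig_set1].
Qed.

(** A rearrangement of some of the coordinates of x, with weights bounded by M; the
    bounds on shifts, diagonal operators and cutoffs are instances. *)
Lemma sqsum_reindex_le (f : I -> R[i]) x D g M : 0 <= M -> set_inj D g ->
  (forall s, ~ D s -> f s = 0) ->
  (forall s, D s -> normc (f s) <= M * normc (x (g s))) ->
  (sqsum f <= ((M * l2norm x) ^+ 2)%:E)%E.
Proof.
move=> M0 gI f0 fM.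
rewrite exprMn EFinM -(sqsum_l2norm (l2P x)).
have -> : sqsum f = (\esum_(s in D) ((normc (f s)) ^+ 2)%:E)%E.
  rewrite [RHS]esum_mkcond; apply: eq_esum => s _; case: ifPn => //.
  by rewrite notin_setE => /f0 ->; rewrite normc0 expr0n.
apply: (@le_trans _ _ (\esum_(s in D) (M ^+ 2 * (normc (x (g s))) ^+ 2)%:E)%E).
  apply: le_esum => s Ds; rewrite lee_fin -exprMn ler_sqr ?nnegrE ?normc_ge0 ?fM //.
  by rewrite mulr_ge0 ?normc_ge0.
have -> : (\esum_(s in D) (M ^+ 2 * (normc (x (g s))) ^+ 2)%:E =
   \esum_(t in g @` D) (M ^+ 2 * (normc (x t)) ^+ 2)%:E)%E.
  by rewrite esum_image.
apply: (@le_trans _ _ (sqsum (fun t => M%:C%C * x t))).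
  rewrite /sqsum [leLHS]esum_mkcond; apply: le_esum => t _.
  case: ifP => _; last by rewrite lee_fin sqr_ge0.
  by rewrite lee_fin normcM normcR exprMn real_normK // num_real.
by rewrite sqsumZ; [rewrite normcR real_normK // num_real|exact: l2P].
Qed.

Lemma sqsum_le_summable (f : I -> R[i]) (c : R) :
  (sqsum f <= c%:E)%E -> square_summable f.
Proof. by move=> h; apply: le_lt_trans h (ltry _). Qed.

Lemma l2norm_le x (c : R) : 0 <= c -> (sqsum x <= (c ^+ 2)%:E)%E -> l2norm x <= c.
Proof.
by move=> c0; rewrite (sqsum_l2norm (l2P x)) lee_fin ler_sqr ?nnegrE ?l2norm_ge0.
Qed.

Lemma l2norm_reindex_le x y D g M : 0 <= M -> set_inj D g ->
  (forall s, ~ D s -> y s = 0) ->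
  (forall s, D s -> normc (y s) <= M * normc (x (g s))) ->
  l2norm y <= M * l2norm x.
Proof.
move=> M0 gI y0 yM; apply: l2norm_le; first by rewrite mulr_ge0 ?l2norm_ge0.
exact: sqsum_reindex_le gI y0 yM.
Qed.

Lemma l2norm_le_coord x y M : 0 <= M ->
  (forall s, normc (y s) <= M * normc (x s)) -> l2norm y <= M * l2norm x.
Proof.
move=> M0 yM; apply: (@l2norm_reindex_le _ _ setT id) => // s.
by move/(_ Logic.I).
Qed.

End L2Norm.

(** * Weighted shifts *)

Section Shifts.
Context {R : realType}.
Local Notation H := (l2 R idx).
Implicit Types (x y : H) (f : idx -> idx) (w : idx -> R) (M : R).

Lemma mkl2E (f : idx -> R[i]) : square_summable f -> forall t, mkl2 f t = f t.
Proof. by move=> hf t; rewrite /mkl2; case: pselect. Qed.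

Definition weight_bounded w := exists M, forall s, `|w s| <= M.

Definition partial_inv f (t : idx) : option idx :=
  if pselect (exists s, f s = t) is left h then Some (projT1 (cid h)) else None.

Lemma partial_invK f s : injective f -> partial_inv f (f s) = Some s.
Proof.
move=> fI; rewrite /partial_inv; case: pselect => [h|[]]; last by exists s.
by case: cid => u /= /fI ->.
Qed.

Lemma partial_invP f s t : partial_inv f t = Some s -> f s = t.
Proof. by rewrite /partial_inv; case: pselect => // h; case: cid => u /= ? [<-]. Qed.

(** [up f w] is the shift e_s |-> w(s) e_(f s) along an injection f, and [dn f w] is
    its adjoint.  For unbounded w the value may be the default one of [mkl2]. *)
Definition up f w x : H :=
  mkl2 (fun t => if partial_inv f t is Some s then (w s)%:C%C * x s else 0).
Definition dn f w x : H := mkl2 (fun s => (w s)%:C%C * x (f s)).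

Section Bounds.
Context (f : idx -> idx) (w : idx -> R) (fI : injective f).

Let up_fun x t := if partial_inv f t is Some s then (w s)%:C%C * x s else 0.

Let up_sqsum M x : 0 <= M -> (forall s, x s != 0 -> `|w s| <= M) ->
  (sqsum (up_fun x) <= ((M * l2norm x) ^+ 2)%:E)%E.
Proof.
move=> M0 wM.
apply: (@sqsum_reindex_le _ _ _ _ [set t | partial_inv f t != None]
  (fun t => odflt t (partial_inv f t))) => //.
- move=> t t'; rewrite !inE /=.
  case E: (partial_inv f t) => [s|] // _; case E': (partial_inv f t') => [s'|] //= _ ss.
  by rewrite -(partial_invP E) -(partial_invP E') ss.
- by move=> t; rewrite /= /up_fun; case: (partial_inv f t) => // s [].
- move=> t; rewrite /= /up_fun; case: (partial_inv f t) => // s _ /=.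
  rewrite normcM normcR; have [->|/wM h] := eqVneq (x s) 0.
    by rewrite normc0 !mulr0.
  by rewrite ler_wpM2r // normc_ge0.
Qed.

Let dn_sqsum M x : 0 <= M -> (forall s, x (f s) != 0 -> `|w s| <= M) ->
  (sqsum (fun s => ((w s)%:C%C * x (f s))%R) <= ((M * l2norm x) ^+ 2)%:E)%E.
Proof.
move=> M0 wM; apply: (@sqsum_reindex_le _ _ _ _ setT f) => //.
- by move=> s t _ _ /fI.
- by move=> s [].
- move=> s _; rewrite normcM normcR; have [->|/wM h] := eqVneq (x (f s)) 0.
    by rewrite normc0 !mulr0.
  by rewrite ler_wpM2r // normc_ge0.
Qed.

Context (wb : weight_bounded w).

Let wb0 : exists2 M, 0 <= M & forall s, `|w s| <= M.
Proof.
by case: wb => M wM; exists (`|M|) => // s; apply: le_trans (wM s) (ler_norm _).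
Qed.

Lemma upE x t : up f w x t = if partial_inv f t is Some s then (w s)%:C%C * x s else 0.
Proof.
rewrite /up mkl2E //; case: wb0 => M M0 wM.
by apply: sqsum_le_summable (up_sqsum (x := x) M0 _) => s _.
Qed.

Lemma dnE x s : dn f w x s = (w s)%:C%C * x (f s).
Proof.
rewrite /dn mkl2E //; case: wb0 => M M0 wM.
by apply: sqsum_le_summable (dn_sqsum (x := x) M0 _) => t _.
Qed.

Lemma up_in x s : up f w x (f s) = (w s)%:C%C * x s.
Proof. by rewrite upE partial_invK. Qed.

Lemma up_out x t : (forall s, f s <> t) -> up f w x t = 0.
Proof. by move=> h; rewrite upE; case E: partial_inv => [s|] //; case: (h _ (partial_invP E)). Qed.

Lemma up_le M x : 0 <= M -> (forall s, x s != 0 -> `|w s| <= M) ->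
  l2norm (up f w x) <= M * l2norm x.
Proof.
move=> M0 wM; apply: l2norm_le; first by rewrite mulr_ge0 ?l2norm_ge0.
rewrite (_ : l2fun _ = up_fun x); first exact: up_sqsum.
by apply/funext => t; rewrite upE.
Qed.

Lemma dn_le M x : 0 <= M -> (forall s, x (f s) != 0 -> `|w s| <= M) ->
  l2norm (dn f w x) <= M * l2norm x.
Proof.
move=> M0 wM; apply: l2norm_le; first by rewrite mulr_ge0 ?l2norm_ge0.
rewrite (_ : l2fun _ = fun s => (w s)%:C%C * x (f s)); first exact: dn_sqsum.
by apply/funext => t; rewrite dnE.
Qed.

Lemma up_linear : linear (up f w).
Proof.
move=> c x y; apply: l2_ext => t; rewrite l2DE l2ZE !upE.
by case: partial_inv => [s|]; rewrite ?l2DE ?l2ZE ?mulr0 ?addr0 // mulrDr mulrCA.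
Qed.

Lemma dn_linear : linear (dn f w).
Proof.
by move=> c x y; apply: l2_ext => t; rewrite l2DE l2ZE !dnE l2DE l2ZE mulrDr mulrCA.
Qed.

End Bounds.
End Shifts.

(** * The inner product *)

Section Inner.
Context {R : realType} {I : choiceType}.
Local Notation H := (l2 R I).
Implicit Types (x y z : H) (f g : I -> R).

Let absum f := (\esum_(t in [set: I]) `|f t|%:E < +oo)%E.

Let pos_fin f : absum f -> (\esum_(t in [set: I]) (Num.max (f t) 0)%:E)%E \is a fin_num.
Proof.
move=> hf; rewrite ge0_fin_numE; last first.
  by apply: esum_ge0 => t _; rewrite lee_fin le_max lexx orbT.
apply: le_lt_trans hf; apply: le_esum => t _.
by rewrite lee_fin ge_max normr_ge0 ler_norm.
Qed.

Let absumN f : absum f -> absum (fun t => - f t).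
Proof. by rewrite /absum; under [in X in _ -> X]eq_esum do rewrite normrN. Qed.

Let absumD f g : absum f -> absum g -> absum (fun t => f t + g t).
Proof.
move=> hf hg; apply: (@le_lt_trans _ _
  (\esum_(t in [set: I]) (`|f t|%:E + `|g t|%:E))%E).
  by apply: le_esum => t _; rewrite -EFinD lee_fin ler_normD.
by rewrite esumD ?lte_add_pinfty // => t _; rewrite lee_fin.
Qed.

(** Positive parts are not additive, but (f + g)^+ + f^- + g^- = (f + g)^- + f^+ + g^+
    relates sums of nonnegative families, which are. *)
Let rsumD f g : absum f -> absum g ->
  rsum (fun t => f t + g t) = rsum f + rsum g.
Proof.
move=> hf hg; rewrite /rsum.
have hN := absumN hf; have gN := absumN hg; have hD := absumD hf hg.
have DN := absumN hD.
have m0 (a : R) : (0 <= (Num.max a 0)%:E)%E by rewrite lee_fin le_max lexx orbT.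
have E : (\esum_(t in [set: I]) (Num.max (f t + g t) 0)%:E +
          (\esum_(t in [set: I]) (Num.max (- f t) 0)%:E +
           \esum_(t in [set: I]) (Num.max (- g t) 0)%:E) =
          \esum_(t in [set: I]) (Num.max (- (f t + g t)) 0)%:E +
          (\esum_(t in [set: I]) (Num.max (f t) 0)%:E +
           \esum_(t in [set: I]) (Num.max (g t) 0)%:E))%E.
  rewrite -!esumD ?adde_ge0 //; last 2 first.
  - by move=> *; rewrite adde_ge0.
  - by move=> *; rewrite adde_ge0.
  apply: eq_esum => t _; rewrite -!EFinD; congr EFin.
  by case: (ltP (f t + g t) 0); case: (ltP (f t) 0); case: (ltP (g t) 0);
    case: (ltP (- (f t + g t)) 0); case: (ltP (- f t) 0); case: (ltP (- g t) 0); lra.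
have := congr1 fine E.
rewrite !fineD ?fin_numD ?pos_fin //.
lra.
Qed.

Let rsumN f : rsum (fun t => - f t) = - rsum f.
Proof. by rewrite /rsum opprB; congr (_ - fine _); apply: eq_esum => t _; rewrite opprK. Qed.

Let absum_prod x y f :
  (forall t, `|f t| <= normc (x t) * normc (y t)) -> absum f.
Proof.
move=> hf; apply: (@le_lt_trans _ _ (sqsum x + sqsum y)%E).
  rewrite /sqsum -esumD; [|by move=> t _; rewrite lee_fin sqr_ge0..].
  apply: le_esum => t _; rewrite -EFinD lee_fin; apply: le_trans (hf t) _.
  have := normc_ge0 (x t); have := normc_ge0 (y t).
  by move: (normc _) (normc _) => a b; nra.
by rewrite lte_add_pinfty //; exact: l2P.
Qed.

Lemma inner_eq x y x' y' :
  (forall t, x t * (y t)^*%C = x' t * (y' t)^*%C) -> inner x y = inner x' y'.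
Proof. by move=> h; rewrite /inner; congr csum; apply/funext. Qed.

Lemma innerDl x x' y : inner (x + x') y = inner x y + inner x' y.
Proof.
rewrite /inner /csum.
have hR (u : H) : absum (fun t => complex.Re (u t * (y t)^*%C)).
  by apply: (@absum_prod u y) => t; rewrite -(normcJ (y t)) -normcM normc_Re.
have hI (u : H) : absum (fun t => complex.Im (u t * (y t)^*%C)).
  by apply: (@absum_prod u y) => t; rewrite -(normcJ (y t)) -normcM normc_Im.
apply/eqP; rewrite eq_complex /= -!rsumD //; apply/andP; split; apply/eqP;
  by congr rsum; apply/funext => t; rewrite -raddfD -mulrDl.
Qed.

Lemma innerC x y : inner y x = (inner x y)^*%C.
Proof.
rewrite /inner /csum /=; apply/eqP; rewrite eq_complex /= -rsumN.
apply/andP; split; apply/eqP; congr rsum; apply/funext => t;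
  by case: (x t) (y t) => a b [c d] /=; ring.
Qed.

Lemma innerDr x y y' : inner x (y + y') = inner x y + inner x y'.
Proof. by rewrite (innerC (y + y') x) (innerC y x) (innerC y' x) innerDl rmorphD. Qed.

Lemma innerZl (c : R[i]) x y : inner (c *: x) y = inner x (c^*%C *: y).
Proof.
apply: inner_eq => t; rewrite !l2ZE.
by case: c (x t) (y t) => a b [c d] [e f] /=; congr (_ +i* _)%C; ring.
Qed.

Lemma inner_real x : inner x x = ((l2norm x) ^+ 2)%:C%C.
Proof. by rewrite innerxx l2_normE -rmorphXn. Qed.

Lemma inner_supp1 x y t : (forall s, s != t -> x s = 0) ->
  inner x y = x t * (y t)^*%C.
Proof.
move=> x0; rewrite /inner /csum.
have h (f : I -> R) : (forall s, s != t -> f s = 0) -> rsum f = f t.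
  move=> f0.
  have h1 (g : I -> R) : (forall s, s != t -> g s = 0) -> (forall s, 0 <= g s) ->
      (\esum_(s in [set: I]) (g s)%:E = (g t)%:E)%E.
    move=> g0 gge.
    rewrite -[RHS](esum_set1 (a := EFin \o g) (t := t)) ?lee_fin //.
    rewrite [RHS]esum_mkcond; apply: eq_esum => s _ /=.
    case: ifPn => //; rewrite notin_setE /= => /eqP st.
    by rewrite g0.
  rewrite /rsum !h1 /=; first by case: (ltP (f t) 0); case: (ltP (- f t) 0); lra.
  - by move=> s st; rewrite f0 // oppr0 maxxx.
  - by move=> s; rewrite le_max lexx orbT.
  - by move=> s st; rewrite f0 // maxxx.
  - by move=> s; rewrite le_max lexx orbT.
by rewrite !h; [case: (_ * _)|move=> s st; rewrite x0 // mul0r..].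
Qed.

Lemma inner_disjoint x y : (forall t, x t * (y t)^*%C = 0) -> inner x y = 0.
Proof.
move=> h.
have -> : inner x y = inner (0 : H) 0 by apply: inner_eq => t; rewrite h mul0r.
by rewrite innerxx normr0 expr0n.
Qed.

End Inner.

Section InnerShift.
Context {R : realType}.
Local Notation H := (l2 R idx).

Let rsum_image (f : idx -> idx) (F : idx -> R) : injective f ->
  (forall t, (forall s, f s <> t) -> F t = 0) ->
  rsum F = rsum (fun s => F (f s)).
Proof.
move=> fI F0.
have h (G : idx -> R) : (forall t, (forall s, f s <> t) -> G t = 0) ->
    (forall t, 0 <= G t) ->
    (\esum_(t in [set: idx]) (G t)%:E = \esum_(s in [set: idx]) (G (f s))%:E)%E.
  move=> G0 Gge.
  have <- := @esum_image R _ _ [set: idx] f (EFin \o G); last by move=> s t _ _ /fI.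
  rewrite [RHS]esum_mkcond; apply: eq_esum => t _ /=.
  case: ifPn => //; rewrite notin_setE /= => ht.
  by rewrite G0 // => s fs; apply: ht; exists s.
rewrite /rsum (h (fun t => Num.max (F t) 0)); last 2 first.
- by move=> t /F0 ->; rewrite maxxx.
- by move=> t; rewrite le_max lexx orbT.
rewrite (h (fun t => Num.max (- F t) 0)) //.
- by move=> t /F0 ->; rewrite oppr0 maxxx.
- by move=> t; rewrite le_max lexx orbT.
Qed.

Lemma inner_up (f : idx -> idx) (w : idx -> R) (x y : H) :
  injective f -> weight_bounded w ->
  inner (up f w x) y = inner x (dn f w y).
Proof.
move=> fI wb; rewrite /inner /csum.
congr (_ +i* _)%C; (rewrite (rsum_image fI);
  last by move=> t h; rewrite up_out // mul0r);
  congr rsum; apply/funext => s;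
  rewrite up_in // dnE //; case: (x s) (y (f s)) => a b [c d] /=; ring.
Qed.

Lemma inner_dn (f : idx -> idx) (w : idx -> R) (x y : H) :
  injective f -> weight_bounded w ->
  inner (dn f w x) y = inner x (up f w y).
Proof. by move=> fI wb; rewrite innerC -inner_up // -innerC. Qed.

End InnerShift.

(** * Completeness and Neumann series *)

Lemma expr_small {R : realType} (rho e : R) : 0 <= rho < 1 -> 0 < e ->
  exists n0, forall n, (n0 <= n)%N -> rho ^+ n < e.
Proof.
move=> /andP[r0 r1] e0.
have /cvgrPdist_lt/(_ e e0)[n0 _ h] : (GRing.exp rho : R ^nat) @ \oo --> 0.
  by apply: cvg_expr; rewrite ger0_norm.
exists n0 => n /h /=; rewrite sub0r normrN ger0_norm // exprn_ge0 //.
Qed.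

Lemma geometric_le0 {R : realType} (a C rho : R) : 0 <= rho < 1 ->
  (forall n, a <= C * rho ^+ n) -> a <= 0.
Proof.
move=> rho01 h; rewrite leNgt; apply/negP => a0.
have C0 : 0 < C by have := h 0%N; rewrite expr0 mulr1; exact: lt_le_trans.
have [n /(_ n (leqnn n)) hn] := expr_small rho01 (divr_gt0 a0 C0).
by have := h n; rewrite leNgt mulrC -ltr_pdivlMr // hn.
Qed.

(** The limit is the supremum of the lower bounds u n - B n, which are all below the
    upper bounds u m + B m. *)
Lemma cauchy_limit {R : realType} (u B : nat -> R) :
  (forall n m, `|u n - u m| <= B n + B m) -> exists l, forall n, `|u n - l| <= B n.
Proof.
move=> h; pose E := range (fun n => u n - B n).
have ub m : ubound E (u m + B m).
  by move=> _ [n _ <-]; have := h n m; rewrite ler_norml => /andP[_]; lra.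
have E0 : E !=set0 by exists (u 0%N - B 0%N), 0%N.
exists (sup E) => n; rewrite ler_norml; apply/andP; split.
  by have := ge_sup E0 (ub n); lra.
have := @ub_le_sup _ E _ (u n - B n) _.
have h1 : has_ubound E by exists (u 0%N + B 0%N).
by move=> /(_ h1) /(_ (imageT _ _)); lra.
Qed.

Section Complete.
Context {R : realType} {I : choiceType}.
Local Notation H := (l2 R I).
Implicit Types (x y : H).

Lemma seq_sum_le x (s : seq I) : uniq s ->
  \sum_(t <- s) normc (x t) ^+ 2 <= l2norm x ^+ 2.
Proof.
move=> us; rewrite -lee_fin -(sqsum_l2norm (l2P x)) -sumEFin.
apply: ereal_sup_ubound; exists [set` s]; first by split.
by rewrite -fsbig_seq.
Qed.

(** A Fatou lemma: a family approximated, on each finite set of indices, by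
    elements of the ball of radius C lies in this ball. *)
Lemma sqsum_fatou (f : I -> R[i]) (C : R) : 0 <= C ->
  (forall (s : seq I) (e : R), 0 < e -> exists x : H, l2norm x <= C /\
     forall t, t \in s -> normc (f t - x t) <= e) ->
  (sqsum f <= (C ^+ 2)%:E)%E.
Proof.
move=> C0 h; apply: ub_ereal_sup => _ [F [finF _] <-].
rewrite fsbig_finite //; set s := finmap.enum_fset _.
rewrite sumEFin lee_fin -subr_le0.
apply: (@geometric_le0 _ _ (2 * C * (size s)%:R + (size s)%:R) 2^-1).
  by rewrite invr_ge0 ler0n invf_lt1 // ltr1n.
move=> n; set e := 2^-1 ^+ n.
have e0 : 0 < e by rewrite exprn_gt0 // invr_gt0.
have e1 : e <= 1 by rewrite exprn_ile1 // ?invr_ge0 // invf_le1 // ler1n.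
have [x [xC fx]] := h s e e0.
have us : uniq s by exact: finmap.fset_uniq.
apply: (@le_trans _ _ (\sum_(t <- s) (normc (x t) ^+ 2 + (2 * C * e + e)) - C ^+ 2)).
  rewrite lerD2r big_seq [leRHS]big_seq; apply: ler_sum => t ts.
  have h1 : normc (f t) <= normc (x t) + e.
    rewrite -[f t](subrK (x t)) addrC; apply: le_trans (le_normcD _ _) _.
    by rewrite lerD2l fx.
  have h2 := le_trans (normc_coord_le x t) xC.
  have h3 := normc_ge0 (x t); have h4 := normc_ge0 (f t).
  apply: (@le_trans _ _ ((normc (x t) + e) ^+ 2)); first by rewrite ler_sqr ?nnegrE ?addr_ge0 // ltW.
  have -> : (normc (x t) + e) ^+ 2 = normc (x t) ^+ 2 + (2 * normc (x t) * e + e * e) by ring.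
  by rewrite lerD2l lerD // ?ler_wpM2r ?ler_wpM2l // ?ler_piMl // ltW.
rewrite big_split /= big_const_seq iter_addr_0 count_predT.
have := seq_sum_le x us.
have : l2norm x ^+ 2 <= C ^+ 2 by rewrite ler_sqr ?nnegrE ?l2norm_ge0.
rewrite -mulr_natr; lra.
Qed.

(** The coordinates converge, and [sqsum_fatou] turns the bounds on x m - x n into
    bounds on the distance to the coordinatewise limit. *)
Lemma l2_complete (x : nat -> H) (C rho : R) : 0 <= rho < 1 ->
  (forall n, l2norm (x n.+1 - x n) <= C * rho ^+ n) ->
  exists y, forall n, l2norm (x n - y) <= C / (1 - rho) * rho ^+ n.
Proof.
move=> rho01 hx; have /andP[r0 r1] := rho01.
pose B n := C / (1 - rho) * rho ^+ n.
have d0 : 0 < 1 - rho by rewrite subr_gt0.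
have C0 : 0 <= C.
  by have := le_trans (l2norm_ge0 _) (hx 0%N); rewrite expr0 mulr1.
have B0 n : 0 <= B n by rewrite mulr_ge0 ?divr_ge0 ?exprn_ge0 ?subr_ge0 // ltW.
have BS n : C * rho ^+ n + B n.+1 = B n.
  by rewrite /B exprS; field; rewrite gt_eqF.
have step n k : l2norm (x (n + k)%N - x n) <= B n - B (n + k)%N.
  elim: k => [|k IH]; first by rewrite addn0 !subrr l2norm0.
  rewrite addnS (_ : _ - x n = (x (n + k).+1 - x (n + k)%N) + (x (n + k)%N - x n));
    last by rewrite addrA subrK.
  apply: le_trans (l2normD _ _) _.
  by have := hx (n + k)%N; have := BS (n + k)%N; lra.
have xnm n m : l2norm (x n - x m) <= B n + B m.
  case: (leqP n m) => [|/ltnW] le.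
    rewrite -l2normN opprB -(subnKC le); apply: le_trans (step _ _) _.
    by have := B0 (n + (m - n))%N; lra.
  rewrite -(subnKC le); apply: le_trans (step _ _) _.
  by have := B0 (m + (n - m))%N; lra.
have coo (p : R[i] -> R) : (forall z w, p (z - w) = p z - p w) ->
    (forall z, `|p z| <= normc z) ->
    forall t, exists l, forall n, `|p (x n t) - l| <= B n.
  move=> pB ple t; apply: cauchy_limit => n m; rewrite -pB.
  have := le_trans (normc_coord_le (x n - x m) t) (xnm n m).
  by rewrite l2DE l2NE; apply: le_trans (ple _).
have cRe := coo (@complex.Re R); have cIm := coo (@complex.Im R).
pose f t := ((projT1 (cid (cRe (fun z w => raddfB _ z w) (@normc_Re R) t))) +i*
             (projT1 (cid (cIm (fun z w => raddfB _ z w) (@normc_Im R) t))))%C.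
have hf t n : normc (x n t - f t) <= 2 * B n.
  rewrite /f; case: cid => a ha; case: cid => b hb /=.
  have -> : x n t - (a +i* b)%C =
     (complex.Re (x n t) - a)%:C%C + (0 +i* (complex.Im (x n t) - b))%C.
    case: (x n t) => c d; apply/eqP; rewrite eq_complex /=.
    by apply/andP; split; apply/eqP; ring.
  apply: le_trans (le_normcD _ _) _; rewrite normcR /= expr0n add0r sqrtr_sqr.
  by have := ha n; have := hb n; lra.
have sq n : (sqsum (fun t => (x n t - f t)%R) <= (B n ^+ 2)%:E)%E.
  apply: sqsum_fatou => // s e e0.
  have c0 : 0 < 2 * (C / (1 - rho)) + 1.
    by rewrite ltr_pwDr // mulr_ge0 // divr_ge0 // ltW.
  have [k /(_ (n + k)%N (leq_addl _ _)) hm] := expr_small rho01 (divr_gt0 e0 c0).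
  have Bm : 2 * B (n + k)%N <= e.
    move: hm; rewrite ltr_pdivlMr // /B.
    have : 0 <= rho ^+ (n + k) by rewrite exprn_ge0.
    move: (C / (1 - rho)) (rho ^+ (n + k)) (divr_ge0 C0 (ltW d0)) => a b a0 b0; lra.
  exists (x n - x (n + k)%N); split.
    by rewrite -l2normN opprB; have := step n k; have := B0 (n + k)%N; lra.
  move=> t _; rewrite l2DE l2NE (_ : _ - _ = x (n + k)%N t - f t); last by ring.
  exact: le_trans (hf t _) Bm.
have sm : square_summable (fun t => x 0%N t - f t) := sqsum_le_summable (sq 0%N).
exists (x 0%N - L2 sm) => n; apply: l2norm_le; first exact: (B0 n).
rewrite [X in (X <= _)%E](_ : _ = sqsum (fun t => x n t - f t)); first exact: sq.
by congr sqsum; apply/funext => t; rewrite !(l2DE, l2NE) /=; ring.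
Qed.
End Complete.

Ltac l2ring := apply: l2_ext => ?; rewrite ?(l2DE, l2NE, l2ZE, l2_0E); ring.

Section Neumann.
Context {R : realType} {I : choiceType}.
Local Notation H := (l2 R I).
Implicit Types (x y : H) (K S T : H -> H).

Lemma lin0 T : linear T -> T 0 = 0.
Proof. by move=> h; have := h (-1) 0 0; rewrite scaler0 addr0 scaleN1r addNr. Qed.

Lemma linD T x y : linear T -> T (x + y) = T x + T y.
Proof. by move=> h; have := h 1 x y; rewrite !scale1r. Qed.

Lemma linZ T (c : R[i]) x : linear T -> T (c *: x) = c *: T x.
Proof. by move=> h; have := h c x 0; rewrite (lin0 h) !addr0. Qed.

Lemma linN T x : linear T -> T (- x) = - T x.
Proof. by move=> h; rewrite -[- x]scaleN1r (linZ _ _ h) scaleN1r. Qed.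

Lemma linB T x y : linear T -> T (x - y) = T x - T y.
Proof. by move=> h; rewrite (linD _ _ h) (linN _ h). Qed.

Lemma lin_sum T (J : Type) (s : seq J) (F : J -> H) : linear T ->
  T (\sum_(j <- s) F j) = \sum_(j <- s) T (F j).
Proof.
move=> h; elim: s => [|j s IH]; first by rewrite !big_nil (lin0 h).
by rewrite !big_cons (linD _ _ h) IH.
Qed.

Lemma lin_comp S T : linear S -> linear T -> linear (S \o T).
Proof. by move=> hS hT c x y /=; rewrite hT hS. Qed.

Lemma lin_iter T n : linear T -> linear (iter n T).
Proof. by move=> h; elim: n => [|n IH] c x y //=; rewrite IH h. Qed.

Lemma iter_le T (M : R) n x : 0 <= M -> (forall x, l2norm (T x) <= M * l2norm x) ->
  l2norm (iter n T x) <= M ^+ n * l2norm x.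
Proof.
move=> M0 h; elim: n => [|n IH] /=; first by rewrite expr0 mul1r.
by apply: le_trans (h _) _; rewrite exprS -mulrA ler_wpM2l.
Qed.

Lemma l2norm_geom0 x (C rho : R) : 0 <= rho < 1 ->
  (forall n, l2norm x <= C * rho ^+ n) -> x = 0.
Proof.
move=> rho01 h; apply: l2norm0_eq; apply/eqP; rewrite eq_le l2norm_ge0 andbT.
exact: geometric_le0 rho01 h.
Qed.

(** The speed of convergence of the partial sums is part of the conclusion, in order
    to see that the inverse lies in any C*-algebra that contains K. *)
Lemma neumann K (rho : R) : linear K -> 0 <= rho < 1 ->
  (forall x, l2norm (K x) <= rho * l2norm x) ->
  exists S, [/\ linear S, forall x, S x - K (S x) = x, forall x, S (x - K x) = x,
    forall x, l2norm (S x) <= (1 - rho)^-1 * l2norm x &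
    forall n x, l2norm (\sum_(j < n) iter j K x - S x)
                  <= (1 - rho)^-1 * rho ^+ n * l2norm x].
Proof.
move=> Kl rho01 Kle; have /andP[r0 r1] := rho01.
pose s n x := \sum_(j < n) iter j K x.
have sS n x : s n.+1 x - s n x = iter n K x by rewrite /s big_ord_recr /=; l2ring.
have kl j := @lin_iter K j Kl.
have sl n : linear (s n).
  move=> c x y; rewrite /s scaler_sumr -big_split /=; apply: eq_bigr => j _.
  by rewrite (kl j).
have hs x n : l2norm (s n.+1 x - s n x) <= l2norm x * rho ^+ n.
  by rewrite sS mulrC iter_le.
have ex x := l2_complete rho01 (hs x).
pose S x := projT1 (cid (ex x)).
have SP x n : l2norm (s n x - S x) <= (1 - rho)^-1 * rho ^+ n * l2norm x.
  by rewrite /S; case: cid => y /= /(_ n) h; apply: le_trans h _; rewrite (mulrC (l2norm x)) -!mulrA (mulrC (l2norm x)).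
have KB n x : s n x - K (s n x) = x - iter n K x.
  elim: n => [|n IH]; first by rewrite /s big_ord0 (lin0 Kl) !subrr.
  have -> : s n.+1 x = s n x + iter n K x by rewrite -sS addrC subrK.
  by rewrite (linD _ _ Kl) opprD addrACA IH /= addrA subrK.
have sK n x : s n (K x) = K (s n x).
  by rewrite /s (lin_sum _ _ Kl); apply: eq_bigr => j _; rewrite -iterSr.
exists S; split.
- move=> c x y; apply/eqP; rewrite -subr_eq0; apply/eqP.
  apply: (@l2norm_geom0 _ ((1 - rho)^-1 * (l2norm (c *: x + y) + normc c * l2norm x + l2norm y)) _ rho01) => n.
  rewrite (_ : S (c *: x + y) - (c *: S x + S y) =
     - (s n (c *: x + y) - S (c *: x + y)) + (c *: (s n x - S x) + (s n y - S y))); last first.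
    by rewrite sl; l2ring.
  apply: le_trans (l2normD _ _) _; rewrite l2normN.
  apply: le_trans (lerD (SP _ n) (l2normD _ _)) _; rewrite l2normZ.
  have := SP x n; have := SP y n; have := normc_ge0 c.
  move: (l2norm (s n x - S x)) (l2norm (s n y - S y)) (normc c) => a b d d0 h1 h2.
  have := ler_wpM2l d0 h2; lra.
- move=> x; apply/eqP; rewrite -subr_eq0; apply/eqP.
  apply: (@l2norm_geom0 _ ((1 - rho)^-1 * (1 + rho) * l2norm x + l2norm x) _ rho01) => n.
  rewrite (_ : S x - K (S x) - x = - (s n x - S x) + K (s n x - S x) + ((s n x - K (s n x)) - x)); last first.
    by rewrite (linB _ _ Kl); l2ring.
  rewrite KB (_ : x - iter n K x - x = - iter n K x); last by l2ring.
  apply: le_trans (l2normB _ _) _; apply: le_trans (lerD (l2normD _ _) (iter_le _ _ r0 Kle)) _.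
  rewrite l2normN; have := SP x n; have := Kle (s n x - S x).
  move: (l2norm (s n x - S x)) (l2norm (K _)) => a b h1 h2.
  have := ler_wpM2l r0 h2; lra.
- move=> x; apply/eqP; rewrite -subr_eq0; apply/eqP.
  apply: (@l2norm_geom0 _ ((1 - rho)^-1 * l2norm (x - K x) + l2norm x) _ rho01) => n.
  rewrite (_ : S (x - K x) - x = - (s n (x - K x) - S (x - K x)) + (s n (x - K x) - x)); last first.
    by l2ring.
  rewrite (linB _ _ (sl n)) sK KB (_ : x - iter n K x - x = - iter n K x); last by l2ring.
  apply: le_trans (l2normB _ _) _; rewrite l2normN.
  have := SP (x - K x) n; rewrite (linB _ _ (sl n)) sK KB.
  have := iter_le n x r0 Kle; lra.
- move=> x; have := SP x 0%N; rewrite /s big_ord0 sub0r l2normN expr0 mulr1 //.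
- by move=> n x; exact: SP.
Qed.

End Neumann.

(** * Operators with an adjoint *)

Section BoundedAdjoint.
Context {R : realType} {I : choiceType}.
Local Notation H := (l2 R I).
Implicit Types (x y : H) (S T : H -> H) (D : set (H * H)).

Definition bounded_by T (M : R) := forall x, l2norm (T x) <= M * l2norm x.
Definition bounded T := linear T /\ exists2 M, 0 <= M & bounded_by T M.

Lemma bounded_bounded_op T : bounded T -> bounded_op T.
Proof.
move=> [lT [M M0 TM]]; split=> //; exists M%:C%C => x.
by rewrite !l2_normE -rmorphM lecR.
Qed.

Definition adjoint_of S T := forall x y, inner (T x) y = inner x (S y).

Lemma adjoint_ofC S T : adjoint_of S T -> adjoint_of T S.
Proof. by move=> h x y; rewrite innerC -h -innerC. Qed.

Lemma adj_unique S T : adjoint_of S T -> adj T = S.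
Proof.
move=> ST; apply: xget_unique => //= S' S'T; apply/funext => y.
apply/eqP; rewrite -subr_eq0; apply/eqP; set x := S' y - S y.
apply: l2norm0_eq; apply/eqP; rewrite -sqrf_eq0; apply/eqP.
have : inner x x = 0.
  have : inner x (S' y) = inner x (S y) by rewrite -S'T -ST.
  rewrite -[S' y](subrK (S y)) -/x innerDr => /eqP.
  by rewrite -subr_eq0 addrK => /eqP.
by rewrite inner_real => -[].
Qed.

Lemma bounded_id : bounded (@id H).
Proof. by split=> //; exists 1 => // x; rewrite mul1r. Qed.

Lemma boundedD S T : bounded S -> bounded T -> bounded (fun x => S x + T x).
Proof.
move=> [lS [M M0 SM]] [lT [N N0 TN]]; split.
  by move=> c x y; rewrite lS lT scalerDr addrACA.
exists (M + N) => [|x]; first exact: addr_ge0.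
by rewrite mulrDl; apply: le_trans (l2normD _ _) _; exact: lerD.
Qed.

Lemma boundedZ (c : R[i]) T : bounded T -> bounded (fun x => c *: T x).
Proof.
move=> [lT [N N0 TN]]; split.
  by move=> d x y; rewrite lT scalerDr !scalerA mulrC.
exists (normc c * N) => [|x]; first by rewrite mulr_ge0 ?normc_ge0.
by rewrite l2normZ -mulrA ler_wpM2l ?normc_ge0.
Qed.

Lemma bounded_comp S T : bounded S -> bounded T -> bounded (S \o T).
Proof.
move=> [lS [M M0 SM]] [lT [N N0 TN]]; split; first exact: lin_comp.
exists (M * N) => [|x /=]; first exact: mulr_ge0.
by apply: le_trans (SM _) _; rewrite -mulrA ler_wpM2l.
Qed.

Definition commutator_bounded D T := exists2 M, 0 <= M & forall x y, D (x, y) ->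
  exists2 z, D (T x, z) & l2norm (z - T y) <= M * l2norm x.

Lemma commutator_bounded_bounded_commutator D T :
  commutator_bounded D T -> bounded_commutator D T.
Proof.
move=> [M M0 h]; exists M%:C%C => x y /h[z Dz zM]; exists z => //.
by rewrite !l2_normE -rmorphM lecR.
Qed.

(** Having an adjoint is part of the property, because it then passes to adjoints. *)
Definition smooth D T := exists S, [/\ bounded T, bounded S, adjoint_of S T,
  commutator_bounded D T & commutator_bounded D S].

Definition linear_graph D := forall (c : R[i]) x y x' y', D (x, y) -> D (x', y') ->
  D (c *: x + x', c *: y + y').

Lemma commutator_boundedD D S T : linear_graph D -> commutator_bounded D S -> commutator_bounded D T ->
  commutator_bounded D (fun x => S x + T x).
Proof.
move=> sD [M M0 hS] [N N0 hT]; exists (M + N) => [|x y Dxy]; first exact: addr_ge0.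
have [z Dz zM] := hS _ _ Dxy; have [z' Dz' zN] := hT _ _ Dxy.
exists (z + z'); first by have := sD 1 _ _ _ _ Dz Dz'; rewrite !scale1r.
by rewrite opprD addrACA mulrDl; apply: le_trans (l2normD _ _) _; exact: lerD.
Qed.

Let commZ D (c : R[i]) T : linear_graph D -> D (0, 0) -> commutator_bounded D T ->
  commutator_bounded D (fun x => c *: T x).
Proof.
move=> sD D0 [N N0 hT]; exists (normc c * N) => [|x y Dxy].
  by rewrite mulr_ge0 ?normc_ge0.
have [z Dz zN] := hT _ _ Dxy; exists (c *: z).
  by have := sD c _ _ _ _ Dz D0; rewrite !addr0.
by rewrite -scalerBr l2normZ -mulrA ler_wpM2l ?normc_ge0.
Qed.

Let commM D S T : bounded S -> bounded T ->
  commutator_bounded D S -> commutator_bounded D T -> commutator_bounded D (S \o T).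
Proof.
move=> [lS [M M0 SM]] [lT [N N0 TN]] [M' M'0 hS] [N' N'0 hT].
exists (M' * N + M * N') => [|x y Dxy]; first by rewrite addr_ge0 ?mulr_ge0.
have [z Dz zN] := hT _ _ Dxy; have [u Du uM] := hS _ _ Dz.
exists u; first by [].
rewrite (_ : u - _ = (u - S z) + S (z - T y)); last first.
  by rewrite (linB _ _ lS) addrA subrK.
apply: le_trans (l2normD _ _) _; rewrite mulrDl; apply: lerD.
  by apply: le_trans uM _; rewrite -mulrA ler_wpM2l.
by apply: le_trans (SM _) _; rewrite -mulrA ler_wpM2l.
Qed.

Lemma star_alg_smooth D (G : set (H -> H)) : linear_graph D -> D (0, 0) ->
  (forall T, G T -> smooth D T) -> forall T, star_alg G T -> smooth D T.
Proof.
move=> sD D0 GD T; elim=> {T}.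
- exact: GD.
- exists id; split=> //; try exact: bounded_id.
  + by exists 0 => // x y Dxy; exists y => //; rewrite subrr l2norm0 mul0r.
  + by exists 0 => // x y Dxy; exists y => //; rewrite subrr l2norm0 mul0r.
- move=> S T _ [S' [bS bS' aS cS cS']] _ [T' [bT bT' aT cT cT']].
  exists (fun x => S' x + T' x); split; try exact: boundedD; try exact: commutator_boundedD.
  by move=> x y; rewrite innerDl innerDr aS aT.
- move=> c T _ [T' [bT bT' aT cT cT']].
  exists (fun x => c^*%C *: T' x); split; try exact: boundedZ; try exact: commZ.
  by move=> x y; rewrite innerZl aT; case: bT' => lT' _; rewrite (linZ _ _ lT').
- move=> S T _ [S' [bS bS' aS cS cS']] _ [T' [bT bT' aT cT cT']].
  exists (T' \o S'); split; try exact: bounded_comp; try exact: commM.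
  by move=> x y /=; rewrite aS aT.
- move=> T _ [T' [bT bT' aT cT cT']]; exists T.
  by rewrite (adj_unique aT); split=> //; exact: adjoint_ofC.
Qed.

End BoundedAdjoint.

(** * The generators as sums of shifts *)

Definition ush_proof (e1 e2 : bool) (t : idx) :
  ((val t).1.2 + e1 <= (val t).1.1.+1)%N && ((val t).2 + e2 <= (val t).1.1.+1)%N.
Proof. by case: t => [[[N a] b] /= /andP[]]; case: e1; case: e2 => /=; lia. Qed.

(** The four maps (N, a, b) |-> (N + 1, a + e1, b + e2) are total injections, and each
    term of alpha, beta and their adjoints goes up or down along one of them. *)
Definition ush (e1 e2 : bool) (t : idx) : idx :=
  Sub ((val t).1.1.+1, (val t).1.2 + e1, (val t).2 + e2)%N (ush_proof e1 e2 t).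

(* W has the arguments of the coefficients a_plus, b_plus, ..., in this order. *)
Definition wt {R : realType} (W : nat -> nat -> nat -> R) (t : idx) : R :=
  W (val t).1.1 (val t).1.2 (val t).2.

Lemma ush_inj e1 e2 : injective (ush e1 e2).
Proof.
move=> [[[N a] b] h] [[[N' a'] b'] h'] /(congr1 val) /= [NN aa bb].
by apply: val_inj => /=; congr (_, _, _); lia.
Qed.

Lemma idx_le (t : idx) : ((val t).1.2 <= (val t).1.1)%N /\ ((val t).2 <= (val t).1.1)%N.
Proof. by case: t => ? /= /andP. Qed.

Section Coordinates.
Context {R : realType}.
Local Notation H := (l2 R idx).
Implicit Types (x y : H) (W : nat -> nat -> nat -> R).

Lemma coordE x (t : idx) : x t = coord x (val t).1.1 (val t).1.2 (val t).2.
Proof. by case: t => [[[N a] b] h]; rewrite /coord /= insubT. Qed.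

Lemma coord_out x N a b : ~~ ((a <= N) && (b <= N))%N -> coord x N a b = 0.
Proof. by move=> h; rewrite /coord insubF //=; exact/negbTE. Qed.

Lemma coord_in x N a b (h : ((a <= N) && (b <= N))%N) :
  coord x N a b = x (Sub (N, a, b) h).
Proof. by rewrite /coord insubT. Qed.

Lemma coord_ext x y : (forall N a b, (a <= N)%N -> (b <= N)%N ->
  coord x N a b = coord y N a b) -> x = y.
Proof.
move=> h; apply: l2_ext => t; rewrite !coordE.
by case: t => [[[N a] b] /= /andP[aN bN]]; exact: h.
Qed.

Lemma coordD x y N a b : coord (x + y) N a b = coord x N a b + coord y N a b.
Proof. by rewrite /coord; case: insub => [t|] /=; rewrite ?addr0 // l2DE. Qed.

Lemma coordZ (c : R[i]) x N a b : coord (c *: x) N a b = c * coord x N a b.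
Proof. by rewrite /coord; case: insub => [t|] /=; rewrite ?mulr0 // l2ZE. Qed.

Lemma coord_up e1 e2 W x N a b : weight_bounded (wt W) -> (a <= N)%N -> (b <= N)%N ->
  coord (up (ush e1 e2) (wt W) x) N a b =
  if [&& 0 < N, e1 <= a & e2 <= b]%N
  then (W N.-1 (a - e1)%N (b - e2)%N)%:C%C * coord x N.-1 (a - e1)%N (b - e2)%N else 0.
Proof.
move=> Wb aN bN.
have h : ((a <= N) && (b <= N))%N by rewrite aN.
rewrite (coord_in _ h).
case: ifPn => [/and3P[N0 ea eb]|h2].
  have [h'|h'] := boolP ((a - e1 <= N.-1) && (b - e2 <= N.-1))%N; last first.
    rewrite coord_out // mulr0 (up_out Wb) //.
    move=> [[[N' a'] b'] /= h''] /(congr1 val) /= [E1 E2 E3].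
    by move/negP: h'; apply; lia.
  rewrite (coord_in _ h').
  have -> : Sub (N, a, b) h = ush e1 e2 (Sub (N.-1, (a - e1)%N, (b - e2)%N) h').
    by apply: val_inj => /=; congr (_, _, _); lia.
  by rewrite (up_in (@ush_inj _ _) Wb).
rewrite (up_out Wb) //.
move=> [[[N' a'] b'] /= h''] /(congr1 val) /= [E1 E2 E3].
by move/negP: h2; apply; lia.
Qed.

Lemma coord_dn e1 e2 W x N a b : weight_bounded (wt W) -> (a <= N)%N -> (b <= N)%N ->
  coord (dn (ush e1 e2) (wt W) x) N a b =
  (W N a b)%:C%C * coord x N.+1 (a + e1)%N (b + e2)%N.
Proof.
move=> Wb aN bN.
have h : ((a <= N) && (b <= N))%N by rewrite aN.
by rewrite (coord_in _ h) (dnE (@ush_inj _ _) Wb) coordE.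
Qed.

End Coordinates.

Section Generators.
Context {R : realType} (q : R) (hq : 0 < q < 1).
Local Notation H := (l2 R idx).
Implicit Types (x y : H).

(** The coefficients of the terms that lower N, indexed by the target of the term
    instead of its source. *)
Definition am N a b := a_minus q N.+1 a.+1 b.+1.
Definition bm N a b := b_minus q N.+1 a b.+1.

Lemma wb_ap : weight_bounded (wt (a_plus q)).
Proof. by exists 1 => t; have [? ?] := idx_le t; exact: a_plus_le1. Qed.

Lemma wb_am : weight_bounded (wt am).
Proof. by exists 1 => t; have [? ?] := idx_le t; exact: a_minus_le1. Qed.

Lemma wb_bp : weight_bounded (wt (b_plus q)).
Proof. by exists 1 => t; have [? ?] := idx_le t; exact: b_plus_le1. Qed.

Lemma wb_bm : weight_bounded (wt bm).
Proof. by exists 1 => t; have [? ?] := idx_le t; apply: b_minus_le1 => //; rewrite leqW. Qed.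

Hint Resolve wb_ap wb_am wb_bp wb_bm ush_inj : core.

Definition alphaS x : H := dn (ush false false) (wt (a_plus q)) x + up (ush true true) (wt am) x.
Definition betaS x : H := dn (ush true false) (wt (b_plus q)) x + up (ush false true) (wt bm) x.

Lemma alpha_shift x :
  alpha q x = up (ush false false) (wt (a_plus q)) x + dn (ush true true) (wt am) x.
Proof.
apply: coord_ext => N a b aN bN; rewrite coordD coord_up // coord_dn //.
have h : ((a <= N) && (b <= N))%N by rewrite aN.
rewrite (coord_in _ h) alphaE // /alpha_fun /= !subn0 !addn1 !andbT.
by case: ifP.
Qed.

Lemma beta_shift x :
  beta q x = up (ush true false) (wt (b_plus q)) x + dn (ush false true) (wt bm) x.
Proof.
apply: coord_ext => N a b aN bN; rewrite coordD coord_up // coord_dn //.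
have h : ((a <= N) && (b <= N))%N by rewrite aN.
rewrite (coord_in _ h) betaE // /beta_fun /= !subn0 !subn1 !addn1 !addn0 !andbT.
by rewrite (_ : (0 < N) && (0 < a) = (0 < a))%N //; apply/idP/idP; lia.
Qed.

Lemma adjoint_alpha : adjoint_of alphaS (alpha q).
Proof.
by move=> x y; rewrite alpha_shift innerDl innerDr inner_up // inner_dn.
Qed.

Lemma adjoint_beta : adjoint_of betaS (beta q).
Proof.
by move=> x y; rewrite beta_shift innerDl innerDr inner_up // inner_dn.
Qed.

Lemma bounded_up f (w : idx -> R) : injective f -> weight_bounded w -> bounded (up f w).
Proof.
move=> fI wb; split; first exact: up_linear.
have [M wM] := wb; have M0 : 0 <= `|M| by [].
by exists `|M| => // x; apply: up_le => // s _; apply: le_trans (wM s) (ler_norm _).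
Qed.

Lemma bounded_dn f (w : idx -> R) : injective f -> weight_bounded w -> bounded (dn f w).
Proof.
move=> fI wb; split; first exact: dn_linear.
have [M wM] := wb; have M0 : 0 <= `|M| by [].
by exists `|M| => // x; apply: dn_le => // s _; apply: le_trans (wM s) (ler_norm _).
Qed.

Lemma bounded_alpha : bounded (alpha q).
Proof.
have -> : alpha q = (fun x => up (ush false false) (wt (a_plus q)) x + dn (ush true true) (wt am) x).
  by apply/funext; exact: alpha_shift.
by apply: boundedD; [exact: bounded_up|exact: bounded_dn].
Qed.

Lemma bounded_beta : bounded (beta q).
Proof.
have -> : beta q = (fun x => up (ush true false) (wt (b_plus q)) x + dn (ush false true) (wt bm) x).
  by apply/funext; exact: beta_shift.
by apply: boundedD; [exact: bounded_up|exact: bounded_dn].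
Qed.

Lemma bounded_alphaS : bounded alphaS.
Proof. by apply: boundedD; [exact: bounded_dn|exact: bounded_up]. Qed.

Lemma bounded_betaS : bounded betaS.
Proof. by apply: boundedD; [exact: bounded_dn|exact: bounded_up]. Qed.

Lemma adj_beta : adj (beta q) = betaS.
Proof. exact/adj_unique/adjoint_beta. Qed.

End Generators.

(** * The relations of SU_q(2) *)

Section Relations.
Context {R : realType} (q : R) (hq : 0 < q < 1).
Local Notation H := (l2 R idx).
Implicit Types (x y : H).

Let q0 : 0 < q. Proof. by case/andP: hq. Qed.
Let q1 : q < 1. Proof. by case/andP: hq. Qed.

(** The square roots of the q-numbers 1 - q^(2k).  As sg 0 = 0, the coefficients AP,
    AM, BP and BM below vanish where their shift leads out of range, and the formulas
    for the coordinates of alpha x, beta x and their adjoints need no case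
    distinction. *)
Let sg (k : nat) : R := Num.sqrt (1 - q ^+ (2 * k)).

Let sgE k : 0 <= 1 - q ^+ (2 * k).
Proof. by rewrite subr_ge0 exprn_ile1 // ltW. Qed.

Let sg2 k : sg k * sg k = 1 - q ^+ (2 * k).
Proof. by rewrite -expr2 sqr_sqrtr. Qed.

Let sg0 : sg 0 = 0.
Proof. by rewrite /sg muln0 expr0 subrr sqrtr0. Qed.

Let AP N a b : R := q ^+ (a + b + 1) * (sg (N - b) * sg (N - a) / (sg N * sg N.+1)).
Let AM N a b : R := sg b * sg a / (sg N * sg N.+1).
Let BP N a b : R := - q ^+ b * (sg (N - b) * sg a / (sg N * sg N.+1)).
Let BM N a b : R := q ^+ a * (sg b * sg (N - a) / (sg N * sg N.+1)).

Let sqrt4 (e u v w z : nat) : Num.sqrt (q ^+ (2 * e) *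
    ((1 - q ^+ (2 * u)) * (1 - q ^+ (2 * v)) / ((1 - q ^+ (2 * w)) * (1 - q ^+ (2 * z))))) =
  q ^+ e * (sg u * sg v / (sg w * sg z)).
Proof.
have h : 0 <= q ^+ e by rewrite exprn_ge0 // ltW.
have qq : q ^+ (2 * e) = (q ^+ e) ^+ 2 by rewrite mulnC exprM.
rewrite sqrtrM; last by rewrite qq sqr_ge0.
rewrite qq sqrtr_sqr ger0_norm //; congr (_ * _).
rewrite sqrtrM ?mulr_ge0 // sqrtrM // sqrtrV ?mulr_ge0 // sqrtrM //.
Qed.

Let a_plusE N a b : (a <= N)%N -> (b <= N)%N -> a_plus q N a b = AP N.+1 a b.
Proof.
move=> aN bN; rewrite /AP /a_plus -sqrt4; congr Num.sqrt.
by congr (_ * (_ * _ / (_ * _))); [|congr (1 - _)..]; congr (q ^+ _); lia.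
Qed.

Let a_minusE N a b : a_minus q N a b = AM N a b.
Proof.
rewrite /AM /a_minus -[RHS]mul1r -(expr0 q) -sqrt4 muln0 expr0 mul1r; congr Num.sqrt.
by congr (_ * _ / (_ * _)); congr (1 - _); congr (q ^+ _); lia.
Qed.

Let b_plusE N a b : (a <= N)%N -> (b <= N)%N -> b_plus q N a b = BP N.+1 a.+1 b.
Proof.
move=> aN bN; rewrite /BP /b_plus mulNr -sqrt4; congr (- Num.sqrt _).
by congr (_ * (_ * _ / (_ * _))); congr (1 - _); congr (q ^+ _); lia.
Qed.

Let b_minusE N a b : b_minus q N a b = BM N a b.
Proof.
rewrite /BM /b_minus -sqrt4; congr Num.sqrt.
by congr (_ * (_ * _ / (_ * _))); congr (1 - _); congr (q ^+ _); lia.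
Qed.

Let coord_alpha x N a b : (a <= N)%N -> (b <= N)%N -> coord (alpha q x) N a b =
  (AP N a b)%:C%C * coord x N.-1 a b + (AM N.+1 a.+1 b.+1)%:C%C * coord x N.+1 a.+1 b.+1.
Proof.
move=> aN bN; rewrite (alpha_shift hq) coordD (coord_up _ _ _ (wb_ap hq)) // (coord_dn _ _ _ (wb_am hq)) //.
rewrite /am a_minusE !addn1 !subn0 !andbT; congr (_ + _).
case: N aN bN => [|N] aN bN /=.
  by rewrite /AP sub0n sg0 !mul0r mulr0 mul0r.
have [h|h] := boolP ((a <= N) && (b <= N))%N; last by rewrite coord_out // !mulr0.
by case/andP: h => h1 h2; rewrite a_plusE.
Qed.

Let coord_alphaS x N a b : (a <= N)%N -> (b <= N)%N -> coord (alphaS q x) N a b =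
  (AP N.+1 a b)%:C%C * coord x N.+1 a b + (AM N a b)%:C%C * coord x N.-1 a.-1 b.-1.
Proof.
move=> aN bN; rewrite coordD (coord_up _ _ _ (wb_am hq)) // (coord_dn _ _ _ (wb_ap hq)) //.
rewrite a_plusE // !addn0 !subn1; congr (_ + _).
case: a b aN bN => [|a] [|b] aN bN; rewrite /= ?andbF ?andbT /AM ?sg0 ?(mul0r, mulr0) //.
by case: N aN bN => // N _ _; rewrite /am a_minusE.
Qed.

Let coord_beta x N a b : (a <= N)%N -> (b <= N)%N -> coord (beta q x) N a b =
  (BP N a b)%:C%C * coord x N.-1 a.-1 b + (BM N.+1 a b.+1)%:C%C * coord x N.+1 a b.+1.
Proof.
move=> aN bN; rewrite (beta_shift hq) coordD (coord_up _ _ _ (wb_bp hq)) // (coord_dn _ _ _ (wb_bm hq)) //.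
rewrite /bm b_minusE addn0 addn1 !subn0 subn1 andbT; congr (_ + _).
case: a aN => [|a] aN; first by rewrite andbF /BP sg0 !(mulr0, mul0r).
case: N aN bN => [|N] aN bN //=.
have [h|h] := boolP ((a <= N) && (b <= N))%N; last by rewrite coord_out // !mulr0.
by case/andP: h => h1 h2; rewrite b_plusE.
Qed.

Let coord_betaS x N a b : (a <= N)%N -> (b <= N)%N -> coord (betaS q x) N a b =
  (BP N.+1 a.+1 b)%:C%C * coord x N.+1 a.+1 b + (BM N a b)%:C%C * coord x N.-1 a b.-1.
Proof.
move=> aN bN; rewrite coordD (coord_up _ _ _ (wb_bm hq)) // (coord_dn _ _ _ (wb_bp hq)) //.
rewrite b_plusE // addn0 addn1 subn0 subn1 /=; congr (_ + _).
case: b bN => [|b] bN; first by rewrite andbF /BM sg0 !(mulr0, mul0r).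
case: N aN bN => [|N] aN bN //=.
have [h|h] := boolP (a <= N)%N; last by rewrite coord_out; [rewrite !mulr0|rewrite (negbTE h)].
by rewrite /bm b_minusE.
Qed.

(* The point at which the inner operator is evaluated may be out of range, but then
   the outer coefficient is zero. *)
Let am_alpha x N a b : (a <= N)%N -> (b <= N)%N ->
  (AM N a b)%:C%C * coord (alpha q x) N.-1 a.-1 b.-1 = (AM N a b)%:C%C *
   ((AP N.-1 a.-1 b.-1)%:C%C * coord x N.-2 a.-1 b.-1 + (AM N a b)%:C%C * coord x N a b).
Proof.
case: a b N => [|a] [|b] [|N] // aN bN; rewrite ?/AM ?sg0 ?(mulr0, mul0r) //=.
by rewrite coord_alpha.
Qed.

Let bm_beta x N a b : (a <= N)%N -> (b <= N)%N ->
  (BM N a b)%:C%C * coord (beta q x) N.-1 a b.-1 = (BM N a b)%:C%C *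
   ((BP N.-1 a b.-1)%:C%C * coord x N.-2 a.-1 b.-1 + (BM N a b)%:C%C * coord x N a b).
Proof.
case: b N => [|b] [|N] // aN bN; rewrite ?/BM ?sg0 ?(mulr0, mul0r) //=.
move: aN; rewrite leq_eqVlt => /orP[/eqP ->|aN].
  by rewrite subnn sg0 ?(mulr0, mul0r).
by rewrite coord_beta.
Qed.

Let ap_alphaS x N a b : (a <= N)%N -> (b <= N)%N ->
  (AP N a b)%:C%C * coord (alphaS q x) N.-1 a b = (AP N a b)%:C%C *
   ((AP N a b)%:C%C * coord x N a b + (AM N.-1 a b)%:C%C * coord x N.-2 a.-1 b.-1).
Proof.
case: N => [|N] aN bN; first by rewrite /AP sub0n sg0 ?(mulr0, mul0r).
move: aN; rewrite leq_eqVlt => /orP[/eqP ->|aN].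
  by rewrite /AP subnn sg0 ?(mulr0, mul0r).
move: bN; rewrite leq_eqVlt => /orP[/eqP ->|bN].
  by rewrite /AP subnn sg0 ?(mulr0, mul0r).
by rewrite coord_alphaS.
Qed.

Let bp_betaS x N a b : (a <= N)%N -> (b <= N)%N ->
  (BP N a b)%:C%C * coord (betaS q x) N.-1 a.-1 b = (BP N a b)%:C%C *
   ((BP N a b)%:C%C * coord x N a b + (BM N.-1 a.-1 b)%:C%C * coord x N.-2 a.-1 b.-1).
Proof.
case: a N => [|a] [|N] // aN bN; rewrite ?/BP ?sub0n ?sg0 ?(mulr0, mul0r) //=.
move: bN; rewrite leq_eqVlt => /orP[/eqP ->|bN].
  by rewrite subnn sg0 ?(mulr0, mul0r).
by rewrite coord_betaS.
Qed.

(* The coefficients of the coordinates at the levels N + 2 and N - 2 in the relations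
   below. *)
Let cross1 N a b : (a <= N)%N -> (b <= N)%N ->
  AP N.+1 a b * AM N.+2 a.+1 b.+1 + BP N.+1 a.+1 b * BM N.+2 a.+1 b.+1 = 0.
Proof.
move=> aN bN; rewrite /AP /AM /BP /BM !subSS !addn1 !exprS exprD; ring.
Qed.

Let cross1' N a b :
  AM N a b * AP N.-1 a.-1 b.-1 + BM N a b * BP N.-1 a b.-1 = 0.
Proof.
rewrite /AP /AM /BP /BM.
case: a b N => [|a] [|b] [|N]; rewrite ?sub0n ?sg0 ?(mulr0, mul0r, addr0) //=.
rewrite !subSS !addn1 !exprS exprD; ring.
Qed.

Let cross2 N a b : AM N.+1 a.+1 b.+1 * AP N.+2 a.+1 b.+1 +
  q ^+ 2 * (BM N.+1 a b.+1 * BP N.+2 a.+1 b.+1) = 0.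
Proof.
rewrite /AP /AM /BP /BM !subSS !addn1 !addSn !addnS !exprS exprD.
ring.
Qed.

Let cross2' N a b : (a <= N)%N -> (b <= N)%N ->
  AP N a b * AM N.-1 a b + q ^+ 2 * (BP N a b * BM N.-1 a.-1 b) = 0.
Proof.
move=> aN bN; rewrite /AP /AM /BP /BM.
case: a N aN bN => [|a] [|N] // aN bN; rewrite ?sub0n ?sg0 ?(mulr0, mul0r, oppr0, addr0) //=.
rewrite !subSS !addn1 !addSn !exprS exprD; ring.
Qed.

Let cross3 N a b : (a <= N)%N -> (b <= N)%N ->
  BM N.+1 a b.+1 * BP N.+2 a.+1 b.+1 = BP N.+1 a.+1 b * BM N.+2 a.+1 b.+1.
Proof.
move=> aN bN; rewrite /AP /AM /BP /BM !subSS !exprS; ring.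
Qed.

Let cross3' N a b : (a <= N)%N -> (b <= N)%N ->
  BP N a b * BM N.-1 a.-1 b = BM N a b * BP N.-1 a b.-1.
Proof.
move=> aN bN; rewrite /AP /AM /BP /BM.
case: a b N aN bN => [|a] [|b] [|N] // aN bN; rewrite ?sub0n ?sg0 ?(mulr0, mul0r, oppr0, addr0) //=.
rewrite !subSS !exprS; ring.
Qed.

Let sq4 (e k u v w z : R) : k ^+ 2 = e ->
  (k * (u * v / (w * z))) * (k * (u * v / (w * z))) =
  e * ((u * u) * (v * v) / ((w * w) * (z * z))).
Proof. by move=> <-; rewrite !invfM; ring. Qed.

Let xp a := q ^+ (2 * a).

(* On the diagonal only squares of the coefficients occur, so that the roots
   disappear and rational identities in q^(2a), q^(2b), q^(2N) remain. *)
Let APsq N a b : AP N a b * AP N a b = (q ^+ 2 * xp a * xp b) *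
  ((1 - xp (N - b)) * (1 - xp (N - a)) / ((1 - xp N) * (1 - xp N.+1))).
Proof.
rewrite /AP (@sq4 (q ^+ 2 * xp a * xp b)) ?sg2 // /xp -exprM -!exprD; congr (_ ^+ _); lia.
Qed.

Let AMsq N a b : AM N a b * AM N a b =
  ((1 - xp b) * (1 - xp a) / ((1 - xp N) * (1 - xp N.+1))).
Proof. by have := @sq4 1 1 (sg b) (sg a) (sg N) (sg N.+1); rewrite expr1n !mul1r !sg2; apply. Qed.

Let BPsq N a b : BP N a b * BP N a b = xp b *
  ((1 - xp (N - b)) * (1 - xp a) / ((1 - xp N) * (1 - xp N.+1))).
Proof.
by rewrite /BP (@sq4 (xp b)) ?sg2 // sqrrN /xp -exprM; congr (_ ^+ _); lia.
Qed.

Let BMsq N a b : BM N a b * BM N a b = xp a *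
  ((1 - xp b) * (1 - xp (N - a)) / ((1 - xp N) * (1 - xp N.+1))).
Proof.
by rewrite /BM (@sq4 (xp a)) ?sg2 // /xp -exprM; congr (_ ^+ _); lia.
Qed.

Let xpS k : xp k.+1 = q ^+ 2 * xp k.
Proof. by rewrite /xp -exprD; congr (_ ^+ _); lia. Qed.

Let xpZ N a : (a <= N)%N -> xp N = xp a * xp (N - a).
Proof. by move=> aN; rewrite /xp -exprD; congr (_ ^+ _); lia. Qed.

Let xp_neq1 k : 1 - xp k.+1 != 0.
Proof. by rewrite subr_eq0 eq_sym lt_eqF // exprn_ilt1 // ltW. Qed.

(* M stands for q^(2N), which is 1 at N = 0: the quotient by 1 - M is then 0 by
   convention, in agreement with the vanishing numerator. *)
Let cancelN (u M c : R) : (M = 1 -> u = 0) -> u * (1 - M) / ((1 - M) * c) = u / c.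
Proof.
have [->|M1] := eqVneq M 1; first by move=> -> //; rewrite !mul0r.
by move=> _; rewrite invfM mulrA mulfK // subr_eq0 eq_sym.
Qed.

Let xp1 N a : (a <= N)%N -> xp N = 1 -> xp a = 1.
Proof.
case: N => [|N] aN h; first by move: aN; rewrite leqn0 => /eqP ->; rewrite /xp expr0.
by have := xp_neq1 N; rewrite h subrr eqxx.
Qed.

Let diag1 N a b : (a <= N)%N -> (b <= N)%N ->
  AP N.+1 a b * AP N.+1 a b + AM N a b * AM N a b +
  (BP N.+1 a.+1 b * BP N.+1 a.+1 b + BM N a b * BM N a b) = 1.
Proof.
move=> aN bN; rewrite APsq AMsq BPsq BMsq !subSn // !xpS.
set s := q ^+ 2.
have MX := xpZ aN; have MY := xpZ bN.
have n1 : 1 - s * xp N != 0 by rewrite -xpS xp_neq1.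
have n2 : 1 - s * (s * xp N) != 0 by rewrite -!xpS xp_neq1.
have c1 := @cancelN (1 - xp b) (xp N) (1 - s * xp N).
have /c1 {}c1 : xp N = 1 -> 1 - xp b = 0 by move=> /(xp1 bN) ->; rewrite subrr.
rewrite [LHS](_ : _ = (xp b - s * xp N) / (1 - s * xp N) +
   (1 - xp b) * (1 - xp N) / ((1 - xp N) * (1 - s * xp N))).
  by rewrite c1 -mulrDl; apply: (canLR (mulfK n1)); ring.
have e1 : (xp b - s * xp N) / (1 - s * xp N) = (s * xp a * xp b) *
    ((1 - s * xp (N - b)) * (1 - s * xp (N - a)) / ((1 - s * xp N) * (1 - s * (s * xp N))))
   + xp b * ((1 - s * xp (N - b)) * (1 - s * xp a) / ((1 - s * xp N) * (1 - s * (s * xp N)))).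
  transitivity ((xp b * (1 - s * xp (N - b))) * (1 - s * (s * (xp a * xp (N - a)))) / ((1 - s * xp N) * (1 - s * (s * xp N)))).
    rewrite -MX (_ : xp b * (1 - s * xp (N - b)) = xp b - s * xp N); last by rewrite MY; ring.
    by field; rewrite n1 n2.
  ring.
rewrite e1 [in X in _ = _ + X / _]MX; ring.
Qed.

Let diag2 N a b : (a <= N)%N -> (b <= N)%N ->
  AP N a b * AP N a b + AM N.+1 a.+1 b.+1 * AM N.+1 a.+1 b.+1 +
  q ^+ 2 * (BP N a b * BP N a b + BM N.+1 a b.+1 * BM N.+1 a b.+1) = 1.
Proof.
move=> aN bN; rewrite APsq AMsq BPsq BMsq !subSn // !xpS.
set s := q ^+ 2.
have MX := xpZ aN; have MY := xpZ bN.
have n1 : 1 - s * xp N != 0 by rewrite -xpS xp_neq1.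
have n2 : 1 - s * (s * xp N) != 0 by rewrite -!xpS xp_neq1.
have nU : s * (xp b - xp N) * (1 - xp N) =
    s * xp a * xp b * ((1 - xp (N - b)) * (1 - xp (N - a))) +
    s * (xp b * ((1 - xp (N - b)) * (1 - xp a))).
  transitivity (s * (xp b - xp b * xp (N - b)) * (1 - xp a * xp (N - a))).
    by rewrite -MX -MY.
  ring.
have nV : (1 - s * xp b) * (1 - s * (s * xp N)) = (1 - s * xp b) * (1 - s * xp a) +
    s * (xp a * ((1 - s * xp b) * (1 - s * xp (N - a)))).
  by rewrite MX; ring.
have c1 := @cancelN (s * (xp b - xp N)) (xp N) (1 - s * xp N).
have /c1 {}c1 : xp N = 1 -> s * (xp b - xp N) = 0.
  by move=> h; rewrite (xp1 bN h) h subrr mulr0.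
transitivity (s * (xp b - xp N) * (1 - xp N) / ((1 - xp N) * (1 - s * xp N)) +
  (1 - s * xp b) * (1 - s * (s * xp N)) / ((1 - s * xp N) * (1 - s * (s * xp N)))).
  by rewrite nU nV; ring.
by rewrite c1; field; rewrite n1 n2.
Qed.

Let diag3 N a b : (a <= N)%N -> (b <= N)%N ->
  BP N a b * BP N a b + BM N.+1 a b.+1 * BM N.+1 a b.+1 =
  BP N.+1 a.+1 b * BP N.+1 a.+1 b + BM N a b * BM N a b.
Proof.
move=> aN bN; rewrite !BPsq !BMsq !subSn // !xpS.
set s := q ^+ 2.
have MX := xpZ aN; have MY := xpZ bN.
have n1 : 1 - s * xp N != 0 by rewrite -xpS xp_neq1.
have n2 : 1 - s * (s * xp N) != 0 by rewrite -!xpS xp_neq1.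
have nU : (xp b - xp a) * (1 - xp N) =
    xp b * ((1 - xp (N - b)) * (1 - xp a)) - xp a * ((1 - xp b) * (1 - xp (N - a))).
  transitivity ((xp b - xp b * xp (N - b)) * (1 - xp a)
                - (xp a - xp a * xp (N - a)) * (1 - xp b)); last by ring.
  by rewrite -MX -MY; ring.
have nV : (xp b - xp a) * (1 - s * (s * xp N)) =
    xp b * ((1 - s * xp (N - b)) * (1 - s * xp a)) -
    xp a * ((1 - s * xp b) * (1 - s * xp (N - a))).
  transitivity ((xp b - s * (xp b * xp (N - b))) * (1 - s * xp a)
                - (xp a - s * (xp a * xp (N - a))) * (1 - s * xp b)); last by ring.
  by rewrite -MX -MY; ring.
have c1 := @cancelN (xp b - xp a) (xp N) (1 - s * xp N).
have /c1 {}c1 : xp N = 1 -> xp b - xp a = 0.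
  by move=> h; rewrite (xp1 bN h) (xp1 aN h) subrr.
have c2 : (xp b - xp a) * (1 - s * (s * xp N)) / ((1 - s * xp N) * (1 - s * (s * xp N))) =
    (xp b - xp a) / (1 - s * xp N) by field; rewrite n1 n2.
apply/eqP; rewrite -subr_eq0; apply/eqP.
transitivity ((xp b - xp a) * (1 - xp N) / ((1 - xp N) * (1 - s * xp N)) -
  (xp b - xp a) * (1 - s * (s * xp N)) / ((1 - s * xp N) * (1 - s * (s * xp N)))).
  by rewrite nU nV; ring.
by rewrite c1 c2 subrr.
Qed.

Let CE (u v : R) : ((u * v)%:C = u%:C * v%:C)%C * ((u + v)%:C = u%:C + v%:C)%C.
Proof. by split; [exact: (rmorphM (real_complex R))|exact: (rmorphD (real_complex R))]. Qed.

(** The relations involve only the coordinates of x at the levels N + 2, N - 2 and N;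
    the first two cancel, and the last one has coefficient 1. *)
Lemma sphere_relation x : alphaS q (alpha q x) + betaS q (beta q x) = x.
Proof.
move: coord_alphaS coord_betaS am_alpha bm_beta coord_alpha coord_beta.
(* Only the formulas for the coordinates matter from here on. *)
generalize (alpha q) (beta q) (alphaS q) (betaS q) => A B A' B' hA' hB' hA'A hB'B hA hB.
apply: coord_ext => N a b aN bN; rewrite coordD (hA' _ _ _ _ aN bN) (hB' _ _ _ _ aN bN).
rewrite (hA'A _ _ _ _ aN bN) (hB'B _ _ _ _ aN bN).
rewrite (hA _ _ _ _ (leqW aN) (leqW bN)) (@hB _ N.+1 a.+1 b aN (leqW bN)).
transitivity (
  (AP N.+1 a b * AM N.+2 a.+1 b.+1 + BP N.+1 a.+1 b * BM N.+2 a.+1 b.+1)%:C%C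
     * coord x N.+2 a.+1 b.+1 +
  (AM N a b * AP N.-1 a.-1 b.-1 + BM N a b * BP N.-1 a b.-1)%:C%C
     * coord x N.-2 a.-1 b.-1 +
  (AP N.+1 a b * AP N.+1 a b + AM N a b * AM N a b +
    (BP N.+1 a.+1 b * BP N.+1 a.+1 b + BM N a b * BM N a b))%:C%C * coord x N a b).
  by rewrite !CE; ring.
by rewrite cross1 // cross1' diag1 // !mul0r !add0r mul1r.
Qed.

Lemma second_relation x :
  alpha q (alphaS q x) + (q ^+ 2)%:C%C *: beta q (betaS q x) = x.
Proof.
move: coord_alphaS coord_betaS ap_alphaS bp_betaS coord_alpha coord_beta.
generalize (alpha q) (beta q) (alphaS q) (betaS q) => A B A' B' hA' hB' hAA' hBB' hA hB.
apply: coord_ext => N a b aN bN; rewrite coordD coordZ (hA _ _ _ _ aN bN) (hB _ _ _ _ aN bN).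
rewrite (hAA' _ _ _ _ aN bN) (hBB' _ _ _ _ aN bN).
rewrite (@hA' _ N.+1 a.+1 b.+1 aN bN) (@hB' _ N.+1 a b.+1 (leqW aN) bN).
transitivity (
  (AM N.+1 a.+1 b.+1 * AP N.+2 a.+1 b.+1 +
    q ^+ 2 * (BM N.+1 a b.+1 * BP N.+2 a.+1 b.+1))%:C%C * coord x N.+2 a.+1 b.+1 +
  (AP N a b * AM N.-1 a b + q ^+ 2 * (BP N a b * BM N.-1 a.-1 b))%:C%C
     * coord x N.-2 a.-1 b.-1 +
  (AP N a b * AP N a b + AM N.+1 a.+1 b.+1 * AM N.+1 a.+1 b.+1 +
    q ^+ 2 * (BP N a b * BP N a b + BM N.+1 a b.+1 * BM N.+1 a b.+1))%:C%C
     * coord x N a b).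
  by rewrite !CE; ring.
by rewrite cross2 // cross2' // diag2 // !mul0r !add0r mul1r.
Qed.

Lemma beta_normal x : beta q (betaS q x) = betaS q (beta q x).
Proof.
move: coord_betaS bm_beta bp_betaS coord_beta.
generalize (beta q) (betaS q) => B B' hB' hB'B hBB' hB.
apply: coord_ext => N a b aN bN; rewrite (hB _ _ _ _ aN bN) [in RHS](hB' _ _ _ _ aN bN).
rewrite (hBB' _ _ _ _ aN bN) (hB'B _ _ _ _ aN bN).
rewrite (@hB' _ N.+1 a b.+1 (leqW aN) bN) (@hB _ N.+1 a.+1 b aN (leqW bN)).
transitivity (
  (BM N.+1 a b.+1 * BP N.+2 a.+1 b.+1)%:C%C * coord x N.+2 a.+1 b.+1 +
  (BP N a b * BM N.-1 a.-1 b)%:C%C * coord x N.-2 a.-1 b.-1 +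
  (BP N a b * BP N a b + BM N.+1 a b.+1 * BM N.+1 a b.+1)%:C%C * coord x N a b).
  by rewrite !CE; ring.
by rewrite cross3 // cross3' // diag3 // !CE; ring.
Qed.

End Relations.

(** * Invertibility of gamma *)

Section StarAlgebra.
Context {R : realType} {I : choiceType}.
Local Notation H := (l2 R I).
Implicit Types (x y : H) (S T : H -> H) (G : set (H -> H)).

Lemma star_alg_ext G S T : (forall x, S x = T x) -> star_alg G S -> star_alg G T.
Proof. by move=> /funext ->. Qed.

Lemma star_algB G S T : star_alg G S -> star_alg G T -> star_alg G (fun x => S x - T x).
Proof.
move=> hS hT; apply: (star_alg_ext _ (star_alg_add hS (star_alg_scale (-1) hT))) => x.
by rewrite scaleN1r.
Qed.

Lemma star_alg_iter G T n : star_alg G T -> star_alg G (iter n T).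
Proof.
move=> hT; elim: n => [|n IH]; first exact: star_alg_id.
exact: (star_alg_comp hT IH).
Qed.

Lemma star_alg_sum G n (F : nat -> H -> H) : (forall j, star_alg G (F j)) ->
  star_alg G (fun x => \sum_(j < n) F j x).
Proof.
move=> hF; elim: n => [|n IH].
  apply: (star_alg_ext _ (star_alg_scale 0 (star_alg_id G))) => x.
  by rewrite scale0r big_ord0.
by apply: (star_alg_ext _ (star_alg_add IH (hF n))) => x; rewrite big_ord_recr.
Qed.

Lemma op_closure_alg G T : linear T -> star_alg G T -> op_closure (star_alg G) T.
Proof.
move=> lT hT; split=> // e e0; exists T => // x.
by rewrite subrr normr0 mulr_ge0 // lecR ltW.
Qed.

Lemma bounded_iter T n : bounded T -> bounded (iter n T).
Proof.
move=> bT; elim: n => [|n IH]; first exact: bounded_id.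
exact: (bounded_comp bT IH).
Qed.

Lemma boundedB S T : bounded S -> bounded T -> bounded (fun x => S x - T x).
Proof.
move=> hS hT; have := boundedD hS (boundedZ (-1) hT).
by rewrite (_ : (fun x => S x + _) = fun x => S x - T x) //; apply/funext => x; rewrite scaleN1r.
Qed.

Lemma bounded_sum n (F : nat -> H -> H) : (forall j, bounded (F j)) ->
  bounded (fun x => \sum_(j < n) F j x).
Proof.
move=> hF; elim: n => [|n IH].
  have := boundedZ 0 (@bounded_id R I).
  by congr bounded; apply/funext => x; rewrite scale0r big_ord0.
have := boundedD IH (hF n).
by congr bounded; apply/funext => x; rewrite big_ord_recr.
Qed.

End StarAlgebra.

Section Gamma.
Context {R : realType} {I : choiceType}.
Local Notation H := (l2 R I).
Implicit Types (x y : H).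
Context (A A' B B' : H -> H) (s : R) (r : nat).
Context (bA' : bounded A') (bB : bounded B) (bB' : bounded B').
Context (aA : adjoint_of A' A) (aB : adjoint_of B' B).
Context (sphere : forall x, A' (A x) + B' (B x) = x).
Context (second : forall x, A (A' x) + s%:C%C *: B (B' x) = x).
Context (normal : forall x, B (B' x) = B' (B x)).
Context (s0 : 0 <= s) (sr : 2 * s ^+ r < 1).

Let lA' : linear A' := proj1 bA'.
Let lB : linear B := proj1 bB.
Let lB' : linear B' := proj1 bB'.

Let c x := B' (B x).
Let lc : linear c. Proof. by move=> k x y; rewrite /c lB lB'. Qed.
Let bc : bounded c. Proof. exact: (bounded_comp bB' bB). Qed.

Let norm_split x : l2norm (A x) ^+ 2 + l2norm (B x) ^+ 2 = l2norm x ^+ 2.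
Proof.
have : inner (A x) (A x) + inner (B x) (B x) = inner x x.
  by rewrite aA aB -innerDr sphere.
rewrite !inner_real => h; have := congr1 (@complex.Re R) h.
by rewrite raddfD.
Qed.

Lemma beta_contraction x : l2norm (B x) <= l2norm x.
Proof.
rewrite -ler_sqr ?nnegrE ?l2norm_ge0 // -(norm_split x).
by rewrite lerDr sqr_ge0.
Qed.

Let A_contraction x : l2norm (A x) <= l2norm x.
Proof.
rewrite -ler_sqr ?nnegrE ?l2norm_ge0 // -(norm_split x).
by rewrite lerDl sqr_ge0.
Qed.

Lemma betaS_contraction x : l2norm (B' x) <= l2norm x.
Proof.
rewrite -ler_sqr ?nnegrE ?l2norm_ge0 //.
apply: le_trans (_ : l2norm (B x) ^+ 2 <= _); last first.
  by rewrite ler_sqr ?nnegrE ?l2norm_ge0 // beta_contraction.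
have : inner (B' x) (B' x) = inner (B x) (B x).
  by rewrite aB (adjoint_ofC aB) normal.
by rewrite !inner_real => -[->].
Qed.

Let c_contraction x : l2norm (c x) <= l2norm x.
Proof. exact: le_trans (betaS_contraction _) (beta_contraction _). Qed.

(** The q-commutation of alpha^* and beta^* beta comes from evaluating A' A A' in two
    ways with the first two relations. *)
Let cA' x : c (A' x) = s%:C%C *: A' (c x).
Proof.
have h1 : A' (A (A' x)) = A' x - c (A' x) by apply: (canRL (addrK _)); exact: sphere.
have h2 : A (A' x) = x - s%:C%C *: c x by apply: (canRL (addrK _)); rewrite /c -normal; exact: second.
by move: h1; rewrite h2 (linB _ _ lA') (linZ _ _ lA') => /addrI/oppr_inj.
Qed.

Let cnA' n x : iter n c (A' x) = (s ^+ n)%:C%C *: A' (iter n c x).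
Proof.
elim: n => [|n IH]; first by rewrite expr0 scale1r.
by rewrite iterS IH (linZ _ _ lc) cA' scalerA -rmorphM -exprSr.
Qed.

(** c^n (1 - c) = c^n A'A = s^n A' c^n A decays geometrically: this is the
    gap between 1 and the rest of the spectrum of c. *)
Let gap : exists2 M, 0 <= M & forall n y, l2norm (iter n c (y - c y)) <= M * s ^+ n * l2norm y.
Proof.
have [_ [M M0 hM]] := bA'; exists M => // n y.
have -> : y - c y = A' (A y) by apply/esym/(canRL (addrK _)); exact: sphere.
rewrite cnA' l2normZ normcR ger0_norm ?exprn_ge0 // (mulrC M) -mulrA.
rewrite ler_wpM2l ?exprn_ge0 //; apply: le_trans (hM _) _; rewrite ler_wpM2l //.
have := iter_le n (A y) ler01 (fun x => le_trans (c_contraction x) _).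
rewrite expr1n mul1r => h; apply: le_trans (h _) (A_contraction y).
by move=> x; rewrite mul1r.
Qed.

Let cB x : c (B x) = B (c x). Proof. by rewrite /c normal. Qed.
Let cB' x : c (B' x) = B' (c x). Proof. by rewrite /c normal. Qed.
Let cnB n x : iter n c (B x) = B (iter n c x).
Proof. by elim: n => //= n ->; rewrite cB. Qed.
Let cnB' n x : iter n c (B' x) = B' (iter n c x).
Proof. by elim: n => //= n ->; rewrite cB'. Qed.
Let lcn n : linear (iter n c) := lin_iter n lc.

Let v x := - iter r c (B x - x).
Let g x := iter r c (B x - x) + x.

Let gE x : g x = x - v x. Proof. by rewrite /g /v opprK addrC. Qed.

Let bv : bounded v.
Proof.
have := boundedZ (-1) (bounded_comp (bounded_iter r bc) (boundedB bB (@bounded_id R I))).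
by congr bounded; apply/funext => x /=; rewrite scaleN1r.
Qed.
Let lv : linear v := proj1 bv.

Let lg : linear g.
Proof. by move=> k x y; rewrite !gE lv scalerBr opprD addrACA. Qed.

(** Each of the J factors v = - c^r (B - 1) contributes s^r through c^r, and at most 2
    through B - 1. *)
Let v_small : exists2 M, 0 <= M & forall J n y,
  l2norm (iter J v (iter n c (y - c y))) <= M * 2 ^+ J * s ^+ (r * J + n) * l2norm y.
Proof.
have [M M0 hM] := gap; exists M => //; elim=> [|J IH] n y.
  by rewrite expr0 mulr1 muln0; exact: hM.
have h : v (iter n c (y - c y)) = - iter (r + n) c ((B y - y) - c (B y - y)).
  rewrite /v iterD; congr (- iter r c _).
  by rewrite -cnB -(linB _ _ (lcn n)); congr (iter _ _ _);
    rewrite (linB _ _ lB) (linB _ _ lc) cB; l2ring.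
rewrite iterSr h (linN _ (lin_iter _ lv)) l2normN; apply: le_trans (IH _ _) _.
rewrite (_ : (r * J + (r + n) = r * J.+1 + n)%N); last by lia.
rewrite exprSr -!mulrA; do 2 rewrite ler_wpM2l ?exprn_ge0 //.
rewrite mulrCA ler_wpM2l ?exprn_ge0 //.
by apply: le_trans (l2normB _ _) _; have := beta_contraction y; lra.
Qed.

Let tele n y : y - iter n c y = (\sum_(i < n) iter i c y) - c (\sum_(i < n) iter i c y).
Proof.
rewrite (lin_sum _ _ lc) -sumrB.
elim: n => [|n IH]; first by rewrite big_ord0 subrr.
by rewrite big_ord_recr -IH /= addrA subrK.
Qed.

(** X is the quotient of 1 - g B' = (1 - c^(r+1)) - (1 - c^r) B' by 1 - c. *)
Let X x := (\sum_(i < r.+1) iter i c x) - (\sum_(i < r) iter i c (B' x)).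
Let G J x := (\sum_(j < J) iter j v x) + iter J v (B' x).

Let vn_g J x : iter J v (g x) = g (iter J v x).
Proof. by rewrite !gE (linB _ _ (lin_iter _ lv)) -iterSr. Qed.

Let gG J x : g (G J x) = x - iter J v (X x - c (X x)).
Proof.
have h1 : g (\sum_(j < J) iter j v x) = x - iter J v x.
  rewrite gE (lin_sum _ _ lv) -sumrB.
  elim: J => [|J IH]; first by rewrite big_ord0 subrr.
  by rewrite big_ord_recr IH /= addrA subrK.
have h2 : g (B' x) = x - (X x - c (X x)).
  rewrite /X (linB _ _ lc).
  have e2 := tele r.+1 x; have e3 := tele r (B' x).
  have e4 : iter r c (B (B' x)) = iter r.+1 c x by rewrite normal iterSr.
  rewrite /g (linB _ _ (lcn r)) e4.
  move: e2 e3; set P := \sum_(i < r.+1) _; set Q := \sum_(i < r) _.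
  move=> e2 e3.
  have -> : P - Q - (c P - c Q) = (P - c P) - (Q - c Q) by l2ring.
  by rewrite -e2 -e3; l2ring.
rewrite /G (linD _ _ lg) h1 -vn_g h2 (linB _ _ (lin_iter _ lv)); l2ring.
Qed.

Let G_g J x : G J (g x) = g (G J x).
Proof.
rewrite /G (linD _ _ lg) -vn_g; congr (_ + _).
  by rewrite (lin_sum _ _ lg); apply: eq_bigr => j _; rewrite vn_g.
congr iter; rewrite /g (linD _ _ lB'); congr (_ + _).
by rewrite -cnB' (linB _ _ lB') normal.
Qed.

Let bX : bounded X.
Proof.
apply: boundedB; first by apply: (@bounded_sum _ _ _ (fun i => iter i c)) => j; exact: bounded_iter.
by apply: (@bounded_sum _ _ _ (fun i => iter i c \o B')) => j; apply: bounded_comp => //; exact: bounded_iter.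
Qed.

Let bG J : bounded (G J).
Proof.
apply: boundedD; first by apply: (@bounded_sum _ _ _ (fun i => iter i v)) => j; exact: bounded_iter.
exact: (bounded_comp (bounded_iter J bv) bB').
Qed.

Context (GG : set (H -> H)) (algB : star_alg GG B) (algB' : star_alg GG B').

Let alg_c : star_alg GG c. Proof. exact: (star_alg_comp algB' algB). Qed.

Let alg_v : star_alg GG v.
Proof.
apply: (star_alg_ext _ (star_alg_scale (-1) (star_alg_comp (star_alg_iter r alg_c)
  (star_algB algB (star_alg_id GG))))) => x /=.
by rewrite scaleN1r.
Qed.

Let alg_G J : star_alg GG (G J).
Proof.
apply: star_alg_add; first by apply: (@star_alg_sum _ _ _ _ (fun i => iter i v)) => j; exact: star_alg_iter.
exact: (star_alg_comp (star_alg_iter J alg_v) algB').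
Qed.

Lemma star_alg_gamma : star_alg GG g.
Proof.
exact: (star_alg_add (star_alg_comp (star_alg_iter r alg_c)
  (star_algB algB (star_alg_id GG))) (star_alg_id GG)).
Qed.

(** The polynomial G J in B and B' satisfies g G = 1 - v^J (1 - c) X, and
    v^J (1 - c) has norm of order (2 s^r)^J.  For J large g G is inverted by a Neumann
    series; as G commutes with g, this inverts g itself. *)
Lemma gamma_inverse : exists S, [/\ op_closure (star_alg GG) S, bounded S,
  forall x, g (S x) = x & forall x, S (g x) = x].
Proof.
have [M M0 hM] := v_small; have [_ [N N0 hN]] := bX.
have t0 : 0 <= 2 * s ^+ r by rewrite mulr_ge0 ?exprn_ge0.
have t01 : 0 <= 2 * s ^+ r < 1 by rewrite t0.
have d0 : 0 < 2^-1 / (M * N + 1) :> R.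
  by rewrite divr_gt0 ?invr_gt0 // ltr_pwDr // mulr_ge0.
have [J /(_ J (leqnn J)) hJ] := expr_small t01 d0.
pose K x := iter J v (X x - c (X x)).
have Kle x : l2norm (K x) <= 2^-1 * l2norm x.
  apply: le_trans (hM J 0%N (X x)) _.
  rewrite addn0 exprM -(mulrA M) -exprMn.
  apply: le_trans (_ : M * (2 * s ^+ r) ^+ J * (N * l2norm x) <= _).
    by rewrite ler_wpM2l // mulr_ge0 // exprn_ge0.
  rewrite mulrA ler_wpM2r ?l2norm_ge0 //.
  move: hJ; rewrite ltr_pdivlMr ?ltr_pwDr ?mulr_ge0 // => hJ.
  have : 0 <= (2 * s ^+ r) ^+ J by rewrite exprn_ge0.
  by move: hJ; move: ((2 * s ^+ r) ^+ J) => z; nra.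
have lK : linear K.
  move=> k x y; rewrite /K (proj1 bX) lc -(lin_iter J lv); congr (iter _ _ _); l2ring.
have h01 : 0 <= (2^-1 : R) < 1 by rewrite invr_ge0 ler0n invf_lt1 // ltr1n.
have [S [lS KS SK Sle Sapp]] := neumann lK h01 Kle.
have gGK x : g (G J x) = x - K x by rewrite gG.
have gGS x : g (G J (S x)) = x by rewrite gGK KS.
have SGg x : S (G J (g x)) = x by rewrite G_g gGK SK.
have bS : bounded S by split=> //; exists (1 - 2^-1)^-1 => //; rewrite invr_ge0; lra.
exists (G J \o S); split; last by move=> x /=; rewrite -[LHS](SGg) gGS SGg.
- split=> [|e e0]; first exact: (lin_comp (proj1 (bG J)) lS).
  have [_ [P P0 hP]] := bG J.
  have d1 : 0 < e / (2 * P + 1) by rewrite divr_gt0 // ltr_pwDr // mulr_ge0.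
  have [n /(_ n (leqnn n)) hn] := expr_small h01 d1.
  exists (G J \o (fun x => \sum_(j < n) iter j K x)).
    apply: star_alg_comp; first exact: alg_G.
    apply: (@star_alg_sum _ _ _ _ (fun i => iter i K)) => j; apply: star_alg_iter.
    apply: (star_alg_ext _ (star_algB (star_alg_id GG) (star_alg_comp star_alg_gamma (alg_G J)))) => x /=.
    by rewrite gGK opprB addrC subrK.
  move=> x; rewrite /= -normrN opprB -(linB _ _ (proj1 (bG J))) !l2_normE -rmorphM lecR.
  apply: le_trans (hP _) _; apply: le_trans (ler_wpM2l P0 (Sapp n x)) _.
  rewrite mulrA ler_wpM2r ?l2norm_ge0 //.
  move: hn; rewrite ltr_pdivlMr ?ltr_pwDr ?mulr_ge0 // => hn.
  have : 0 <= (2^-1 : R) ^+ n by rewrite exprn_ge0 // invr_ge0.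
  have -> : (1 - 2^-1 : R)^-1 = 2 by field.
  by move: hn; move: (2^-1 ^+ n) => z; nra.
- exact: bounded_comp (bG J) bS.
- exact: gGS.
Qed.

End Gamma.

(** * Compactness and density *)

Section Topology.
Context {R : realType} {I : choiceType}.
Local Notation H := (l2 R I).
Implicit Types (x y : H) (F : set I).

Lemma nbhs_l2P x (U : set H) :
  nbhs x U <-> exists2 e : R, 0 < e & forall y, l2norm (x - y) < e -> U y.
Proof.
split=> [/nbhs_ballP[e /= e0 eU]|[e e0 eU]].
  have [r er] : exists r : R, e = r%:C%C.
    by exists (complex.Re e); rewrite RRe_real // gtr0_real.
  exists r => [|y xy]; first by rewrite -ltcR -er.
  by apply: eU; rewrite -ball_normE /ball_ /= l2_normE er ltcR.
apply/nbhs_ballP; exists e%:C%C => /=; first by rewrite ltcR.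
by move=> y; rewrite -ball_normE /ball_ /= l2_normE ltcR; exact: eU.
Qed.

Definition cutoff_fun F x t : R[i] := if t \in F then x t else 0.

Let cutoff_sqsum F x : (sqsum (cutoff_fun F x) <= ((1 * l2norm x) ^+ 2)%:E)%E.
Proof.
apply: (@sqsum_reindex_le _ _ _ _ F id) => //.
  by move=> t Ft; rewrite /cutoff_fun memNset.
by move=> t Ft; rewrite /cutoff_fun mem_set // mul1r.
Qed.

Definition cutoff F x : H := L2 (sqsum_le_summable (cutoff_sqsum F x)).

Lemma cutoffE F x t : cutoff F x t = if t \in F then x t else 0.
Proof. by []. Qed.

Lemma cutoff_le F x : l2norm (cutoff F x) <= l2norm x.
Proof.
rewrite -[leRHS]mul1r; apply: l2norm_le; first by rewrite mul1r l2norm_ge0.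
exact: cutoff_sqsum.
Qed.

Lemma cutoff_linear F : linear (cutoff F).
Proof.
move=> c x y; apply: l2_ext => t; rewrite l2DE l2ZE !cutoffE.
by case: ifP => _; rewrite ?l2DE ?l2ZE // mulr0 addr0.
Qed.

Lemma cutoffC F x : x = cutoff F x + cutoff (~` F) x.
Proof.
apply: l2_ext => t; rewrite l2DE !cutoffE in_setC.
by case: (t \in F); rewrite /= ?addr0 ?add0r.
Qed.

Lemma cutoff_small F x (s : seq I) (d : R) : F = [set` s] -> 0 <= d ->
  (forall t, t \in s -> normc (x t) <= d) -> l2norm (cutoff F x) <= (size s)%:R * d.
Proof.
move=> Fs d0 xd; apply: l2norm_le; first by rewrite mulr_ge0.
have -> : sqsum (cutoff F x) = (\esum_(t in F) ((normc (x t)) ^+ 2)%:E)%E.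
  rewrite /sqsum [RHS]esum_mkcond; apply: eq_esum => t _; rewrite cutoffE.
  by case: ifP => //; rewrite normc0 expr0n.
have fin : finite_set F by rewrite Fs.
rewrite esum_fset //; last by move=> t _; rewrite lee_fin sqr_ge0.
rewrite fsbig_finite // sumEFin lee_fin.
set s' := finmap.enum_fset _.
have s's : (size s' <= size s)%N.
  apply: uniq_leq_size; first exact: finmap.fset_uniq.
  by move=> t; rewrite /s' in_fset_set // Fs inE.
have h : \sum_(t <- s') normc (x t) ^+ 2 <= \sum_(t <- s') d ^+ 2.
  rewrite big_seq [leRHS]big_seq; apply: ler_sum => t.
  rewrite /s' in_fset_set // Fs inE /= => ts.
  by rewrite ler_sqr ?nnegrE ?normc_ge0 // xd.
apply: le_trans h _; rewrite big_const_seq iter_addr_0 count_predT exprMn.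
rewrite -[leLHS]mulr_natl ler_wpM2r ?sqr_ge0 // -natrX ler_nat.
by apply: leq_trans s's _; case: (size s) => // n; rewrite -mulnn leq_pmulr.
Qed.

(** Elements of l2 are approximated by their restrictions to finite sets. *)
Lemma tail_small x (e : R) : 0 < e -> exists2 s : seq I, uniq s &
  l2norm (cutoff (~` [set` s]) x) <= e.
Proof.
move=> e0; have e2 : 0 < e ^+ 2 by rewrite exprn_gt0.
have hx := square_summable_fin (l2P x).
have [_ [F [finF _] <-] hF] := ub_ereal_sup_adherent e2 hx.
exists (finmap.enum_fset (fset_set F)); first exact: finmap.fset_uniq.
have -> : [set` finmap.enum_fset (fset_set F)] = F.
  by apply/seteqP; split=> t /=; rewrite in_fset_set // inE.
apply: l2norm_le; first exact: ltW.
have -> : sqsum (cutoff (~` F) x) = (\esum_(t in ~` F) ((normc (x t)) ^+ 2)%:E)%E.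
  rewrite /sqsum [RHS]esum_mkcond; apply: eq_esum => t _; rewrite cutoffE.
  by case: ifP => //; rewrite normc0 expr0n.
have E : (sqsum x = \esum_(t in F) ((normc (x t)) ^+ 2)%:E +
     \esum_(t in ~` F) ((normc (x t)) ^+ 2)%:E)%E.
  rewrite /sqsum (esumID F) ?setTI // => t _; by rewrite lee_fin sqr_ge0.
have {}hF : (sqsum x - (e ^+ 2)%:E < \esum_(t in F) ((normc (x t)) ^+ 2)%:E)%E.
  by rewrite esum_fset //; move=> t _; rewrite lee_fin sqr_ge0.
rewrite E in hF.
have f1 : (\esum_(t in F) ((normc (x t)) ^+ 2)%:E)%E \is a fin_num.
  rewrite esum_fset // ?fsbig_finite // ?sumEFin // => t _.
  by rewrite lee_fin sqr_ge0.
move: hF hx; rewrite E; move: f1.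
move: (\esum_(t in F) _) (\esum_(t in ~` F) _) => [u| |] [v| |] //= _.
by rewrite -EFinD lte_fin lee_fin => h _; lra.
Qed.

Section Ultra.
Context (FF : set_system H) (UF : UltraFilter FF).

Lemma ultra_meet (P Q : set H) : FF P -> FF Q -> exists x, P x /\ Q x.
Proof.
move=> hP hQ; have h : FF (P `&` Q) by exact: filterI.
by have [x Px] := filter_ex h; exists x.
Qed.

(** The limit of a bounded function along an ultrafilter is the supremum of its
    eventual lower bounds. *)
Let ultra_limit (u : H -> R) (C : R) : FF [set x | `|u x| <= C] ->
  exists l, forall e, 0 < e -> FF [set x | `|u x - l| <= e].
Proof.
move=> FC; pose E := [set r | FF [set x | r <= u x]].
have ub : ubound E C.
  move=> r Er; have [x [/= h1 h2]] := ultra_meet Er FC.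
  by apply: le_trans h1 (le_trans (ler_norm _) h2).
have EC : E (- C).
  by apply: filterS FC => x; rewrite /= ler_norml => /andP[].
have hE : has_sup E by split; [exists (- C)|exists C].
exists (sup E) => e e0.
have [r Er hr] := sup_adherent e0 hE.
have nE : ~ E (sup E + e).
  by move=> h; have := ub_le_sup hE.2 h; rewrite gerDl leNgt e0.
have [//|h] := in_ultra_setVsetC [set x | sup E + e <= u x] UF.
apply: filterS (filterI h Er) => x [] /= /negP; rewrite -ltNge => h1 h2.
by rewrite ler_norml; lra.
Qed.

Let filter_seq (s : seq I) (Q : I -> set H) : (forall t, FF (Q t)) ->
  FF [set x | forall t, t \in s -> Q t x].
Proof.
move=> h; elim: s => [|t s IH]; first by apply: filterS filterT => x _ t.
apply: filterS (filterI (h t) IH) => x [Qx sx] u.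
by rewrite inE => /orP[/eqP ->|/sx].
Qed.

Lemma ultra_coord (C : R) : FF [set x | l2norm x <= C] ->
  exists p : H, l2norm p <= C /\ (forall (s : seq I) e, 0 < e ->
    FF [set x | forall t, t \in s -> normc (p t - x t) <= e]).
Proof.
move=> FC.
have C0 : 0 <= C by have /filter_ex[x] := FC; exact: le_trans (l2norm_ge0 _).
have lRe t := @ultra_limit (fun x => complex.Re (x t)) C.
have lIm t := @ultra_limit (fun x => complex.Im (x t)) C.
have {}lRe t : exists l, forall e, 0 < e -> FF [set x : H | `|complex.Re (x t) - l| <= e].
  apply: lRe; apply: filterS FC => x /= xC.
  exact: le_trans (normc_Re _) (le_trans (normc_coord_le _ _) xC).
have {}lIm t : exists l, forall e, 0 < e -> FF [set x : H | `|complex.Im (x t) - l| <= e].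
  apply: lIm; apply: filterS FC => x /= xC.
  exact: le_trans (normc_Im _) (le_trans (normc_coord_le _ _) xC).
pose f t := (projT1 (cid (lRe t)) +i* projT1 (cid (lIm t)))%C.
have hf (s : seq I) e : 0 < e ->
    FF [set x | forall t, t \in s -> normc (f t - x t) <= e].
  move=> e0; apply: filter_seq => t.
  rewrite /f; case: cid => a ha; case: cid => b hb /=.
  have e2 : 0 < e / 2 by rewrite divr_gt0.
  apply: filterS (filterI (ha _ e2) (hb _ e2)) => x [] /=.
  case: (x t) => u w h1 h2.
  rewrite [X in normc X](_ : _ = (a - u)%:C%C + (0 +i* (b - w))%C); last first.
    by apply/eqP; rewrite eq_complex /=; apply/andP; split; apply/eqP; ring.
  apply: le_trans (le_normcD _ _) _; rewrite normcR /= expr0n add0r sqrtr_sqr.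
  by move: h1 h2; rewrite /= distrC (distrC w); lra.
have fC : (sqsum f <= (C ^+ 2)%:E)%E.
  apply: sqsum_fatou => // s e e0.
  by have [x [h1 h2]] := ultra_meet FC (hf s e e0); exists x.
exists (L2 (sqsum_le_summable fC)); split; first exact: l2norm_le.
exact: hf.
Qed.

End Ultra.

(** In a bounded set with uniformly small tails, coordinatewise convergence is
    convergence in norm. *)
Lemma compact_tails (A : set H) (C : R) : closed A ->
  (forall x, A x -> l2norm x <= C) ->
  (forall e, 0 < e -> exists s : seq I, forall x, A x ->
     l2norm (cutoff (~` [set` s]) x) <= e) ->
  compact A.
Proof.
move=> clA AC tails; rewrite compact_ultra => FF UF FA.
have FC : FF [set x | l2norm x <= C] by apply: filterS FA => x; exact: AC.
have [p [pC hp]] := ultra_coord UF FC.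
have Fp : FF --> p.
  move=> U /nbhs_l2P[e e0 eU].
  have e4 : 0 < e / 4 by rewrite divr_gt0.
  have [s hs] := tails _ e4.
  have pt : l2norm (cutoff (~` [set` s]) p) <= e / 4.
    apply: l2norm_le; first exact: ltW.
    apply: sqsum_fatou => [|s' e' e'0]; first exact: ltW.
    have [x [Ax hx]] := ultra_meet UF FA (hp s' e' e'0).
    exists (cutoff (~` [set` s]) x); split; first exact: hs.
    move=> t ts; rewrite !cutoffE; case: ifP => _; first exact: hx.
    by rewrite subrr normc0 ltW.
  have d0 : 0 < e / 4 / ((size s)%:R + 1) by rewrite !divr_gt0 // ltr_wpDl.
  apply: filterS (filterI FA (hp s _ d0)) => x [Ax hx]; apply: eU.
  rewrite [p - x](cutoffC [set` s]).
  have h1 := @cutoff_small [set` s] (p - x) s _ erefl (ltW d0).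
  have {}h1 : l2norm (cutoff [set` s] (p - x)) <= e / 4.
    apply: le_trans (h1 _) _; first by move=> t ts; rewrite l2DE l2NE; exact: hx.
    by rewrite mulrA ler_pdivrMr ?ltr_wpDl //; lra.
  have h2 : l2norm (cutoff (~` [set` s]) (p - x)) <= e / 4 + e / 4.
    rewrite (linB _ _ (cutoff_linear _)); apply: le_trans (l2normB _ _) _.
    by apply: lerD => //; exact: hs.
  by apply: le_lt_trans (l2normD _ _) _; lra.
exists p; split=> //; apply: clA => B /Fp FB.
by have [x [Ax Bx]] := ultra_meet UF FA FB; exists x.
Qed.

End Topology.

(** * Diagonal operators *)

Section Diagonal.
Context {R : realType}.
Local Notation H := (l2 R idx).
Implicit Types (x y : H) (d : idx -> R).

Definition diagD d : set (H * H) :=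
  [set xy : H * H | forall t, xy.2 t = (d t)%:C%C * xy.1 t].

Lemma diagD_linear d : linear_graph (diagD d).
Proof.
by move=> c x y x' y' /= h h' t; rewrite !l2DE !l2ZE h h' mulrDr mulrCA.
Qed.

Lemma diagD0 d : diagD d (0, 0).
Proof. by move=> t /=; rewrite mulr0. Qed.

Definition evec (t : idx) : H := L2 (delta_summable t).

Lemma evecE t s : evec t s = (s == t)%:R :> R[i]. Proof. by []. Qed.

Let conjcR (z w : R[i]) (k : R) :
  (k%:C * z)%C * (w^*)%C = z * ((k%:C * w)^*)%C.
Proof. by case: z w => a b [e f]; apply/eqP; rewrite eq_complex /=; apply/andP; split; apply/eqP; ring. Qed.

(** The domain is dense because it contains the finitely supported vectors; testing
    the adjoint against basis vectors shows that it is D again. *)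
Lemma diagD_self_adjoint d : self_adjoint (diagD d).
Proof.
split.
  move=> O [x Ox] oO; have /nbhs_l2P[e e0 eO] : nbhs x O by exact: open_nbhs_nbhs.
  have e2 : 0 < e / 2 by rewrite divr_gt0.
  have [s us hs] := tail_small x e2.
  set z := cutoff [set` s] x.
  exists z; split.
    apply: eO; have -> : (x : H) - z = cutoff (~` [set` s]) x.
      by apply: (addIr z); rewrite subrK addrC; exact: cutoffC.
    by apply: le_lt_trans hs _; lra.
  have sm : square_summable (fun t => (d t)%:C%C * z t).
    have M0 : 0 <= \sum_(t <- s) `|d t| by exact: sumr_ge0.
    apply: (@sqsum_le_summable _ _ _ ((\sum_(t <- s) `|d t| * l2norm z) ^+ 2)).
    rewrite -mulr_suml; apply: (@sqsum_reindex_le _ _ _ _ setT id _ M0) => [//|t []//|t _].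
    rewrite normcM normcR cutoffE; case: ifPn => [ts|_]; last by rewrite normc0 !mulr0.
    rewrite ler_wpM2r ?normc_ge0 //.
    move: ts; rewrite inE /= => ts.
    by rewrite (bigD1_seq t) //= lerDl sumr_ge0.
  by exists (L2 sm).
apply/seteqP; split=> [[x y] /= h u w /= hu|[x y] /= h t].
  by apply: inner_eq => t; rewrite hu h conjcR.
have ht : diagD d (evec t, (d t)%:C%C *: evec t).
  by move=> u /=; rewrite /delta; case: eqP => [->//|_]; rewrite !mulr0.
have := h _ _ ht; rewrite (@inner_supp1 _ _ _ _ t); last first.
  by move=> u ut; rewrite l2ZE evecE (negbTE ut) mulr0.
rewrite (@inner_supp1 _ _ _ _ t); last by move=> u ut; rewrite evecE (negbTE ut).
rewrite l2ZE conjcR evecE eqxx !mul1r => /(congr1 (@conjc R)).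
by rewrite !conjcK.
Qed.

(** The coordinate of (D - l) x at an index t with d t = l is zero, but D - l is onto. *)
Lemma diagD_resolvent d l K : is_resolvent (diagD d) l K ->
  (forall t, (d t)%:C%C - l != 0) /\ forall y t, K y t = ((d t)%:C%C - l)^-1 * y t.
Proof.
move=> [_ hK _].
have E y t : ((d t)%:C%C - l) * K y t = y t.
  have /= h := hK y t.
  by rewrite mulrBl -h addrK.
have n0 t : (d t)%:C%C - l != 0.
  apply/eqP => h; have := E (evec t) t.
  by rewrite h mul0r evecE eqxx => /eqP; rewrite eq_sym oner_eq0.
by split=> // y t; rewrite -[in RHS](E y t) mulKf.
Qed.

Lemma id_inj : injective (@id idx). Proof. by []. Qed.

Lemma finite_level n : finite_set [set t : idx | ((val t).1.1 < n)%N].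
Proof.
pose t0 : idx := exist _ (0, 0, 0)%N isT.
apply: (sub_finite_set (B := (fun p : nat * nat * nat => insubd t0 p) @`
   ((`I_n `*` `I_n) `*` `I_n))); last first.
  by apply: finite_image; apply: finite_setX; [apply: finite_setX|]; exact: finite_II.
move=> t /= tn; exists (val t); last by rewrite valKd.
by case: t tn => [[[N a] b] /= /andP[aN bN]] Nn; split; [split|] => /=; lia.
Qed.

Lemma diagD_compact_resolvent d : (forall t, ((val t).1.1)%:R + 1 <= `|d t|) ->
  compact_resolvent (diagD d).
Proof.
move=> hd; have d0 t : d t != 0.
  by rewrite -normr_gt0; apply: lt_le_trans (hd t); rewrite ltr_wpDl.
have iw t : `|(d t)^-1| <= ((val t).1.1%:R + 1)^-1.
  by rewrite normfV lef_pV2 ?posrE ?normr_gt0 // ltr_wpDl.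
have wb : weight_bounded (fun t => (d t)^-1).
  exists 1 => t; apply: le_trans (iw t) _.
  by rewrite invf_le1 ?ltr_wpDl // lerDr.
pose K := dn id (fun t => (d t)^-1) : H -> H.
have KE x t : K x t = ((d t)^-1)%:C%C * x t by rewrite /K (dnE id_inj wb).
have bK : bounded K := bounded_dn id_inj wb.
have dK t : (d t)%:C%C * ((d t)^-1)%:C%C = 1 :> R[i].
  by rewrite -rmorphM mulfV.
have K1 x : l2norm (K x) <= l2norm x.
  rewrite -[leRHS]mul1r; apply: (dn_le id_inj wb) => // s _.
  by apply: le_trans (iw s) _; rewrite invf_le1 ?ltr_wpDl // lerDr.
exists 0, K; split.
  split; first exact: bounded_bounded_op.
    by move=> y t; rewrite /= mul0r addr0 KE mulrA dK mul1r.
  move=> x y /= h; apply: l2_ext => t.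
  by rewrite scale0r subr0 KE h mulrA (mulrC _ (d t)%:C%C) dK mul1r.
split; first exact: bounded_bounded_op.
set B := K @` _.
have cB (y : H) (e : R) : 0 < e -> closure B y -> exists2 x : H, l2norm x <= 1 & l2norm (y - K x) < e.
  move=> e0 /(_ [set z : H | l2norm (y - z) < e]) [].
    by apply/nbhs_l2P; exists e.
  move=> _ [[x x1 <-] /= h]; exists x => //.
  by move: x1; rewrite /= l2_normE lecR.
apply: (@compact_tails _ _ _ 2); first exact: closed_closure.
  move=> y /(cB y 1 ltr01)[x x1 yx]; rewrite -[y](subrK (K x)).
  by apply: le_trans (l2normD _ _) _; have := K1 x; lra.
move=> e e0; have e2 : 0 < e / 2 by rewrite divr_gt0.
pose n := Num.bound (2 / e).
have hn : (n%:R + 1)^-1 <= e / 2.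
  rewrite -[e / 2]invrK lef_pV2 ?posrE ?invr_gt0 ?ltr_wpDl // invf_div.
  have : 2 / e < n%:R by apply: archi_boundP; rewrite divr_ge0 // ltW.
  by move=> h; rewrite (le_trans (ltW h)) // lerDl.
exists (finmap.enum_fset (fset_set [set t : idx | ((val t).1.1 < n)%N])) => y.
have -> : [set` finmap.enum_fset (fset_set [set t : idx | ((val t).1.1 < n)%N])] =
    [set t : idx | ((val t).1.1 < n)%N].
  by apply/seteqP; split=> t /=; rewrite in_fset_set ?inE //; exact: finite_level.
move=> /(cB y _ e2)[x x1 yx]; rewrite -[y](subrK (K x)) (linD _ _ (cutoff_linear _)).
apply: le_trans (l2normD _ _) _.
have h1 := cutoff_le (~` [set t : idx | ((val t).1.1 < n)%N]) (y - K x).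
have h2 : l2norm (cutoff (~` [set t : idx | ((val t).1.1 < n)%N]) (K x)) <= e / 2 * l2norm x.
  apply: l2norm_le_coord => [|t]; first exact: ltW.
  rewrite cutoffE; case: ifPn => [|_]; last first.
    by rewrite normc0 mulr_ge0 ?normc_ge0 // ltW.
  rewrite inE /= => /negP; rewrite -leqNgt => nt.
  rewrite KE normcM normcR ler_wpM2r ?normc_ge0 //.
  apply: le_trans (iw t) (le_trans _ hn).
  by rewrite lef_pV2 ?posrE ?ltr_wpDl // lerD2r ler_nat.
by have := ler_wpM2l (ltW e2) x1; lra.
Qed.

(** The commutator of a diagonal operator with a shift is the shift weighted
    by the differences of the eigenvalues. *)
Lemma commutator_up d f w : injective f -> weight_bounded w ->
  weight_bounded (fun s => (d (f s) - d s) * w s) -> commutator_bounded (diagD d) (up f w).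
Proof.
move=> fI wb db; have [M hM] := db.
exists `|M| => // x y h; have {}h t : y t = (d t)%:C%C * x t := h t.
exists (up f w y + up f (fun s => (d (f s) - d s) * w s) x).
  move=> t /=; rewrite (upE f wb y) (upE f db x) (upE f wb x).
  case E: (partial_inv f t) => [s|]; last by rewrite mulr0 addr0.
  rewrite h -(partial_invP E) (rmorphM (real_complex R)) (rmorphB (real_complex R)) /=; ring.
rewrite addrAC subrr add0r; apply: up_le => // s _.
exact: le_trans (hM s) (ler_norm _).
Qed.

Lemma commutator_dn d f w : injective f -> weight_bounded w ->
  weight_bounded (fun s => (d (f s) - d s) * w s) -> commutator_bounded (diagD d) (dn f w).
Proof.
move=> fI wb db; have [M hM] := db.
exists `|M| => // x y h; have {}h t : y t = (d t)%:C%C * x t := h t.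
exists (dn f w y - dn f (fun s => (d (f s) - d s) * w s) x).
  move=> t /=; rewrite (dnE fI wb y) (dnE fI db x) (dnE fI wb x).
  rewrite h (rmorphM (real_complex R)) (rmorphB (real_complex R)) /=; ring.
rewrite addrAC subrr add0r l2normN; apply: (dn_le fI db) => // s _.
exact: le_trans (hM s) (ler_norm _).
Qed.

Section Equivariance.
Context (q : R) (d : idx -> R).
Context (hd : forall t t' : idx, (val t).1.1 = (val t').1.1 ->
  (val t).1.2 = (val t').1.2 -> d t = d t').

Let A1_diag (k : idx -> R[i]) x y x' y' :
  (forall t t' : idx, (val t).1.1 = (val t').1.1 ->
     (val t).1.2 = (val t').1.2 -> k t = k t') ->
  (forall t, x' t = k t * x t) -> (forall t, y' t = k t * y t) ->
  A1 q (x, y) -> A1 q (x', y').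
Proof.
move=> hk xk yk h t; have := h t; case: t => [[[N a] b] ht] /= E.
rewrite yk E; case: b ht {E} => [|b] ht; first by rewrite mulr0.
have ht' : ((a <= N) && (b <= N))%N by move: ht => /= /andP[-> /ltnW ->].
rewrite !(coord_in _ ht') xk mulrCA; congr (_ * (_ * _)).
exact: hk.
Qed.

(** A resolvent of D multiplies the coordinates by a function of N and a, and so does
    its adjoint, while A_0 and A_1 multiply by functions of N and b and shift b only. *)
Lemma diagD_equivariant : equivariant q (diagD d).
Proof.
have kd (l : R[i]) t t' : (val t).1.1 = (val t').1.1 ->
  (val t).1.2 = (val t').1.2 -> ((d t)%:C%C - l)^-1 = ((d t')%:C%C - l)^-1.
  by move=> e1 e2; rewrite (hd e1 e2).
split=> l K rK x y; have [n0 KE] := diagD_resolvent rK.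
- move=> h t; have := h t; case: t => [[[N a] b] ht] /= E.
  by rewrite !KE E mulrCA.
- by apply: A1_diag (KE x) (KE y); exact: kd.
- move=> h u w uw /=.
  have Ks (z : H) : square_summable (fun t => (((d t)%:C%C - l)^-1)^*%C * z t).
    rewrite /square_summable (_ : sqsum _ = sqsum (K z)); first exact: l2P.
    by apply: eq_esum => t _; rewrite KE !normcM normcJ.
  have kJ (t t' : idx) : (val t).1.1 = (val t').1.1 -> (val t).1.2 = (val t').1.2 ->
      (((d t)%:C%C - l)^-1)^*%C = (((d t')%:C%C - l)^-1)^*%C.
    by move=> e1 e2; rewrite (kd l t t').
  have := h _ _ (@A1_diag _ u w (L2 (Ks u)) (L2 (Ks w)) kJ (fun t => erefl) (fun t => erefl) uw).
  have mv (z z' : H) : inner (L2 (Ks z)) z' = inner z (K z').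
    apply: inner_eq => t; rewrite KE /=; move: (_^-1) (z t) (z' t).
    by move=> [a b] [e f] [g k]; apply/eqP; rewrite eq_complex /=;
      apply/andP; split; apply/eqP; ring.
  by rewrite !mv.
Qed.

End Equivariance.

(** * Sign and spectral projection *)

Definition sgn_weight d (t : idx) : R := if d t < 0 then -1 else 1.

Lemma wb_sgn d : weight_bounded (sgn_weight d).
Proof. by exists 1 => t; rewrite /sgn_weight; case: ifP; rewrite ?normrN normr1. Qed.

Definition signD d : H -> H := dn id (sgn_weight d).

Lemma signDE d x t : signD d x t = (if d t < 0 then -1 else 1) * x t.
Proof.
rewrite /signD (dnE id_inj (wb_sgn d)) /sgn_weight.
by case: ifP => _; rewrite ?rmorphN1 ?rmorph1.
Qed.

Lemma signD_is_sign d : is_sign (diagD d) (signD d).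
Proof.
split; first exact/bounded_bounded_op/(bounded_dn id_inj (wb_sgn d)).
move=> l x h; apply: l2_ext => t; rewrite signDE l2ZE.
have /eqP : (d t)%:C%C * x t = l%:C%C * x t by rewrite -[LHS](h t).
rewrite -subr_eq0 -mulrBl mulf_eq0 => /orP[|/eqP ->]; last by rewrite !mulr0.
by rewrite -rmorphB /= => /eqP [/eqP]; rewrite subr_eq0 => /eqP ->.
Qed.

Lemma cutoff_orth_proj d :
  orth_proj (cutoff [set t | d t < 0]) [set x : H | signD d x = - x].
Proof.
move=> x; split=> [|v /= hv].
  apply: l2_ext => t; rewrite signDE l2NE cutoffE.
  case: (boolP (d t < 0)) => dt; first by rewrite mem_set // mulN1r.
  by rewrite memNset ?mulr0 ?oppr0 //; exact/negP.
apply: inner_disjoint => t; rewrite l2DE l2NE cutoffE.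
case: ifPn => [_|]; first by rewrite subrr mul0r.
rewrite notin_setE /= => /negP h; have := congr1 (fun z : H => z t) hv.
rewrite signDE l2NE (negbTE h) mul1r => /eqP; rewrite -addr_eq0 -mulr2n mulrn_eq0 /=.
by move=> /eqP ->; rewrite conjc0 mulr0.
Qed.

End Diagonal.

(** * The Dirac operators *)

Section Estimates.
Context {R : realType} (q : R) (hq : 0 < q < 1).

Let q0 : 0 <= q. Proof. by case/andP: hq => /ltW. Qed.
Let q1 : q <= 1. Proof. by case/andP: hq => _ /ltW. Qed.

Lemma q_exp01 k : 0 <= q ^+ k <= 1.
Proof. by rewrite exprn_ge0 // exprn_ile1. Qed.

Lemma q_exp_le k l : (k <= l)%N -> q ^+ l <= q ^+ k.
Proof. by move=> kl; rewrite ler_wiXn2l. Qed.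

Let q_pos k : (0 < k)%N -> 0 < 1 - q ^+ k.
Proof. by case: k => // k _; case/andP: hq => h0 h1; rewrite subr_gt0 exprn_ilt1. Qed.

Let q_ge0 k : 0 <= 1 - q ^+ k.
Proof. by have /andP[_] := q_exp01 k; rewrite subr_ge0. Qed.

Lemma ratio_bounds u v w z : (0 < w)%N -> (0 < z)%N -> (u <= w)%N -> (v <= z)%N ->
  (1 - q ^+ u) * (1 - q ^+ v) <=
  (1 - q ^+ u) * (1 - q ^+ v) / ((1 - q ^+ w) * (1 - q ^+ z)) <= 1.
Proof.
move=> w0 z0 uw vz; have wz : 0 < (1 - q ^+ w) * (1 - q ^+ z) by rewrite mulr_gt0 ?q_pos.
rewrite ler_pdivlMr // ler_pdivrMr // mul1r; apply/andP; split.
  rewrite ler_piMr ?mulr_ge0 // mulr_ile1 // lerBlDr lerDl;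
  by have /andP[] := q_exp01 w; have /andP[] := q_exp01 z.
by rewrite ler_pM // lerD2l lerN2 q_exp_le.
Qed.

Lemma sqrt_ratio_le e k u v w z :
  (2 * e <= k)%N -> (0 < w)%N -> (0 < z)%N -> (u <= w)%N -> (v <= z)%N ->
  Num.sqrt (q ^+ k * ((1 - q ^+ u) * (1 - q ^+ v) /
    ((1 - q ^+ w) * (1 - q ^+ z)))) <= q ^+ e.
Proof.
move=> ek w0 z0 uw vz; have /andP[h1 h2] := ratio_bounds w0 z0 uw vz.
have e0 : 0 <= q ^+ e by rewrite exprn_ge0.
rewrite -[leRHS]ger0_norm // -sqrtr_sqr ler_wsqrtr // -exprM mulnC.
apply: le_trans (_ : q ^+ k * 1 <= _); last by rewrite mulr1 q_exp_le.
by rewrite ler_wpM2l // exprn_ge0.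
Qed.

Lemma a_plus_le N a b : (a <= N)%N -> (b <= N)%N -> `|a_plus q N a b| <= q ^+ a.
Proof. by move=> aN bN; rewrite ger0_norm ?sqrtr_ge0 // sqrt_ratio_le //; lia. Qed.

Lemma bm_le N a b : (a <= N)%N -> (b <= N)%N -> `|bm q N a b| <= q ^+ a.
Proof. by move=> aN bN; rewrite ger0_norm ?sqrtr_ge0 // sqrt_ratio_le //; lia. Qed.

Lemma nq_bounded : exists2 M, 0 <= M & forall n, n%:R * q ^+ n <= M.
Proof.
have /andP[h0 h1] := hq.
pose h := q^-1 - 1; have hp : 0 < h by rewrite subr_gt0 invf_gt1.
exists h^-1 => [|n]; first by rewrite invr_ge0 ltW.
have B : 1 + n%:R * h <= q^-1 ^+ n.
  have -> : q^-1 = 1 + h by rewrite /h addrC subrK.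
  elim: n => [|n IH]; first by rewrite mul0r addr0 expr0.
  have hn : 0 <= n%:R * h by rewrite mulr_ge0 // ltW.
  rewrite exprS -natr1; have := ler_wpM2l (_ : 0 <= 1 + h) IH.
  by move=> /(_ (addr_ge0 ler01 (ltW hp))); have := mulr_ge0 hn (ltW hp); lra.
rewrite -[leRHS]mul1r ler_pdivlMr //.
have qn : q ^+ n * q^-1 ^+ n = 1 by rewrite -exprMn mulfV ?expr1n // gt_eqF.
have := ler_wpM2l (_ : 0 <= q ^+ n) B.
by move=> /(_ (exprn_ge0 _ q0)); rewrite qn; have /andP[h2 _] := q_exp01 n; lra.
Qed.

End Estimates.

Section Dirac.
Context {R : realType} (q : R) (hq : 0 < q < 1) (N0 k : nat) (flip : bool).
Local Notation H := (l2 R idx).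

(** The lines N - a < k, from the level N0 on.  A large N0 makes the errors in the
    estimates of gamma on this region small. *)
Definition region (t : idx) : bool :=
  (N0 <= (val t).1.1)%N && ((val t).1.1 - (val t).1.2 < k)%N.

(** The eigenvalues are negative on the region, or on its complement if [flip]. *)
Definition dirac_eig (t : idx) : R :=
  (if region t (+) flip then -1 else 1) * ((val t).1.1%:R + 1).

Lemma dirac_lt0 t : (dirac_eig t < 0) = region t (+) flip.
Proof.
rewrite /dirac_eig; case: ifP => _; last by rewrite mul1r ltNge addr_ge0.
by rewrite mulN1r oppr_lt0 ltr_wpDl.
Qed.

Lemma dirac_norm t : `|dirac_eig t| = (val t).1.1%:R + 1.
Proof.
by rewrite normrM [X in _ * X]ger0_norm ?addr_ge0 //;
  case: ifP => _; rewrite ?normrN normr1 mul1r.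
Qed.

Lemma dirac_level (t t' : idx) : (val t).1.1 = (val t').1.1 ->
  (val t).1.2 = (val t').1.2 -> dirac_eig t = dirac_eig t'.
Proof. by move=> e1 e2; rewrite /dirac_eig /region e1 e2. Qed.

(** A shift that changes the sign of D does so at a bounded level, or moves
    between the lines N - a = k - 1 and N - a = k, where its weight is O(q^N). *)
Lemma dirac_commutator_weight (e1 e2 : bool) (W : nat -> nat -> nat -> R) :
  (forall N a b, (a <= N)%N -> (b <= N)%N -> `|W N a b| <= 1) ->
  (e1 \/ forall N a b, (a <= N)%N -> (b <= N)%N -> `|W N a b| <= q ^+ a) ->
  weight_bounded (fun s => (dirac_eig (ush e1 e2 s) - dirac_eig s) * wt W s).
Proof.
move=> W1 W2; have [M M0 hM] := nq_bounded hq.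
have n23 j : (2 * j + 3)%N%:R = 2 * j%:R + 3 :> R by rewrite natrD natrM.
exists ((2 * N0 + 3)%N%:R + (2 * M + (2 * k + 3)%N%:R)) => t.
have K1 : 1 <= (2 * N0 + 3)%N%:R + (2 * M + (2 * k + 3)%N%:R) :> R.
  rewrite !n23; have := ler0n R N0; have := ler0n R k; lra.
have cases : region (ush e1 e2 t) = region t \/
    ((val t).1.1.+1 = N0 \/ (~~ e1 /\ (val t).1.1 <= (val t).1.2 + k)%N).
  rewrite /region /=; case: t => [[[N a] b] /= /andP[aN bN]].
  by case: (e1) => /=; lia.
have tt := idx_le t.
have {}W1 := W1 _ _ _ tt.1 tt.2; rewrite normrM /wt.
case: cases => [same|cases].
  apply: le_trans K1; rewrite /dirac_eig same -mulrBr normrM /=.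
  rewrite -natr1 (_ : _ - _ = 1); last by ring.
  by rewrite normr1 mulr1; case: ifP => _; rewrite ?normrN normr1 mul1r.
have dd : `|dirac_eig (ush e1 e2 t) - dirac_eig t| <= 2 * (val t).1.1%:R + 3.
  by apply: le_trans (ler_normB _ _) _; rewrite !dirac_norm /= -natr1; lra.
have D0 : (0 : R) <= 2 * (val t).1.1%:R + 3 by rewrite addr_ge0 // mulr_ge0.
case: cases => [NN0|[ne1 Nak]].
  apply: le_trans (ler_pM _ _ dd W1) _ => //.
  rewrite mulr1 -NN0 !n23 -natr1.
  have := ler0n R (val t).1.1; have := ler0n R k; lra.
have {}W2 : `|W (val t).1.1 (val t).1.2 (val t).2| <= q ^+ ((val t).1.1 - k).
  case: W2 => [h|h]; first by rewrite h in ne1.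
  by apply: le_trans (h _ _ _ tt.1 tt.2) (q_exp_le hq _); lia.
apply: le_trans (ler_pM _ _ dd W2) _ => //.
set n := ((val t).1.1 - k)%N.
have Nn : (val t).1.1%:R <= n%:R + k%:R :> R by rewrite -natrD ler_nat; lia.
have /andP[h0 h1] := q_exp01 hq n; have := hM n.
have hk := ler0n R k; have hN0 := ler0n R N0.
have h2 : (2 * (val t).1.1%:R + 3) * q ^+ n <= (2 * n%:R + (2 * k%:R + 3)) * q ^+ n.
  by apply: ler_wpM2r => //; lra.
have h3 : (2 * k%:R + 3) * q ^+ n <= 2 * k%:R + 3 by rewrite ler_piMr //; lra.
rewrite !n23; lra.
Qed.

Lemma smooth_alpha : smooth (diagD dirac_eig) (alpha q).
Proof.
have am1 N a b : (a <= N)%N -> (b <= N)%N -> `|am q N a b| <= 1.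
  by move=> aN bN; exact: a_minus_le1.
have I1 := @dirac_commutator_weight false false (a_plus q).
have I2 := @dirac_commutator_weight true true (am q).
have {}I1 := I1 (a_plus_le1 hq) (or_intror (a_plus_le hq)).
have {}I2 := I2 am1 (or_introl isT).
exists (alphaS q); split; [exact: bounded_alpha|exact: bounded_alphaS|exact: adjoint_alpha| |].
  have -> : alpha q = (fun x => up (ush false false) (wt (a_plus q)) x +
      dn (ush true true) (wt (am q)) x) by apply/funext; exact: alpha_shift.
  apply: commutator_boundedD; first exact: diagD_linear.
    by apply: commutator_up => //; [exact: ush_inj|exact: wb_ap].
  by apply: commutator_dn => //; [exact: ush_inj|exact: wb_am].
apply: commutator_boundedD; first exact: diagD_linear.
  by apply: commutator_dn => //; [exact: ush_inj|exact: wb_ap].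
by apply: commutator_up => //; [exact: ush_inj|exact: wb_am].
Qed.

Lemma smooth_beta : smooth (diagD dirac_eig) (beta q).
Proof.
have bm1 N a b : (a <= N)%N -> (b <= N)%N -> `|bm q N a b| <= 1.
  by move=> aN bN; apply: b_minus_le1 => //; exact: leqW.
have I1 := @dirac_commutator_weight true false (b_plus q).
have I2 := @dirac_commutator_weight false true (bm q).
have {}I1 := I1 (b_plus_le1 hq) (or_introl isT).
have {}I2 := I2 bm1
  (or_intror (bm_le hq)).
exists (betaS q); split; [exact: bounded_beta|exact: bounded_betaS|exact: adjoint_beta| |].
  have -> : beta q = (fun x => up (ush true false) (wt (b_plus q)) x +
      dn (ush false true) (wt (bm q)) x) by apply/funext; exact: beta_shift.
  apply: commutator_boundedD; first exact: diagD_linear.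
    by apply: commutator_up => //; [exact: ush_inj|exact: wb_bp].
  by apply: commutator_dn => //; [exact: ush_inj|exact: wb_bm].
apply: commutator_boundedD; first exact: diagD_linear.
  by apply: commutator_dn => //; [exact: ush_inj|exact: wb_bp].
by apply: commutator_up => //; [exact: ush_inj|exact: wb_bm].
Qed.

Lemma dirac_triple : odd_spectral_triple (SUq2_poly q) (diagD dirac_eig).
Proof.
split; first exact: diagD_self_adjoint.
  by apply: diagD_compact_resolvent => t; rewrite dirac_norm.
move=> T hT; apply: commutator_bounded_bounded_commutator.
have G T' : [set alpha q; beta q] T' -> smooth (diagD dirac_eig) T'.
  by case=> ->; [exact: smooth_alpha|exact: smooth_beta].
by have [S []] := star_alg_smooth (@diagD_linear R dirac_eig) (diagD0 _) G hT.
Qed.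

End Dirac.

(** * Asymptotics along the lines N - a < k *)

Section Asymptotics.
Context {R : realType} (k : nat).
Local Notation H := (l2 R idx).
Implicit Types (x y : H) (S T : H -> H).

Definition supported (n : nat) x := forall t, ~~ region n k t -> x t = 0.

Lemma supported_mono n n' x : (n <= n')%N -> supported n' x -> supported n x.
Proof.
move=> nn hx t ht; apply: hx; apply: contra ht; rewrite /region.
by move=> /andP[h ->]; rewrite (leq_trans nn h).
Qed.

Definition stable S := forall n x, supported n x -> supported n (S x).

(** S is the limit of T at infinity along the lines N - a < k. *)
Definition asymp T S := forall e, 0 < e -> exists n, forall x, supported n x ->
  l2norm (T x - S x) <= e * l2norm x.

Lemma asympxx T : asymp T T.
Proof.
move=> e e0; exists 0%N => x _.
by rewrite subrr l2norm0 mulr_ge0 ?l2norm_ge0 // ltW.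
Qed.

Lemma asympD T T' S S' : asymp T S -> asymp T' S' ->
  asymp (fun x => T x + T' x) (fun x => S x + S' x).
Proof.
move=> h h' e e0; have e2 : 0 < e / 2 by rewrite divr_gt0.
have [n hn] := h _ e2; have [n' hn'] := h' _ e2.
exists (maxn n n') => x hx; rewrite opprD addrACA.
apply: le_trans (l2normD _ _) _.
have := hn x (supported_mono (leq_maxl _ _) hx).
have := hn' x (supported_mono (leq_maxr _ _) hx).
lra.
Qed.

Lemma asympN T S : asymp T S -> asymp (fun x => - T x) (fun x => - S x).
Proof.
move=> h e e0; have [n hn] := h _ e0; exists n => x hx.
by rewrite -opprD l2normN; exact: hn.
Qed.

(** Stability of S' is what allows the estimate for T - S to be used at S' x. *)
Lemma asympM T T' S S' : bounded T -> bounded S' -> stable S' ->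
  asymp T S -> asymp T' S' -> asymp (T \o T') (S \o S').
Proof.
move=> [lT [M M0 hM]] [_ [M' M'0 hM']] st h h' e e0.
have e1 : 0 < e / (2 * M + 1) by rewrite divr_gt0 // ltr_wpDl // mulr_ge0.
have e2 : 0 < e / (2 * M' + 1) by rewrite divr_gt0 // ltr_wpDl // mulr_ge0.
have [n hn] := h _ e2; have [n' hn'] := h' _ e1.
exists (maxn n n') => x hx.
have E : T (T' x) - S (S' x) = T (T' x - S' x) + (T (S' x) - S (S' x)).
  by rewrite (linB _ _ lT) addrA subrK.
change (l2norm (T (T' x) - S (S' x)) <= e * l2norm x); rewrite E.
apply: le_trans (l2normD _ _) _.
have h1 := hn' x (supported_mono (leq_maxr _ _) hx).
have h2 := hn _ (st _ _ (supported_mono (leq_maxl _ _) hx)).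
have h3 := le_trans (hM _) (ler_wpM2l M0 h1).
have h4 := le_trans h2 (ler_wpM2l (ltW e2) (hM' x)).
apply: le_trans (lerD h3 h4) _; rewrite !mulrA -mulrDl ler_wpM2r ?l2norm_ge0 //.
have half (c : R) : 0 <= c -> c * (e / (2 * c + 1)) <= e / 2.
  by move=> c0; rewrite mulrA ler_pdivrMr ?ltr_wpDl ?mulr_ge0 //; lra.
have := half _ M0; have := half _ M'0; lra.
Qed.

Lemma asymp_iter T S r : bounded T -> bounded S -> stable S -> asymp T S ->
  asymp (iter r T) (iter r S).
Proof.
move=> bT bS sS h; elim: r => [|r IH]; first exact: asympxx.
have bi : bounded (iter r S).
  by elim: (r) => [|j hj]; [exact: bounded_id|exact: bounded_comp bS hj].
have si : stable (iter r S) by elim: (r) => [//|j hj] n x hx; exact/sS/hj.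
exact: (asympM bT bi si h IH).
Qed.

End Asymptotics.

Lemma region_ush n k e1 e2 s : region n k (ush e1 e2 s) =
  (n <= (val s).1.1.+1)%N && ((val s).1.1.+1 - ((val s).1.2 + e1) < k)%N.
Proof. by []. Qed.

Section BetaAsymptotics.
Context {R : realType} (q : R) (hq : 0 < q < 1) (k : nat).
Local Notation H := (l2 R idx).
Implicit Types (x y : H).

Let q0 : 0 <= q. Proof. by case/andP: hq => /ltW. Qed.

(** The square root in b_plus is that of (1 - u)(1 - v) divided by factors below 1,
    with q^b u <= q^a and v <= q^a; and 1 - sqrt x <= 1 - x on [0, 1]. *)
Lemma b_plus_approx N a b : (a <= N)%N -> (b <= N)%N ->
  `|b_plus q N a b + q ^+ b| <= 2 * q ^+ a.
Proof.
move=> aN bN; rewrite /b_plus.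
have e1 : (a <= b + (2 * (N - b) + 2))%N by lia.
have e2 : (a <= b + (2 * a + 2))%N by lia.
set rho := (_ * _ / _ : R).
have /andP[h1 h2] : (1 - q ^+ (2 * (N - b) + 2)) * (1 - q ^+ (2 * a + 2)) <= rho <= 1.
  by apply: ratio_bounds => //; lia.
have /andP[u0 u1] := q_exp01 hq (2 * (N - b) + 2).
have /andP[v0 v1] := q_exp01 hq (2 * a + 2).
have r0 : 0 <= rho by apply: le_trans h1; rewrite mulr_ge0 // subr_ge0.
have b0 : 0 <= q ^+ b by rewrite exprn_ge0.
rewrite sqrtrM; last by rewrite exprn_ge0.
rewrite mulnC exprM sqrtr_sqr (ger0_norm b0) addrC.
rewrite -[X in X - _]mulr1 -mulrBr normrM (ger0_norm b0).
have s1 : Num.sqrt rho <= 1 by rewrite -sqrtr1 ler_wsqrtr.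
have s0 := sqrtr_ge0 rho.
rewrite ger0_norm ?subr_ge0 //.
have s2 : 1 - Num.sqrt rho <= 1 - rho.
  by rewrite lerD2l lerN2 -[leLHS]sqr_sqrtr // expr2 ler_piMl.
apply: le_trans (ler_wpM2l b0 s2) _.
have s3 : 1 - rho <= q ^+ (2 * (N - b) + 2) + q ^+ (2 * a + 2).
  by move: h1 u0 v0; move: (q ^+ _) (q ^+ _) => u v; nra.
apply: le_trans (ler_wpM2l b0 s3) _.
have x1 : q ^+ b * q ^+ (2 * (N - b) + 2) <= q ^+ a.
  by rewrite -exprD q_exp_le.
have x2 : q ^+ b * q ^+ (2 * a + 2) <= q ^+ a.
  by rewrite -exprD q_exp_le.
move: s1 s2 s3 {h1 h2}; lra.
Qed.

(** Along the lines N - a < k, b_plus tends to -q^b and b_minus tends to 0, so that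
    beta becomes a single shift. *)
Definition limit_weight (N a b : nat) : R := - q ^+ b.

Lemma wb_limit : weight_bounded (wt limit_weight).
Proof.
exists 1 => t; rewrite normrN ger0_norm ?exprn_ge0 //.
by have /andP[] := q_exp01 hq (val t).2.
Qed.

Definition beta_lim : H -> H := up (ush true false) (wt limit_weight).
Definition betaS_lim : H -> H := dn (ush true false) (wt limit_weight).

Let sub_bounded (w w' : idx -> R) : weight_bounded w -> weight_bounded w' ->
  weight_bounded (fun s => w s - w' s).
Proof.
by move=> [M h] [M' h']; exists (M + M') => s; apply: le_trans (ler_normB _ _) (lerD _ _).
Qed.

Let up_sub f (w w' : idx -> R) x : weight_bounded w -> weight_bounded w' ->
  up f w x - up f w' x = up f (fun s => w s - w' s) x.
Proof.
move=> h h'; apply: l2_ext => t; rewrite l2DE l2NE (upE _ h) (upE _ h') (upE _ (sub_bounded h h')).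
by case: partial_inv => [s|]; rewrite ?subrr // -mulrBl -rmorphB.
Qed.

Let dn_sub f (w w' : idx -> R) x : injective f -> weight_bounded w -> weight_bounded w' ->
  dn f w x - dn f w' x = dn f (fun s => w s - w' s) x.
Proof.
move=> fI h h'; apply: l2_ext => t; rewrite l2DE l2NE (dnE fI h) (dnE fI h') (dnE fI (sub_bounded h h')).
by rewrite -mulrBl -rmorphB.
Qed.

Let in_region n x t : supported k n x -> x t != 0 -> region n k t.
Proof. by move=> hx; apply: contraR => /hx ->. Qed.

Let small e : 0 < e -> exists n, 3 * q ^+ n <= e.
Proof.
move=> e0; have q01 : 0 <= q < 1 by rewrite q0; case/andP: hq.
have e3 : 0 < e / 3 by rewrite divr_gt0.
have [n /(_ n (leqnn n)) h] := expr_small q01 e3.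
by exists n; move: h; lra.
Qed.

Lemma beta_asymp : asymp k (beta q) beta_lim.
Proof.
move=> e /small[n hn]; exists (n + k.+1)%N => x hx.
have qn : 0 <= q ^+ n by rewrite exprn_ge0.
rewrite (beta_shift hq) addrAC (up_sub _ _ (wb_bp hq) wb_limit).
apply: le_trans (l2normD _ _) _.
apply: le_trans (lerD (_ : _ <= 2 * q ^+ n * l2norm x) (_ : _ <= q ^+ n * l2norm x)) _.
- apply: up_le; first exact: sub_bounded (wb_bp hq) wb_limit.
    by rewrite mulr_ge0.
  move=> s /(in_region hx) /andP[h1 h2]; have [sa sb] := idx_le s.
  rewrite /wt /limit_weight opprK; apply: le_trans (b_plus_approx sa sb) _.
  by rewrite ler_wpM2l // q_exp_le //; lia.
- apply: dn_le => //; [exact: ush_inj|exact: wb_bm|].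
  move=> s /(in_region hx); rewrite region_ush => /andP[h1 h2]; have [sa sb] := idx_le s.
  by apply: le_trans (bm_le hq sa sb) _; rewrite q_exp_le //; lia.
- apply: le_trans (_ : 3 * q ^+ n * l2norm x <= _); first by lra.
  by rewrite ler_wpM2r ?l2norm_ge0.
Qed.

Lemma betaS_asymp : asymp k (betaS q) betaS_lim.
Proof.
move=> e /small[n hn]; exists (n + k.+1)%N => x hx.
have qn : 0 <= q ^+ n by rewrite exprn_ge0.
rewrite /betaS addrAC (dn_sub _ (@ush_inj _ _) (wb_bp hq) wb_limit).
apply: le_trans (l2normD _ _) _.
apply: le_trans (lerD (_ : _ <= 2 * q ^+ n * l2norm x) (_ : _ <= q ^+ n * l2norm x)) _.
- apply: dn_le; [exact: ush_inj|exact: sub_bounded (wb_bp hq) wb_limit|by rewrite mulr_ge0|].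
  move=> s /(in_region hx); rewrite region_ush => /andP[h1 h2]; have [sa sb] := idx_le s.
  rewrite /wt /limit_weight opprK; apply: le_trans (b_plus_approx sa sb) _.
  by rewrite ler_wpM2l // q_exp_le //; lia.
- apply: up_le => //; first exact: wb_bm.
  move=> s /(in_region hx) /andP[h1 h2]; have [sa sb] := idx_le s.
  by apply: le_trans (bm_le hq sa sb) _; rewrite q_exp_le //; lia.
- apply: le_trans (_ : 3 * q ^+ n * l2norm x <= _); first by lra.
  by rewrite ler_wpM2r ?l2norm_ge0.
Qed.

End BetaAsymptotics.

(** * The model operator *)

Section Model.
Context {R : realType} (k : nat).
Local Notation H := (l2 R idx).
Implicit Types (x y : H).

Definition edge_shift (t : idx) : idx := if (val t).2 == 0%N then ush true false t else t.

Lemma edge_shift_col t : (val (edge_shift t)).2 = (val t).2.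
Proof. by rewrite /edge_shift; case: eqP => //= _; rewrite addn0. Qed.

Lemma edge_shift_inj : injective edge_shift.
Proof.
move=> s t h; have := congr1 (fun u : idx => (val u).2) h; rewrite !edge_shift_col => e.
by move: h; rewrite /edge_shift e; case: eqP => // _ /ush_inj.
Qed.

Definition edge_weight (t : idx) : R := if (val t).2 == 0%N then -1 else 1.

Lemma edge_weight1 t : `|edge_weight t| <= 1.
Proof. by rewrite /edge_weight; case: eqP; rewrite ?normrN normr1. Qed.

Lemma wb_edge : weight_bounded edge_weight.
Proof. by exists 1 => t; exact: edge_weight1. Qed.

(** The limit of gamma with q^(2 b r) replaced by 0 for b > 0: minus the shift
    a |-> a + 1, N |-> N + 1 on the edge b = 0, and the identity elsewhere.  It is
    written as a single shift along an injection, so that it is an isometry. *)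
Definition model : H -> H := up edge_shift edge_weight.
Definition model_inv : H -> H := dn edge_shift edge_weight.

Lemma model_invK x : model_inv (model x) = x.
Proof.
apply: l2_ext => t; rewrite /model_inv (dnE edge_shift_inj wb_edge) /model (up_in edge_shift_inj wb_edge).
by rewrite mulrA -rmorphM /edge_weight; case: eqP => _; rewrite ?mulrNN mulr1 rmorph1 mul1r.
Qed.

Lemma model_inv_le x : l2norm (model_inv x) <= l2norm x.
Proof.
rewrite -[leRHS]mul1r; apply: (dn_le edge_shift_inj wb_edge) => // s _.
exact: edge_weight1.
Qed.

Lemma model_linear : linear model.
Proof. exact: up_linear wb_edge. Qed.

Lemma model_inv_linear : linear model_inv.
Proof. exact: dn_linear edge_shift_inj wb_edge. Qed.

Lemma model_stable : stable k model.
Proof.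
move=> n x hx t ht; case: (pselect (exists s, edge_shift s = t)) => [[s st]|h].
  rewrite -st /model (up_in edge_shift_inj wb_edge) hx ?mulr0 //.
  apply: contra ht; rewrite -st /region /edge_shift; case: eqP => //= _.
  by move=> /andP[h1 h2]; apply/andP; split; lia.
by apply: up_out => [|s st]; [exact: wb_edge|apply: h; exists s].
Qed.

End Model.

Section GammaLimit.
Context {R : realType} (q : R) (hq : 0 < q < 1) (k r : nat).
Local Notation H := (l2 R idx).
Implicit Types (x y : H).

Let q0 : 0 <= q. Proof. by case/andP: hq => /ltW. Qed.

Let B := @beta_lim R q.
Let B' := @betaS_lim R q.

Let bB : bounded B. Proof. exact: bounded_up (@ush_inj _ _) (wb_limit hq). Qed.
Let bB' : bounded B'. Proof. exact: bounded_dn (@ush_inj _ _) (wb_limit hq). Qed.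

Let B'BE x t : B' (B x) t = (q ^+ (2 * (val t).2))%:C%C * x t.
Proof.
rewrite /B' /betaS_lim (dnE (@ush_inj _ _) (wb_limit hq)) /B /beta_lim.
rewrite (up_in (@ush_inj _ _) (wb_limit hq)) mulrA -rmorphM /wt /limit_weight mulrNN -exprD.
by rewrite mul2n addnn.
Qed.

Let iterE x t : iter r (B' \o B) x t = (q ^+ (2 * (val t).2 * r))%:C%C * x t.
Proof.
elim: r => [|j IH]; first by rewrite muln0 expr0 mul1r.
by rewrite iterS [LHS]B'BE IH mulrA -rmorphM -exprD mulnS.
Qed.

Let B_stable : stable k B.
Proof.
move=> n x hx t ht; case: (pselect (exists s, ush true false s = t)) => [[s st]|h].
  rewrite -st /B /beta_lim (up_in (@ush_inj _ _) (wb_limit hq)) hx ?mulr0 //.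
  apply: contra ht; rewrite -st region_ush => /andP[h1 h2]; apply/andP; split; lia.
by apply: up_out => [|s st]; [exact: wb_limit|apply: h; exists s].
Qed.

Definition gamma_lim x : H := iter r (B' \o B) (B x - x) + x.

Lemma gamma_lim_stable : stable k gamma_lim.
Proof.
move=> n x hx t ht; rewrite l2DE iterE l2DE l2NE (hx t ht) (B_stable hx ht).
by rewrite subrr mulr0 addr0.
Qed.

Lemma gammaE x : gamma q r x = iter r (betaS q \o beta q) (beta q x - x) + x.
Proof. by rewrite /gamma (adj_beta hq). Qed.

Lemma gamma_asymp : asymp k (gamma q r) gamma_lim.
Proof.
have bb := bounded_beta hq; have bbS := bounded_betaS hq.
have h1 := beta_asymp hq k; have h2 := betaS_asymp hq k.
have sD : stable k (fun x => B x - x).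
  by move=> n x hx t ht; rewrite l2DE l2NE hx // (B_stable hx ht) subrr.
have sQ : stable k (B' \o B).
  by move=> n x hx t ht; rewrite [LHS]B'BE hx // mulr0.
have bD : bounded (fun x => B x - x) by apply: boundedB => //; exact: bounded_id.
have hD : asymp k (fun x => beta q x - x) (fun x => B x - x).
  by apply: asympD h1 _; apply: asympN; exact: asympxx.
have hQ := asympM bbS bB B_stable h2 h1.
have hI := asymp_iter r (bounded_comp bbS bb) (bounded_comp bB' bB) sQ hQ.
have := asympD (asympM (bounded_iter r (bounded_comp bbS bb)) bD sD hI hD) (asympxx k (@id H)).
have -> : gamma q r = (fun x => iter r (betaS q \o beta q) (beta q x - x) + x).
  by apply/funext; exact: gammaE.
exact.
Qed.

(** The two operators agree on the edge b = 0; for b > 0 they differ by q^(2 b r) (B - 1). *)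
Lemma gamma_lim_model x : l2norm (gamma_lim x - model x) <= 2 * q ^+ (2 * r) * l2norm x.
Proof.
pose F := [set t : idx | (val t).2 != 0%N].
have B1 x' : l2norm (B x') <= l2norm x'.
  rewrite -[leRHS]mul1r; apply: up_le => // [|s _]; first exact: wb_limit.
  by rewrite normrN ger0_norm ?exprn_ge0 //; have /andP[] := q_exp01 hq (val s).2.
have BE x' t : (forall s, ush true false s = t -> x' s = 0) -> B x' t = 0.
  move=> h; rewrite /B /beta_lim (upE _ (wb_limit hq)); case E: partial_inv => [s|] //.
  by rewrite (h s) ?mulr0 //; exact: partial_invP.
set z := B (cutoff F x) - cutoff F x.
have zb t : (val t).2 = 0%N -> z t = 0.
  move=> t0; rewrite l2DE l2NE cutoffE memNset /F /= ?t0 // subr0 BE // => s st.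
  rewrite cutoffE memNset //=; have := congr1 (fun u : idx => (val u).2) st.
  by rewrite t0 /= addn0 => ->.
have -> : gamma_lim x - model x = iter r (B' \o B) z.
  apply: l2_ext => t; rewrite iterE l2DE l2NE l2DE iterE.
  have [t0|t0] := eqVneq (val t).2 0%N.
    rewrite zb // t0 muln0 mul0n expr0 mul1r mulr0 l2DE l2NE subrK.
    case: (pselect (exists s, ush true false s = t)) => [[s st]|h].
      have s0 : (val s).2 = 0%N.
        by have := congr1 (fun u : idx => (val u).2) st; rewrite /= addn0 t0.
      have es : edge_shift s = t by rewrite /edge_shift s0.
      rewrite -{1}st -es /B /beta_lim (up_in (@ush_inj _ _) (wb_limit hq)).
      rewrite /model (up_in edge_shift_inj wb_edge) /edge_weight /wt /limit_weight s0 eqxx.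
      by rewrite expr0 subrr.
    rewrite BE; last by move=> s st; case: h; exists s.
    rewrite /model (up_out wb_edge) ?subrr // => s st; apply: h; exists s.
    by move: st (edge_shift_col s) => st; rewrite st t0 -st /edge_shift => <-.
  have mt : model x t = x t.
    have {1}-> : t = edge_shift t by rewrite /edge_shift (negbTE t0).
    by rewrite /model (up_in edge_shift_inj wb_edge) /edge_weight (negbTE t0) rmorph1 mul1r.
  rewrite mt addrK; congr (_ * _); rewrite !l2DE !l2NE cutoffE mem_set //.
  congr (_ - _); apply/eqP; rewrite -subr_eq0 -l2NE -l2DE -(linB _ _ (proj1 bB)).
  apply/eqP; apply: BE => s st.
  have sc : (val s).2 = (val t).2.
    by have := congr1 (fun u : idx => (val u).2) st; rewrite /= addn0.
  by rewrite l2DE l2NE cutoffE mem_set; [rewrite subrr|move: t0; rewrite -sc].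
have hz : l2norm z <= 2 * l2norm x.
  apply: le_trans (l2normB _ _) _; have := B1 (cutoff F x); have := cutoff_le F x; lra.
apply: le_trans (_ : q ^+ (2 * r) * l2norm z <= _).
  apply: l2norm_le_coord => [|t]; first exact: exprn_ge0.
  rewrite iterE normcM normcR ger0_norm ?exprn_ge0 //.
  have [t0|t0] := eqVneq (val t).2 0%N; first by rewrite zb // normc0 !mulr0.
  by rewrite ler_wpM2r ?normc_ge0 // q_exp_le //; nia.
by have := ler_wpM2l (exprn_ge0 (2 * r) q0) hz; lra.
Qed.

End GammaLimit.

(** * Index of a compression *)

Section Range.
Context {R : realType} {I : choiceType}.

Lemma cutoffK (F : set I) (x : l2 R I) : cutoff F (cutoff F x) = cutoff F x.
Proof. by apply: l2_ext => t; rewrite !cutoffE; case: ifP => // ->. Qed.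

Lemma range_cutoff (F : set I) (x : l2 R I) : range (cutoff F) x <-> cutoff F x = x.
Proof. by split=> [[y _ <-]|<-]; [exact: cutoffK|exists x]. Qed.

End Range.

Section Compression.
Context {R : realType} {I : choiceType} (F : set I).
Local Notation H := (l2 R I).
Implicit Types (x y v : H).

Let P : H -> H := cutoff F.
Let lP : linear P. Proof. exact: cutoff_linear. Qed.
Let PK x : P (P x) = P x. Proof. exact: cutoffK. Qed.

Context (C : H -> H) (lC : linear C).
Context (k : nat) (b : 'I_k -> H) (bV : forall i, P (b i) = b i).

Let A x := P (C (P x)).
Let lA : linear A. Proof. by move=> c x y; rewrite /A lP lC lP. Qed.

(** The b i form a basis of an algebraic complement in the range of P of the image of
    the compression A. *)
Definition complementary :=
  (forall v (c : 'I_k -> R[i]), P v = v -> \sum_i c i *: b i = A v -> forall i, c i = 0) /\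
  (forall y, P y = y -> exists c v, P v = v /\ y = \sum_i c i *: b i + A v).

Section Shift.
Context (T L : H -> H) (lT : linear T) (lL : linear L) (rho : R).
Context (rho01 : 0 <= rho < 1).
Context (TV : forall x, P x = x -> P (T x) = T x).
Context (LT : forall x, L (T x) = x) (L1 : forall x, l2norm (L x) <= l2norm x).
Context (CT : forall x, P x = x -> l2norm (C x - T x) <= rho * l2norm x).
Context (bL : forall i, P (L (b i)) = 0).
Context (bfree : forall c : 'I_k -> R[i], \sum_i c i *: b i = 0 -> forall i, c i = 0).
Context (bspan : forall z, P z = z -> P (L z) = 0 -> exists c, z = \sum_i c i *: b i).

Let K x := P (L (T (P x) - A x)).

Let lK : linear K.
Proof.
move=> c x y; rewrite /K -lP -lL; congr (P (L _)).
by rewrite lA lP lT; l2ring.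
Qed.

Let K_le x : l2norm (K x) <= rho * l2norm x.
Proof.
apply: le_trans (cutoff_le _ _) _; apply: le_trans (L1 _) _.
have -> : T (P x) - A x = - P (C (P x) - T (P x)).
  by rewrite (linB _ _ lP) (TV (PK x)) opprB.
rewrite l2normN; apply: le_trans (cutoff_le _ _) _; apply: le_trans (CT (PK x)) _.
by rewrite ler_wpM2l ?cutoff_le //; case/andP: rho01.
Qed.

Let KE x : P x = x -> x - K x = P (L (A x)).
Proof.
by move=> xV; rewrite /K (linB _ _ lL) (linB _ _ lP) xV LT xV opprB addrC subrK.
Qed.

(** P L inverts A up to the contraction K, so A is injective and the range of A
    is complementary to the kernel of P L. *)
Lemma compression_shift : (forall x, P x = x -> A x = 0 -> x = 0) /\ complementary.
Proof.
have [S [lS KS SK _ _]] := neumann lK rho01 K_le.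
have inj x : P x = x -> A x = 0 -> x = 0.
  move=> xV Ax; have := KE xV; rewrite Ax (lin0 lL) (lin0 lP) => h.
  by rewrite -(SK x) h (lin0 lS).
split=> //; split=> [v c vV E|y yV].
  have h : P (L (\sum_i c i *: b i)) = 0.
    rewrite (lin_sum _ _ lL) (lin_sum _ _ lP) big1 // => i _.
    by rewrite (linZ _ _ lL) (linZ _ _ lP) bL scaler0.
  have v0 : v = 0 by rewrite -(SK v) (KE vV) -E h (lin0 lS).
  by apply: bfree; rewrite E v0 (lin0 lA).
set v := S (P (L y)).
have Ev : v - K v = P (L y) by exact: KS.
have vV : P v = v.
  have -> : v = P (L y) + K v by rewrite -Ev subrK.
  by rewrite (linD _ _ lP) /K !PK.
have zV : P (y - A v) = y - A v by rewrite (linB _ _ lP) yV /A PK.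
have zL : P (L (y - A v)) = 0.
  by rewrite (linB _ _ lL) (linB _ _ lP) -(KE vV) Ev subrr.
by have [c hc] := bspan zV zL; exists c, v; rewrite -hc subrK.
Qed.

End Shift.

Lemma index_injective : (forall x, P x = x -> A x = 0 -> x = 0) -> complementary ->
  fredholm_index (range P) A (- k%:Z).
Proof.
move=> inj [free span]; exists 0%N, k; split.
- by move=> x _; exists (C (P x)).
- exists (fun=> 0); split=> [[] //|c _ [] //|x [/range_cutoff xV Ax]].
  by exists (fun=> 0) => /=; rewrite (inj _ xV Ax) big_ord0 subrr.
- exists b; split=> [i|c [v /range_cutoff vV /esym E]|y /range_cutoff yV].
  + by apply/range_cutoff.
  + exact: free E.
  + have [c [v [vV ->]]] := span _ yV; exists c; exists v.
      by apply/range_cutoff.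
    by rewrite addrAC subrr add0r.
- by rewrite sub0r.
Qed.

Section Complement.
Context (D : H -> H) (lD : linear D) (CD : forall x, C (D x) = x) (DC : forall x, D (C x) = x).
Context (M e : R) (M0 : 0 <= M) (e0 : 0 <= e) (DM : bounded_by D M) (eM : M * e < 1).
Context (small : forall x, P x = x -> l2norm (C x - P (C x)) <= e * l2norm x).

Let Q : H -> H := cutoff (~` F).
Let QE x : Q x = x - P x.
Proof. by apply: (canRL (addrK _)); rewrite addrC -cutoffC. Qed.
Let lQ : linear Q. Proof. exact: cutoff_linear. Qed.
Let QP x : Q (P x) = 0. Proof. by rewrite QE PK subrr. Qed.

(** Removing from C the small corner Q C P leaves an invertible G which preserves
    the range of P, and which has the same compression to the range of Q. *)
Let G x := C x - Q (C (P x)).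

Let lG : linear G.
Proof. by move=> c x y; rewrite /G lP !lC lQ; l2ring. Qed.

Let G_inverse : exists S, [/\ linear S, forall x, G (S x) = x & forall x, S (G x) = x].
Proof.
pose K x := D (Q (C (P x))).
have lK : linear K by move=> c x y; rewrite /K lP lC lQ lD.
have K_le x : l2norm (K x) <= M * e * l2norm x.
  apply: le_trans (DM _) _; rewrite -mulrA ler_wpM2l // QE.
  apply: le_trans (small (PK x)) _.
  by rewrite ler_wpM2l ?cutoff_le.
have Me : 0 <= M * e < 1 by rewrite mulr_ge0.
have [S [lS KS SK _ _]] := neumann lK Me K_le.
have GK x : G x = C (x - K x) by rewrite (linB _ _ lC) CD.
exists (S \o D); split=> [|x|x /=]; first exact: lin_comp.
  by rewrite GK /= KS CD.
by rewrite GK DC SK.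
Qed.

Let GV v : P v = v -> G v = A v.
Proof. by move=> vV; rewrite /G /A QE vV opprB addrC subrK. Qed.

Let QG x : Q (G x) = Q (C (Q x)).
Proof.
by rewrite (linB _ _ lQ) [Q (Q _)]cutoffK -(linB _ _ lQ) -(linB _ _ lC) -QE.
Qed.

Let QGP x : Q (G (P x)) = 0.
Proof. by rewrite (GV (PK x)) QP. Qed.

Let PQ0 x : Q x = 0 -> P x = x.
Proof. by rewrite QE => /eqP; rewrite subr_eq0 => /eqP. Qed.

(** The compression to the range of Q is Q G, which kills the range V of P.  Since G
    preserves V, it is onto, and its kernel Q G^-1 V is isomorphic to V / G V. *)
Lemma index_complement : complementary -> fredholm_index (range Q) (Q \o C \o Q) k%:Z.
Proof.
move=> [free span]; have [S [lS GS SG]] := G_inverse.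
have TE x : (Q \o C \o Q) x = Q (G x) by rewrite QG.
have QGQ x : Q (G (Q x)) = Q (G x).
  have -> : G (Q x) = G x - G (P x) by rewrite -(linB _ _ lG) -QE.
  by rewrite (linB _ _ lQ) QGP subr0.
have Qb i : Q (b i) = 0 by rewrite -bV QP.
exists k, 0%N; split.
- by move=> x _; exists (C (Q x)).
- exists (fun i => Q (S (b i))); split.
  + by move=> i; split; [exists (S (b i))|rewrite TE QGQ GS Qb].
  + move=> c /= E.
    have Qw : Q (S (\sum_i c i *: b i)) = 0.
      rewrite (lin_sum _ _ lS) (lin_sum _ _ lQ) -[RHS]E; apply: eq_bigr => i _.
      by rewrite (linZ _ _ lS) (linZ _ _ lQ).
    have wV := PQ0 Qw.
    by apply: (free _ _ wV); rewrite -(GV wV) GS.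
  + move=> x [/range_cutoff xQ]; rewrite TE => /PQ0 yV.
    have [c [v [vV E]]] := span _ yV; exists c => /=.
    have Sx : x - v = S (\sum_i c i *: b i).
      by rewrite -(SG (x - v)) (linB _ _ lG) E (GV vV) addrK.
    have Qv : Q v = 0 by rewrite -vV QP.
    have -> : x = Q (S (\sum_i c i *: b i)) by rewrite -Sx (linB _ _ lQ) Qv subr0 /Q xQ.
    rewrite (lin_sum _ _ lS) (lin_sum _ _ lQ).
    apply/eqP; rewrite subr_eq0; apply/eqP; apply: eq_bigr => i _.
    by rewrite (linZ _ _ lS) (linZ _ _ lQ).
- exists (fun=> 0); split=> [[] //|c _ [] //|x /range_cutoff xQ].
  exists (fun=> 0); rewrite big_ord0 subr0; exists (Q (S x)); first by exists (S x).
  by rewrite TE QGQ GS.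
- by rewrite subr0.
Qed.

End Complement.

End Compression.

(** * The pairing *)

Section Edge.
Context {R : realType} (k n : nat) (kn : (k <= n)%N).
Local Notation H := (l2 R idx).
Local Notation F := [set t : idx | region n k t].

Let vertex_proof (i : 'I_k) : ((n - i <= n) && (0 <= n))%N.
Proof. by rewrite leq_subr. Qed.

(** The points of the region that are not images of points of the region under
    [edge_shift]; they index a basis of the cokernel. *)
Definition vertex (i : 'I_k) : idx := Sub (n, n - i, 0)%N (vertex_proof i).

Lemma l2_sumE (c : 'I_k -> R[i]) (v : 'I_k -> H) t :
  (\sum_i c i *: v i) t = \sum_i c i * v i t.
Proof.
by apply: (big_ind2 (fun (z : H) u => z t = u)) => // z u z' u' <- <-.
Qed.

Lemma vertex_inj : injective vertex.
Proof.
move=> i j /(congr1 (fun u : idx => (val u).1.2)) /= h; apply: val_inj => /=.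
have := ltn_ord i; have := ltn_ord j; lia.
Qed.

Lemma region_vertex i : region n k (vertex i).
Proof. by rewrite /region /= leqnn; have := ltn_ord i; lia. Qed.

Lemma edge_shift_out t i : region n k t -> edge_shift t <> vertex i.
Proof.
move=> /andP[h1 h2] E; have := edge_shift_col t; rewrite E /= => t0.
have := congr1 (fun u : idx => (val u).1.1) E.
by rewrite /edge_shift -t0 /= => e; move: h1; rewrite -[X in (X <= _)%N]e ltnn.
Qed.

Lemma region_split t : region n k t ->
  (exists i, t = vertex i) \/ exists2 s, region n k s & t = edge_shift s.
Proof.
move=> rt; have /andP[h1 h2] := rt.
have [t0|t0] := eqVneq (val t).2 0%N; last first.
  by right; exists t => //; rewrite /edge_shift (negbTE t0).
case: t rt h1 h2 t0 => [[[N a] b] ht] /= rt h1 h2 t0.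
have /andP[/= aN _] := ht; subst b.
have [nN|nN] := ltnP n N; last first.
  left; have hi : (N - a < k)%N by [].
  by exists (Ordinal hi); apply: val_inj => /=; congr (_, _, _); lia.
right; have hs : ((a.-1 <= N.-1) && (0 <= N.-1))%N by lia.
exists (Sub (N.-1, a.-1, 0)%N hs); first by rewrite /region /=; lia.
by apply: val_inj; rewrite /edge_shift /=; congr (_, _, _); lia.
Qed.

Let b i : H := evec (vertex i).

Lemma vertex_sum (c : 'I_k -> R[i]) j : (\sum_i c i *: b i) (vertex j) = c j.
Proof.
rewrite l2_sumE (bigD1 j) // /b evecE eqxx mulr1 big1 => [|i ij]; first exact: addr0.
by rewrite evecE (inj_eq vertex_inj) eq_sym (negbTE ij) mulr0.
Qed.

Lemma vertex_sum_out (c : 'I_k -> R[i]) t : (forall i, t <> vertex i) ->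
  (\sum_i c i *: b i) t = 0.
Proof.
move=> h; rewrite l2_sumE big1 // => i _.
by rewrite /b evecE; case: eqP => [/h//|_]; rewrite mulr0.
Qed.

Lemma vertex_in i : cutoff F (b i) = b i.
Proof.
apply: l2_ext => t; rewrite cutoffE; case: ifPn => // /negP h.
rewrite /b evecE; case: eqP => // E; case: h.
by rewrite E mem_set //; exact: region_vertex.
Qed.

Lemma vertex_kernel i : cutoff F (model_inv (b i)) = 0.
Proof.
apply: l2_ext => t; rewrite cutoffE; case: ifPn => // /set_mem h.
rewrite /model_inv (dnE edge_shift_inj (@wb_edge R)) /b evecE.
by case: eqP => [/(edge_shift_out h)//|_]; rewrite mulr0.
Qed.

Lemma vertex_free (c : 'I_k -> R[i]) : \sum_i c i *: b i = 0 -> forall i, c i = 0.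
Proof. by move=> h i; rewrite -(vertex_sum c i) h. Qed.

Lemma vertex_span (z : H) : cutoff F z = z -> cutoff F (model_inv z) = 0 ->
  exists c, z = \sum_i c i *: b i.
Proof.
move=> zF zL; exists (fun i => z (vertex i)); apply: l2_ext => t.
have [rt|nt] := boolP (region n k t); last first.
  rewrite vertex_sum_out; last by move=> i ti; rewrite ti region_vertex in nt.
  by rewrite -zF cutoffE memNset //; exact/negP.
have [[i ->]|[s rs ->]] := region_split rt; first by rewrite vertex_sum.
rewrite vertex_sum_out; last by move=> i; exact: edge_shift_out.
have := congr1 (fun u : H => u s) zL; rewrite cutoffE mem_set //.
rewrite /model_inv (dnE edge_shift_inj (@wb_edge R)) /edge_weight.
by case: ifP => _ /=; rewrite ?rmorphN1 ?rmorph1 ?mulN1r ?mul1r // => /eqP; rewrite oppr_eq0 => /eqP.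
Qed.

End Edge.

Section GammaSUq2.
Context {R : realType} (q : R) (hq : 0 < q < 1) (r : nat) (hr : q ^+ (2 * r) < 1 / 2).
Local Notation H := (l2 R idx).

Let beta_in : star_alg [set alpha q; beta q] (beta q).
Proof. by apply: star_alg_gen; right. Qed.

Let betaS_in : star_alg [set alpha q; beta q] (betaS q).
Proof. by rewrite -(adj_beta hq); exact: star_alg_adj beta_in. Qed.

Lemma gamma_in_SUq2 : SUq2 q (gamma q r).
Proof.
have h := star_alg_gamma r beta_in betaS_in.
have -> : gamma q r = (fun x => iter r (fun x => betaS q (beta q x)) (beta q x - x) + x).
  by apply/funext => x; rewrite (gammaE hq).
apply: op_closure_alg h => //.
have bc := bounded_comp (bounded_betaS hq) (bounded_beta hq).
have bg := boundedD (bounded_comp (bounded_iter r bc)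
  (boundedB (bounded_beta hq) (@bounded_id R idx))) (@bounded_id R idx).
exact: (proj1 bg).
Qed.

Lemma gamma_invertible : exists S, [/\ SUq2 q S, bounded S,
  forall x, gamma q r (S x) = x & forall x, S (gamma q r x) = x].
Proof.
have s0 : 0 <= q ^+ 2 by rewrite sqr_ge0.
have sr : 2 * (q ^+ 2) ^+ r < 1 by rewrite -exprM; move: hr; move: (q ^+ _) => z; lra.
have [S [h1 h2 h3 h4]] := gamma_inverse (bounded_alphaS hq)
  (bounded_beta hq) (bounded_betaS hq) (adjoint_alpha hq) (adjoint_beta hq)
  (sphere_relation hq) (second_relation hq) (beta_normal hq) s0 sr beta_in betaS_in.
exists S; split; [exact: h1|exact: h2|move=> x|move=> x].
  exact: (etrans (gammaE hq r (S x)) (h3 x)).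
exact: (etrans (congr1 S (gammaE hq r x)) (h4 x)).
Qed.

End GammaSUq2.

Theorem proposition4p4 (R : realType) (q : R) (hq : 0 < q < 1)
  (r : nat) (hr : q ^+ (2 * r) < 1 / 2 < q ^+ (2 * r - 2)) (m : int) :
  exists D : set (l2 R idx * l2 R idx),
    [/\ odd_spectral_triple (SUq2_poly q) D,
        equivariant q D &
        index_pairing (SUq2 q) (gamma q r) D m].
Proof.
have /andP[hr1 _] := hr.
have [S [SA [lS [M M0 SM]] gS Sg]] := gamma_invertible hq hr1.
have gA := gamma_in_SUq2 hq r.
have lg : linear (gamma q r) := proj1 gA.
have [kneg kpos] : (m < 0 -> m = - `|m|%N%:Z) /\ (0 <= m -> m = - - `|m|%N%:Z) by lia.
set k := `|m|%N in kneg kpos *; set rho := 2 * q ^+ (2 * r).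
have rho0 : 0 <= rho by rewrite mulr_ge0 // exprn_ge0 //; case/andP: hq => /ltW.
have rho1 : rho < 1 by rewrite /rho; move: hr1; move: (q ^+ _) => z; lra.
(* Both e + rho < 1, for the distance to the model, and e M < 1, for the corner Q gamma P,
   are needed; M bounds the inverse of gamma. *)
pose e := (1 - rho) / 2 / (M + 1).
have e0 : 0 < e by rewrite !divr_gt0 ?subr_gt0 // ltr_wpDl.
have eE : e * M + e = (1 - rho) / 2.
  by rewrite -[X in _ + X]mulr1 -mulrDr /e divfK // gt_eqF // ltr_wpDl.
have eM0 : 0 <= e * M by rewrite mulr_ge0 // ltW.
have [n0 hn0] := gamma_asymp hq k r e0.
set n := maxn n0 k; have kn : (k <= n)%N by exact: leq_maxr.
pose F := [set t : idx | region n k t].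
have Fsupp (x : l2 R idx) : cutoff F x = x -> supported k n x.
  by move=> <- t nt; rewrite cutoffE memNset //; exact/negP.
have close (x : l2 R idx) : cutoff F x = x -> l2norm (gamma q r x - gamma_lim q r x) <= e * l2norm x.
  by move=> /Fsupp hx; apply: hn0; apply: supported_mono hx; exact: leq_maxl.
have stableF (T : l2 R idx -> l2 R idx) : stable k T -> forall x, cutoff F x = x -> cutoff F (T x) = T x.
  move=> sT x /Fsupp/sT hx; apply: l2_ext => t; rewrite cutoffE.
  by case: ifPn => //; rewrite notin_setE => /negP/hx.
have CT (x : l2 R idx) : cutoff F x = x -> l2norm (gamma q r x - model x) <= (e + rho) * l2norm x.
  move=> hx; have := close x hx; have := gamma_lim_model hq r x; rewrite -/rho.
  have -> : gamma q r x - model x =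
      (gamma q r x - gamma_lim q r x) + (gamma_lim q r x - model x) by l2ring.
  by move=> h1 h2; apply: le_trans (l2normD _ _) _; lra.
have small (x : l2 R idx) : cutoff F x = x ->
    l2norm (gamma q r x - cutoff F (gamma q r x)) <= e * l2norm x.
  move=> hx; apply: le_trans (close x hx).
  have hl := stableF _ (@gamma_lim_stable R q hq k r) x hx.
  have lc := @cutoff_linear R _ F.
  apply: le_trans (cutoff_le (~` F) _).
  have -> : gamma q r x - cutoff F (gamma q r x) =
      cutoff (~` F) (gamma q r x - gamma_lim q r x); last by [].
  have QE (z : l2 R idx) : cutoff (~` F) z = z - cutoff F z.
    by apply: (canRL (addrK _)); rewrite addrC -cutoffC.
  by rewrite QE (linB _ _ lc) hl; l2ring.
have er01 : 0 <= e + rho < 1 by apply/andP; split; lra.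
have [inj compl] := compression_shift lg (@model_linear R)
  (@model_inv_linear R) er01 (stableF _ (@model_stable R k)) (@model_invK R)
  (@model_inv_le R) CT (vertex_kernel n) (vertex_free kn) (vertex_span kn).
pose d := @dirac_eig R n k (m < 0); exists (diagD d); split.
- exact: dirac_triple.
- by apply: diagD_equivariant; exact: dirac_level.
split; first by split; [exact: gA|exists S; split; [exact: SA|apply/funext|apply/funext]].
exists (signD d), (cutoff [set t | d t < 0]).
have PD := cutoff_orth_proj d.
have [m0|m0] := ltrP m 0.
- have E : [set t | d t < 0] = ~` F.
    by apply/seteqP; split=> t /=; rewrite dirac_lt0 m0 addbT => /negP.
  exists k%:Z; split; [exact: signD_is_sign|exact: PD| |exact: kneg].
  rewrite E; apply: (index_complement lg (fun i => vertex_in kn i) lS gS Sg M0 (ltW e0) SM _ small compl).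
  by rewrite mulrC; lra.
- have E : [set t | d t < 0] = F.
    by apply/seteqP; split=> t /=; rewrite dirac_lt0 ltNge m0 addbF.
  exists (- k%:Z); split; [exact: signD_is_sign|exact: PD| |exact: kpos].
  rewrite E; apply: (index_injective (fun i => vertex_in kn i) inj compl).
Qed.
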